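(* Let $k\in\mathbb{N}$ and suppose that the sequence $(\ell_{n,k})_{n\in\mathbb{N}_0}$ is square-summable. Then for every $t\in\mathbb{R}$, $$\zeta^k\!\left(\tfrac12+it\right)=\sum_{n\ge -k}\ell_{n,k}\left(\frac{\frac12-it}{\frac12+it}\right)^n,$$ the series converging (as the limit of its partial sums over $-k\le n\le N$, $N\to\infty$). In particular, if the Lindelöf Hypothesis is true, this expansion holds for every $k\in\mathbb{N}$ and every $t\in\mathbb{R}$.
   Context: $\zeta$ denotes the Riemann zeta function. For $k\in\mathbb{N}$, $\lambda_{j,k}$ ($j\in\mathbb{N}_0$) are defined by $(s-1)^k\zeta^k(s)=\sum_{j\ge0}\frac{\lambda_{j,k}}{j!}(s-1)^j$ for $|s-1|\le1$, and $\ell_{n,k}=(-1)^n\sum_{j=1}^n\binom{n-1}{j-1}\frac{\lambda_{j+k,k}}{(j+k)!}$ for $n\ge1$, $\ell_{n,k}=(-1)^k\sum_{j=0}^{k+n}\binom{k-j}{-n}(-1)^j\frac{\lambda_{j,k}}{j!}$ for $-k\le n\le 0$. The Lindelöf Hypothesis is the statement $\zeta(\frac12+it)=O(|t|^\varepsilon)$ for every $\varepsilon>0$. *)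

(* Defs.v *)
From Stdlib Require Import Reals ZArith ClassicalEpsilon.
From Coquelicot Require Import Coquelicot.
Open Scope R_scope.

Definition cpow_pos (x : R) (s : C) : C :=
  (exp (Re s * ln x) * cos (Im s * ln x), exp (Re s * ln x) * sin (Im s * ln x)).

Definition eta_term (s : C) (n : nat) : C :=
  Cmult (RtoC ((-1) ^ n)) (cpow_pos (INR (S n)) (Copp s)).

(* eta(s): the sum of the (conditionally) convergent alternating series,
   computed componentwise; it converges for Re s > 0. *)
Definition eta (s : C) : C :=
  (Series (fun n => Re (eta_term s n)), Series (fun n => Im (eta_term s n))).

(* Riemann zeta via  zeta(s) = eta(s) / (1 - 2^(1-s)),  valid for Re s > 0
   away from the zeros of 1 - 2^(1-s) (which for Re s > 0 are
   s = 1 + 2 pi i m / ln 2; the only one with |s-1| < 1 is s = 1). *)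
Definition zeta (s : C) : C :=
  Cdiv (eta s) (Cminus (RtoC 1) (cpow_pos 2 (Cminus (RtoC 1) s))).

Definition Gk (k : nat) (s : C) : C :=
  Cpow (Cmult (Cminus s (RtoC 1)) (zeta s)) k.

(* The Taylor coefficients lambda_{j,k}/j! of (s-1)^k zeta^k(s) at s = 1:
   the (unique) sequence c with  sum_j c_j (s-1)^j = (s-1)^k zeta^k(s)
   on the punctured disk 0 < |s-1| < 1. *)
Definition is_taylor_coef (k : nat) (c : nat -> C) : Prop :=
  forall s : C, 0 < Cmod (Cminus s (RtoC 1)) < 1 ->
    is_series (V := C_NormedModule)
      (fun j => Cmult (c j) (Cpow (Cminus s (RtoC 1)) j)) (Gk k s).

Definition lam_over_fact (k : nat) : nat -> C :=
  epsilon (inhabits (fun _ => RtoC 0)) (is_taylor_coef k).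

Definition lam (j k : nat) : C := Cmult (RtoC (INR (fact j))) (lam_over_fact k j).

(* ell_{n,k}, n : Z (taken to be 0 for n < -k, where it is not used). *)
Definition ell (n : Z) (k : nat) : C :=
  if (0 <? n)%Z then
    let m := Z.to_nat n in
    Cmult (RtoC ((-1) ^ m))
      (sum_n (fun i => (* j = i+1, j from 1 to m *)
         Cmult (RtoC (Binomial.C (m - 1) i))
               (Cdiv (lam (S i + k) k) (RtoC (INR (fact (S i + k))))))
         (m - 1))
  else if (- Z.of_nat k <=? n)%Z then
    let p := Z.to_nat (- n) in
    Cmult (RtoC ((-1) ^ k))
      (sum_n (fun j =>
         Cmult (RtoC (Binomial.C (k - j) p))
           (Cmult (RtoC ((-1) ^ j)) (Cdiv (lam j k) (RtoC (INR (fact j))))))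
         (k - p))
  else RtoC 0.

Definition CpowZ (w : C) (n : Z) : C :=
  if (0 <=? n)%Z then Cpow w (Z.to_nat n) else Cinv (Cpow w (Z.to_nat (- n))).

Definition Lindelof : Prop :=
  forall eps : R, 0 < eps -> exists M T : R, 0 < T /\
    forall t : R, T <= Rabs t ->
      Cmod (zeta (1/2, t)) <= M * Rpower (Rabs t) eps.

(* The expansion:  zeta^k(1/2+it) = sum_{n >= -k} ell_{n,k} w^n,
   w = (1/2 - it)/(1/2 + it), as the limit of partial sums over
   -k <= n <= N, N -> oo  (reindexed by m = n + k >= 0). *)
Definition expansion_holds (k : nat) (t : R) : Prop :=
  let w := Cdiv (1/2, - t) (1/2, t) in
  is_series (V := C_NormedModule)
    (fun m : nat => Cmult (ell (Z.of_nat m - Z.of_nat k)%Z k)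
                          (CpowZ w (Z.of_nat m - Z.of_nat k)%Z))
    (Cpow (zeta (1/2, t)) k).

(* Main.v *)
Require Import Defs.
From Stdlib Require Import Reals ZArith Lra Lia ClassicalEpsilon IndefiniteDescription.
From Coquelicot Require Import Coquelicot.

(* Put s = 1/(1+w), which maps the unit disc onto Re s > 1/2, and
   F(w) = w^k zeta(s)^k, a function holomorphic for Re w > -1 whose Taylor
   coefficients at 0 are a_m = ell_(m-k),k.  The expansion is the convergence of
   the Taylor series of F at a boundary point w <> -1 of the unit disc, which by
   the Fatou-Riesz theorem holds as soon as a_m -> 0.  Square-summability gives
   this at once.  Under the Lindelof Hypothesis |F(w)|^2 = O(|1+w|^(-1/2)) on the
   unit circle; after multiplication by ((1+w)/(1+w+e))^(k+1) the function F is
   continuous on the closed disc, and Parseval's identity with e -> 0 bounds the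
   sum of the |a_m|^2.

   Holomorphy is used only in the form "uniform limit of polynomials": the Cauchy
   estimates, the mean value property and Parseval's identity for polynomials are
   finite sums over roots of unity. *)

Local Open Scope C_scope.

(** * Complex numbers, finite sums and limits *)

Lemma Cmod_minus_sym (x y : C) : Cmod (x - y) = Cmod (y - x).
Proof. rewrite <- (Cmod_opp (x - y)). f_equal. ring. Qed.

Lemma Cmod_minus_triangle (x y z : C) : Cmod (x - z) <= Cmod (x - y) + Cmod (y - z).
Proof. replace (x - z) with ((x - y) + (y - z)) by ring. apply Cmod_triangle. Qed.

Lemma Cmod_le_plus_minus (x y : C) : Cmod x <= Cmod y + Cmod (x - y).
Proof. replace x with (y + (x - y)) at 1 by ring. apply Cmod_triangle. Qed.

Lemma Cmod_minus_le_plus (x y : C) : Cmod (x - y) <= Cmod x + Cmod y.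
Proof. rewrite <- (Cmod_opp y). apply Cmod_triangle. Qed.

Lemma Cmod_sq_le_minus (x y : C) : Cmod x ^ 2 <= 2 * Cmod y ^ 2 + 2 * Cmod (x - y) ^ 2.
Proof.
  pose proof (Cmod_le_plus_minus x y). pose proof (Cmod_ge_0 x).
  assert (Cmod x ^ 2 <= (Cmod y + Cmod (x - y)) ^ 2) by (apply pow_incr; lra).
  pose proof (pow2_ge_0 (Cmod y - Cmod (x - y))). simpl in *. lra.
Qed.

Lemma Cmod_RtoC_pos (x : R) : 0 <= x -> Cmod (RtoC x) = x.
Proof. intros x_ge0. rewrite Cmod_R. now apply Rabs_pos_eq. Qed.

Lemma Rabs_Im_le_Cmod (z : C) : Rabs (Im z) <= Cmod z.
Proof. eapply Rle_trans; [apply Rmax_r | apply Rmax_Cmod]. Qed.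

Lemma Re_le_Cmod (z : C) : Re z <= Cmod z.
Proof. eapply Rle_trans; [apply Rle_abs | apply re_le_Cmod]. Qed.

Lemma Re_ge_opp_Cmod (z : C) : - Cmod z <= Re z.
Proof. pose proof (Re_le_Cmod (- z)) as H. rewrite Cmod_opp in H. simpl in H. unfold Re. lra. Qed.

Lemma Cmod_le_Re_Im (z : C) : Cmod z <= Rabs (Re z) + Rabs (Im z).
Proof.
  pose proof (Rabs_pos (Re z)). pose proof (Rabs_pos (Im z)).
  apply Rsqr_incr_0_var; [|lra].
  rewrite !Rsqr_pow2, Cmod2_alt, <- (pow2_abs (Re z)), <- (pow2_abs (Im z)). nra.
Qed.

Lemma Re_inv (u : C) : Re (/ u) = (Re u / Cmod u ^ 2)%R.
Proof. rewrite Cmod2_alt. reflexivity. Qed.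

Lemma Re_1_plus (z : C) : Re (1 + z) = (1 + Re z)%R.
Proof. reflexivity. Qed.

Lemma Cneq0_of_Cmod (z : C) (c : R) : 0 < c -> c <= Cmod z -> z <> 0.
Proof. intros c_pos z_ge. apply Cmod_gt_0. lra. Qed.

Lemma Cneq0_of_Re (z : C) : 0 < Re z -> z <> 0.
Proof. intros Re_pos z_eq. rewrite z_eq in Re_pos. simpl in Re_pos. lra. Qed.

Lemma RtoC_neq0 (x : R) : x <> 0%R -> RtoC x <> 0.
Proof. intros x_neq0 x_eq. now apply x_neq0, RtoC_inj. Qed.

Lemma Cpow_opp_l (z : C) (n : nat) : (- z) ^ n = RtoC ((-1) ^ n) * z ^ n.
Proof.
  rewrite RtoC_pow, <- Cpow_mult_l. f_equal.
  ring.
Qed.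

Lemma sum_Sn_C (f : nat -> C) (n : nat) : sum_n f (S n) = sum_n f n + f (S n) :> C.
Proof. apply (sum_Sn (G := C_AbelianMonoid)). Qed.

Lemma sum_n_Cext (f g : nat -> C) (n : nat) :
  (forall i, (i <= n)%nat -> f i = g i) -> sum_n f n = sum_n g n :> C.
Proof. apply (sum_n_ext_loc (G := C_AbelianMonoid)). Qed.

Lemma sum_n_Cplus (f g : nat -> C) (n : nat) :
  sum_n (fun i => f i + g i) n = sum_n f n + sum_n g n :> C.
Proof. apply (sum_n_plus (G := C_AbelianMonoid)). Qed.

Lemma sum_n_Cmult_l (a : C) (f : nat -> C) (n : nat) :
  sum_n (fun i => a * f i) n = a * sum_n f n :> C.
Proof. apply (sum_n_mult_l (K := C_Ring)). Qed.

Lemma sum_n_Cmult_r (a : C) (f : nat -> C) (n : nat) :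
  sum_n (fun i => f i * a) n = sum_n f n * a :> C.
Proof. apply (sum_n_mult_r (K := C_Ring)). Qed.

Lemma sum_n_Cconst (a : C) (n : nat) : sum_n (fun _ => a) n = RtoC (INR (S n)) * a :> C.
Proof.
  induction n as [|n IH]; [rewrite sum_O; symmetry; apply Cmult_1_l|].
  rewrite sum_Sn_C, IH, (S_INR (S n)), RtoC_plus. ring.
Qed.

Lemma sum_n_zero {G : AbelianMonoid} (f : nat -> G) (n : nat) :
  (forall i, (i <= n)%nat -> f i = zero) -> sum_n f n = zero.
Proof.
  intros f_zero. rewrite (sum_n_ext_loc f (fun _ => zero)) by easy. apply sum_n_m_const_zero.
Qed.

Lemma sum_n_single {G : AbelianMonoid} (f : nat -> G) (n k : nat) : (k <= n)%nat ->
  (forall i, (i <= n)%nat -> i <> k -> f i = zero) -> sum_n f n = f k.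
Proof.
  induction n as [|n IH]; intros k_le f_zero.
  - rewrite sum_O. f_equal. lia.
  - rewrite sum_Sn. destruct (Nat.eq_dec k (S n)) as [->|k_neq].
    + rewrite sum_n_zero by (intros; apply f_zero; lia). apply plus_zero_l.
    + rewrite IH, (f_zero (S n)) by (intros; try apply f_zero; lia). apply plus_zero_r.
Qed.

Lemma sum_n_truncate {G : AbelianMonoid} (f : nat -> G) (n m : nat) : (n <= m)%nat ->
  (forall i, (n < i)%nat -> f i = zero) -> sum_n f m = sum_n f n.
Proof.
  intros n_le f_zero. induction n_le as [|m n_le IH]; [easy|].
  rewrite sum_Sn, f_zero by lia. now rewrite plus_zero_r.
Qed.

Lemma sum_n_split {G : AbelianMonoid} (f : nat -> G) (n m : nat) :
  sum_n f (n + S m) = plus (sum_n f n) (sum_n (fun i => f (S n + i)%nat) m).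
Proof.
  induction m as [|m IH].
  - rewrite Nat.add_1_r, sum_Sn, sum_O. now rewrite Nat.add_0_r.
  - rewrite Nat.add_succ_r, sum_Sn, IH, sum_Sn, plus_assoc.
    now replace (S (n + S m)) with (S n + S m)%nat by lia.
Qed.

Lemma sum_n_m_le_loc (f g : nat -> R) (n m : nat) :
  (forall i, (n <= i <= m)%nat -> f i <= g i) -> sum_n_m f n m <= sum_n_m g n m.
Proof.
  intros f_le.
  pose (clamp := fun h : nat -> R => fun i =>
    if (andb (n <=? i) (i <=? m))%nat then h i else 0%R).
  assert (clampE : forall h, sum_n_m h n m = sum_n_m (clamp h) n m).
  { intros h. apply sum_n_m_ext_loc. intros i i_in. unfold clamp.
    rewrite (proj2 (Nat.leb_le n i)), (proj2 (Nat.leb_le i m)) by lia. easy. }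
  rewrite (clampE f), (clampE g). apply sum_n_m_le. intros i. unfold clamp.
  destruct (Nat.leb_spec n i), (Nat.leb_spec i m); simpl; try lra. now apply f_le.
Qed.

Lemma sum_n_m_Rmult_l (a : R) (f : nat -> R) (n m : nat) :
  sum_n_m (fun i => a * f i)%R n m = (a * sum_n_m f n m)%R.
Proof. apply (sum_n_m_mult_l (K := R_Ring)). Qed.

Lemma sum_n_Rplus (f g : nat -> R) (n : nat) :
  sum_n (fun i => f i + g i)%R n = (sum_n f n + sum_n g n)%R.
Proof. apply (sum_n_plus (G := R_AbelianMonoid)). Qed.

Lemma sum_n_mono (f : nat -> R) (n m : nat) :
  (forall i, 0 <= f i) -> (n <= m)%nat -> sum_n f n <= sum_n f m.
Proof.
  intros f_ge0 n_le. induction n_le as [|m n_le IH]; [lra|].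
  rewrite sum_Sn. specialize (f_ge0 (S m)). unfold plus; simpl. lra.
Qed.

Lemma sum_n_term_le (f : nat -> R) (n i : nat) :
  (forall j, 0 <= f j) -> (i <= n)%nat -> f i <= sum_n f n.
Proof.
  intros f_ge0 i_le. apply Rle_trans with (sum_n f i); [|now apply sum_n_mono].
  destruct i as [|i]; [rewrite sum_O; lra|]. rewrite sum_Sn. unfold plus; simpl.
  pose proof (sum_n_mono f 0 i f_ge0 ltac:(lia)) as sum_ge. rewrite sum_O in sum_ge.
  specialize (f_ge0 0%nat). lra.
Qed.

Lemma Cmod_sum_n_m_le (f : nat -> C) (g : nat -> R) (n m : nat) :
  (forall i, (n <= i <= m)%nat -> Cmod (f i) <= g i) -> Cmod (sum_n_m f n m) <= sum_n_m g n m.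
Proof.
  intros f_le. eapply Rle_trans; [apply (norm_sum_n_m (V := C_NormedModule) f)|].
  now apply sum_n_m_le_loc.
Qed.

Lemma sum_n_Cgeom (x : C) (n : nat) : (1 - x) * sum_n (fun i => x ^ i) n = 1 - x ^ S n.
Proof.
  induction n as [|n IH]; [rewrite sum_O; simpl; ring|].
  rewrite sum_Sn_C, Cmult_plus_distr_l, IH, (Cpow_S _ (S n)). ring.
Qed.

Lemma sum_n_m_geom (x : R) (n m : nat) : (n <= S m)%nat ->
  ((1 - x) * sum_n_m (fun i => x ^ i)%R n m = x ^ n - x ^ S m)%R.
Proof.
  intros n_le. induction m as [|m IH].
  - destruct n as [|[|n]]; [| |lia].
    + rewrite sum_n_n. simpl. ring.
    + rewrite sum_n_m_zero by lia. unfold zero; simpl. ring.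
  - destruct (Nat.eq_dec n (S (S m))) as [->|n_neq].
    + rewrite sum_n_m_zero by lia. unfold zero; simpl. ring.
    + rewrite sum_n_Sm by lia. unfold plus; simpl. rewrite Rmult_plus_distr_l, IH by lia.
      simpl. ring.
Qed.

Lemma sum_n_m_geom_le_lt1 (x : R) (n m : nat) : 0 <= x < 1 ->
  sum_n_m (fun i => x ^ i)%R n m <= x ^ n / (1 - x).
Proof.
  intros x_in. apply Rle_div_r; [lra|]. rewrite Rmult_comm.
  pose proof (pow_le x n (proj1 x_in)). pose proof (pow_le x (S m) (proj1 x_in)).
  destruct (Nat.le_gt_cases n (S m)).
  - rewrite sum_n_m_geom by easy. lra.
  - rewrite sum_n_m_zero by lia. unfold zero; simpl. lra.
Qed.

Lemma sum_n_m_geom_le_gt1 (x : R) (n m : nat) : 1 < x -> (n <= S m)%nat ->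
  sum_n_m (fun i => x ^ i)%R n m <= x ^ S m / (x - 1).
Proof.
  intros x_gt1 n_le. apply Rle_div_r; [lra|].
  pose proof (sum_n_m_geom x n m n_le). pose proof (pow_le x n ltac:(lra)). lra.
Qed.

Lemma Re_sum_n (f : nat -> C) (n : nat) : Re (sum_n f n) = sum_n (fun i => Re (f i)) n.
Proof.
  induction n as [|n IH]; [now rewrite !sum_O|]. rewrite sum_Sn_C, sum_Sn, <- IH. reflexivity.
Qed.

Lemma Im_sum_n (f : nat -> C) (n : nat) : Im (sum_n f n) = sum_n (fun i => Im (f i)) n.
Proof.
  induction n as [|n IH]; [now rewrite !sum_O|]. rewrite sum_Sn_C, sum_Sn, <- IH. reflexivity.
Qed.

Lemma RtoC_sum_n (f : nat -> R) (n : nat) : RtoC (sum_n f n) = sum_n (fun i => RtoC (f i)) n.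
Proof.
  induction n as [|n IH]; [now rewrite !sum_O|]. rewrite sum_Sn_C, sum_Sn, <- IH. apply RtoC_plus.
Qed.

Lemma Cconj_sum_n (f : nat -> C) (n : nat) : Cconj (sum_n f n) = sum_n (fun i => Cconj (f i)) n.
Proof.
  induction n as [|n IH]; [now rewrite !sum_O|]. rewrite !sum_Sn_C, <- IH. apply Cplus_conj.
Qed.

Lemma pow_le_1 (x : R) (n : nat) : 0 <= x <= 1 -> x ^ n <= 1.
Proof. intros x_in. rewrite <- (pow1 n). now apply pow_incr. Qed.

Lemma small_factor (M eps : R) : 0 < eps -> exists d : R, 0 < d /\ M * d <= eps.
Proof.
  intros eps_pos. pose proof (Rabs_pos M). pose proof (Rle_abs M).
  exists (eps / (Rabs M + 1))%R.
  assert (d_pos : 0 < eps / (Rabs M + 1)) by (apply Rdiv_lt_0_compat; lra).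
  split; [easy|]. replace eps with ((Rabs M + 1) * (eps / (Rabs M + 1)))%R at 2 by (field; lra).
  apply Rmult_le_compat_r; lra.
Qed.

Lemma is_lim_seq_0_eventually_le (b : nat -> R) (eps : R) :
  is_lim_seq b 0%R -> 0 < eps -> eventually (fun n => b n <= eps).
Proof.
  intros b_lim eps_pos. apply is_lim_seq_spec in b_lim.
  destruct (b_lim (mkposreal _ eps_pos)) as [N b_small]. exists N. intros n n_ge.
  specialize (b_small n n_ge). simpl in b_small. rewrite Rminus_0_r in b_small.
  pose proof (Rle_abs (b n)). lra.
Qed.

Lemma is_lim_seq_scal_0 (M : R) (b : nat -> R) :
  is_lim_seq b 0%R -> is_lim_seq (fun n => M * b n)%R 0%R.
Proof.
  intros b_lim. replace (Finite 0) with (Rbar_mult M (Finite 0)) by (simpl; f_equal; ring).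
  now apply is_lim_seq_scal_l.
Qed.

Lemma is_lim_seq_inv_INR_S : is_lim_seq (fun n => / INR (S n))%R 0%R.
Proof.
  apply (is_lim_seq_incr_1 (fun n => / INR n)%R).
  apply (is_lim_seq_inv _ p_infty); [apply is_lim_seq_INR | easy].
Qed.

Definition is_Clim (u : nat -> C) (l : C) : Prop :=
  filterlim u eventually (locally l).

Lemma is_Clim_spec (u : nat -> C) (l : C) :
  is_Clim u l <-> forall eps : R, 0 < eps -> eventually (fun n => Cmod (u n - l) <= eps).
Proof.
  unfold is_Clim. rewrite (filterlim_locally_ball_norm (U := C_NormedModule)). split.
  - intros u_lim eps eps_pos. apply (filter_imp _ _ (fun n => Rlt_le _ _)
      (u_lim (mkposreal _ eps_pos))).
  - intros u_lim eps. apply (filter_imp (fun n => Cmod (u n - l) <= eps / 2)).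
    + intros n u_close. unfold ball_norm. eapply Rle_lt_trans; [exact u_close|].
      pose proof (cond_pos eps). lra.
    + apply u_lim, is_pos_div_2.
Qed.

Lemma is_Clim_squeeze (u : nat -> C) (l : C) (b : nat -> R) :
  (forall n, Cmod (u n - l) <= b n) -> is_lim_seq b 0%R -> is_Clim u l.
Proof.
  intros u_le b_lim. apply is_Clim_spec. intros eps eps_pos.
  apply (filter_imp (fun n => b n <= eps)); [|now apply is_lim_seq_0_eventually_le].
  intros n b_le. specialize (u_le n). lra.
Qed.

Lemma is_Clim_dist_le (u : nat -> C) (l a : C) (B : R) :
  is_Clim u l -> eventually (fun n => Cmod (u n - a) <= B) -> Cmod (l - a) <= B.
Proof.
  intros u_lim u_le. apply le_epsilon. intros eps eps_pos.
  destruct (filter_ex _ (filter_and _ _ (proj1 (is_Clim_spec u l) u_lim eps eps_pos) u_le))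
    as [n [near_l near_a]].
  eapply Rle_trans; [apply (Cmod_minus_triangle _ (u n))|]. rewrite Cmod_minus_sym. lra.
Qed.

Lemma is_Clim_Cauchy (u : nat -> C) (b : nat -> R) :
  (forall n m, (n <= m)%nat -> Cmod (u m - u n) <= b n) -> is_lim_seq b 0%R ->
  exists l, is_Clim u l.
Proof.
  intros u_le b_lim.
  apply (filterlim_locally_cauchy (U := C_CompleteNormedModule)). intros eps.
  destruct (is_lim_seq_0_eventually_le b (eps / 3) b_lim) as [N b_small].
  { pose proof (cond_pos eps). lra. }
  exists (fun n => (N <= n)%nat). split; [now exists N|]. intros n m n_ge m_ge.
  apply (norm_compat1 (V := C_NormedModule)). change (Cmod (u m - u n) < eps).
  eapply Rle_lt_trans; [apply (Cmod_minus_triangle _ (u N))|]. rewrite (Cmod_minus_sym (u N)).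
  pose proof (u_le N n n_ge). pose proof (u_le N m m_ge). pose proof (b_small N (Nat.le_refl N)).
  pose proof (cond_pos eps). lra.
Qed.

Local Notation is_Cseries := (is_series (V := C_NormedModule)).

Lemma is_Cseries_Re_Im (a : nat -> C) (l : C) : is_Cseries a l ->
  is_series (fun n => Re (a n)) (Re l) /\ is_series (fun n => Im (a n)) (Im l).
Proof.
  intros a_lim. pose proof (proj1 (is_Clim_spec _ _) a_lim) as a_close. split.
  - change (is_lim_seq (sum_n (fun n => Re (a n))) (Re l)). apply is_lim_seq_spec. intros eps.
    apply (filter_imp (fun n => Cmod (sum_n a n - l) <= eps / 2)); [|apply a_close, is_pos_div_2].
    intros n close. rewrite <- Re_sum_n. pose proof (re_le_Cmod (sum_n a n - l)) as Re_le.
    change (Re (sum_n a n - l)) with (Re (sum_n a n) - Re l)%R in Re_le.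
    pose proof (cond_pos eps). lra.
  - change (is_lim_seq (sum_n (fun n => Im (a n))) (Im l)). apply is_lim_seq_spec. intros eps.
    apply (filter_imp (fun n => Cmod (sum_n a n - l) <= eps / 2)); [|apply a_close, is_pos_div_2].
    intros n close. rewrite <- Im_sum_n. pose proof (Rabs_Im_le_Cmod (sum_n a n - l)) as Im_le.
    change (Im (sum_n a n - l)) with (Im (sum_n a n) - Im l)%R in Im_le.
    pose proof (cond_pos eps). lra.
Qed.

Lemma is_Cseries_of_odd_partial_sums (a : nat -> C) (l : C) :
  is_Clim a 0 -> is_Clim (fun n => sum_n a (2 * n + 1)) l -> is_Cseries a l.
Proof.
  rewrite !is_Clim_spec. intros a_lim odd_lim. change (is_Clim (sum_n a) l). apply is_Clim_spec.
  intros eps eps_pos.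
  destruct (a_lim (eps / 2)%R ltac:(lra)) as [N1 a_small].
  destruct (odd_lim (eps / 2)%R ltac:(lra)) as [N2 odd_close].
  exists (2 * (N1 + N2))%nat. intros n n_ge.
  destruct (Nat.Even_or_Odd n) as [[m ->]|[m ->]].
  - specialize (a_small (2 * m + 1)%nat ltac:(lia)). specialize (odd_close m ltac:(lia)).
    rewrite Nat.add_1_r, sum_Sn_C in odd_close. rewrite Nat.add_1_r in a_small.
    replace (sum_n a (2 * m) - l)
      with ((sum_n a (2 * m) + a (S (2 * m)) - l) - (a (S (2 * m)) - 0)) by ring.
    eapply Rle_trans; [apply Cmod_minus_le_plus | lra].
  - specialize (odd_close m ltac:(lia)). lra.
Qed.

(** * The complex exponential *)

Lemma exp_le (x y : R) : x <= y -> exp x <= exp y.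
Proof. intros [x_lt|x_eq]; [now apply Rlt_le, exp_increasing | rewrite x_eq; apply Rle_refl]. Qed.

Lemma derive_nonpos_decreasing (f f' : R -> R) (a b : R) : a <= b ->
  (forall t, a <= t <= b -> is_derive f t (f' t)) ->
  (forall t, a <= t <= b -> f' t <= 0) -> f b <= f a.
Proof.
  intros a_le_b f_derive f'_le0.
  destruct (MVT_gen f a b f') as [t [t_in f_diff]];
    rewrite ?Rmin_left, ?Rmax_right in * by easy.
  - intros t t_in. apply f_derive. lra.
  - intros t t_in. apply continuity_pt_filterlim.
    apply (ex_derive_continuous (K := R_AbsRing) (V := R_NormedModule)).
    exists (f' t). now apply f_derive.
  - specialize (f'_le0 t t_in). nra.
Qed.

Local Notation is_Cderive := (is_derive (V := C_R_NormedModule)).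

Lemma is_derive_Re (f : R -> C) (t : R) (l : C) :
  is_Cderive f t l -> is_derive (fun x => Re (f x)) t (Re l).
Proof.
  intros f_derive.
  apply (filterdiff_ext_lin _ (fun y => fst (scal (V := C_R_NormedModule) y l))); [|easy].
  apply (filterdiff_comp' (V := C_R_NormedModule) f fst); [exact f_derive|].
  apply filterdiff_linear. exact (is_linear_fst (U := R_NormedModule) (V := R_NormedModule)).
Qed.

Lemma is_derive_Im (f : R -> C) (t : R) (l : C) :
  is_Cderive f t l -> is_derive (fun x => Im (f x)) t (Im l).
Proof.
  intros f_derive.
  apply (filterdiff_ext_lin _ (fun y => snd (scal (V := C_R_NormedModule) y l))); [|easy].
  apply (filterdiff_comp' (V := C_R_NormedModule) f snd); [exact f_derive|].
  apply filterdiff_linear. exact (is_linear_snd (U := R_NormedModule) (V := R_NormedModule)).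
Qed.

Lemma is_derive_RtoC_scal (g : R -> R) (t l : R) (z : C) : is_derive g t l ->
  is_Cderive (fun x => RtoC (g x) * z) t (RtoC l * z).
Proof.
  intros g_derive. rewrite <- scal_R_Cmult.
  apply (is_derive_ext (fun x => scal (V := C_R_ModuleSpace) (g x) z));
    [intros; apply scal_R_Cmult|].
  exact (is_derive_scal_l (V := C_R_NormedModule) g t l z g_derive).
Qed.

(* Projecting on the direction of [f b - f a] reduces to the real mean value theorem. *)
Lemma Cmod_increment_le (f f' : R -> C) (g g' : R -> R) (a b : R) : a <= b ->
  (forall t, a <= t <= b -> is_Cderive f t (f' t)) ->
  (forall t, a <= t <= b -> is_derive g t (g' t)) ->
  (forall t, a <= t <= b -> Cmod (f' t) <= g' t) ->
  Cmod (f b - f a) <= g b - g a.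
Proof.
  intros a_le_b f_derive g_derive f'_le.
  set (u := f b - f a).
  set (proj := fun z : C => (Re u * Re z + Im u * Im z)%R).
  assert (proj_le : forall z, proj z <= Cmod u * Cmod z).
  { intros z. unfold proj. rewrite <- (Cmod_conj u), <- Cmod_mult.
    replace (Re u * Re z + Im u * Im z)%R with (Re (Cconj u * z))
      by (rewrite re_mult, re_conj, im_conj; ring).
    apply Re_le_Cmod. }
  assert (g_mono : - g b <= - g a).
  { apply (derive_nonpos_decreasing (fun t => - g t)%R (fun t => - g' t)%R); [easy| |].
    - intros t t_in. exact (is_derive_opp _ _ _ (g_derive t t_in)).
    - intros t t_in. pose proof (Cmod_ge_0 (f' t)). specialize (f'_le t t_in). lra. }
  assert (proj_mono : proj (f b) - Cmod u * g b <= proj (f a) - Cmod u * g a).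
  { apply (derive_nonpos_decreasing (fun t => proj (f t) - Cmod u * g t)%R
            (fun t => proj (f' t) - Cmod u * g' t)%R); [easy| |].
    - intros t t_in. apply (is_derive_minus (V := R_NormedModule)).
      + apply (is_derive_plus (V := R_NormedModule)); apply is_derive_scal.
        * now apply is_derive_Re, f_derive.
        * now apply is_derive_Im, f_derive.
      + now apply is_derive_scal, g_derive.
    - intros t t_in. specialize (f'_le t t_in). specialize (proj_le (f' t)).
      pose proof (Cmod_ge_0 u). nra. }
  assert (u_sq : (Cmod u ^ 2 = proj (f b) - proj (f a))%R).
  { rewrite Cmod2_alt. unfold proj.
    replace (Re (f b)) with (Re u + Re (f a))%R by (unfold u, Re; simpl; ring).
    replace (Im (f b)) with (Im u + Im (f a))%R by (unfold u, Im; simpl; ring). ring. }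
  pose proof (Cmod_ge_0 u). nra.
Qed.

Definition cexp (z : C) : C := (exp (Re z) * cos (Im z), exp (Re z) * sin (Im z))%R.

Lemma cexp_plus (x y : C) : cexp (x + y) = cexp x * cexp y.
Proof.
  unfold cexp, Cmult, Cplus, Re, Im; cbn [fst snd]. rewrite exp_plus, cos_plus, sin_plus.
  f_equal; ring.
Qed.

Lemma cexp_0 : cexp 0 = 1.
Proof. unfold cexp; simpl. rewrite exp_0, cos_0, sin_0. unfold RtoC. f_equal; ring. Qed.

Lemma Cmod_cexp (z : C) : Cmod (cexp z) = exp (Re z).
Proof.
  unfold Cmod, cexp. cbn [fst snd].
  replace ((exp (Re z) * cos (Im z)) ^ 2 + (exp (Re z) * sin (Im z)) ^ 2)%R
    with (exp (Re z) ^ 2 * ((sin (Im z))² + (cos (Im z))²))%R by (unfold Rsqr; ring).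
  rewrite sin2_cos2, Rmult_1_r. apply sqrt_pow2, Rlt_le, exp_pos.
Qed.

Lemma Cconj_cexp (z : C) : Cconj (cexp z) = cexp (Cconj z).
Proof.
  unfold Cconj, cexp, Re, Im; cbn [fst snd]. rewrite cos_neg, sin_neg. f_equal. ring.
Qed.

Lemma cexp_pow (z : C) (n : nat) : cexp z ^ n = cexp (RtoC (INR n) * z).
Proof.
  induction n as [|n IH].
  - change (INR 0) with 0%R. rewrite Cmult_0_l, cexp_0. reflexivity.
  - rewrite Cpow_S, IH, <- cexp_plus, S_INR, RtoC_plus. f_equal. ring.
Qed.

Lemma cexp_eq_1_Re (z : C) : cexp z = 1 -> Re z = 0%R.
Proof.
  intros z_eq. apply exp_inv. rewrite exp_0, <- Cmod_cexp, z_eq. apply Cmod_1.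
Qed.

Lemma cexp_eq_1 (z : C) : cexp z = 1 -> Rabs (Im z) < 2 * PI -> z = 0.
Proof.
  intros z_eq Im_lt. pose proof (cexp_eq_1_Re z z_eq) as Re_eq.
  apply injective_projections; [exact Re_eq|].
  pose proof (f_equal Re z_eq) as cos_eq. unfold cexp in cos_eq. simpl in cos_eq.
  rewrite Re_eq, exp_0, Rmult_1_l in cos_eq.
  replace (Im z) with (2 * (Im z / 2))%R in cos_eq by field. rewrite cos_2a_sin in cos_eq.
  assert (sin_eq : sin (Im z / 2) = 0%R) by nra.
  apply Rabs_def2 in Im_lt. simpl. fold (Im z).
  destruct (Rtotal_order (Im z) 0) as [Im_neg|[Im_eq|Im_pos]]; [|easy|].
  - assert (sin_pos : 0 < sin (- (Im z / 2))) by (apply sin_gt_0; lra).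
    rewrite sin_neg in sin_pos. lra.
  - assert (sin_pos : 0 < sin (Im z / 2)) by (apply sin_gt_0; lra). lra.
Qed.

Lemma is_derive_cexp_comp (g : R -> R) (t l : R) (z : C) : is_derive g t l ->
  is_Cderive (fun x => cexp (RtoC (g x) * z)) t
    (RtoC l * z * cexp (RtoC (g t) * z)).
Proof.
  intros g_derive.
  assert (expE : forall x, cexp (RtoC (g x) * z)
    = RtoC (exp (g x * Re z) * cos (g x * Im z)) * 1
      + RtoC (exp (g x * Re z) * sin (g x * Im z)) * Ci).
  { intros x. unfold cexp. rewrite re_mult, im_mult. apply injective_projections; simpl;
      rewrite !Rmult_0_l, Rplus_0_r, Rminus_0_r; ring. }
  set (dRe := (Re z * exp (g t * Re z) * cos (g t * Im z)
    - Im z * exp (g t * Re z) * sin (g t * Im z))%R).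
  set (dIm := (Re z * exp (g t * Re z) * sin (g t * Im z)
    + Im z * exp (g t * Re z) * cos (g t * Im z))%R).
  apply (is_derive_ext (V := C_R_NormedModule) _ _ _ _ (fun x => eq_sym (expE x))).
  replace (RtoC l * z * cexp (RtoC (g t) * z))
    with (RtoC (l * dRe) * 1 + RtoC (l * dIm) * Ci).
  2:{ rewrite expE. unfold dRe, dIm, Re, Im. apply injective_projections; simpl; ring. }
  assert (g_ex : ex_derive g t) by now exists l.
  apply (is_derive_plus (V := C_R_NormedModule)); apply is_derive_RtoC_scal;
    (auto_derive; [easy|]); rewrite (is_derive_unique (fun x : R => g x) t l g_derive);
    unfold dRe, dIm; ring.
Qed.

Lemma is_derive_cexp_line (z : C) (t : R) :
  is_Cderive (fun x => cexp (RtoC x * z)) t (z * cexp (RtoC t * z)).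
Proof.
  replace (z * cexp (RtoC t * z)) with (RtoC 1 * z * cexp (RtoC t * z)) by ring.
  apply (is_derive_cexp_comp (fun x => x)). exact (is_derive_id t).
Qed.

Lemma is_derive_pow_div_fact (n : nat) (t : R) :
  is_derive (fun t => t ^ S n / INR (fact (S n)))%R t (t ^ n / INR (fact n))%R.
Proof.
  auto_derive; [easy|]. change (match n with O => 1%R | S _ => (INR n + 1)%R end)
    with (INR (S n)).
  change (fact n + n * fact n)%nat with (fact (S n)). rewrite fact_simpl, mult_INR.
  field. split; [apply INR_fact_neq_0 | apply not_0_INR; lia].
Qed.

Lemma Cmod_le_of_derive_le_monomial (f f' : R -> C) (M : R) (n : nat) (t : R) :
  f 0%R = 0 -> 0 <= t ->
  (forall x, 0 <= x <= t -> is_Cderive f x (f' x)) ->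
  (forall x, 0 <= x <= t -> Cmod (f' x) <= M * (x ^ n / INR (fact n))) ->
  Cmod (f t) <= M * (t ^ S n / INR (fact (S n))).
Proof.
  intros f_0 t_ge0 f_derive f'_le.
  replace (f t) with (f t - f 0%R) by (rewrite f_0; ring).
  replace (M * (t ^ S n / INR (fact (S n))))%R
    with (M * (t ^ S n / INR (fact (S n))) - M * (0 ^ S n / INR (fact (S n))))%R
    by (rewrite pow_i by lia; unfold Rdiv; ring).
  apply (Cmod_increment_le f f' (fun t => M * (t ^ S n / INR (fact (S n))))%R
    (fun x => M * (x ^ n / INR (fact n)))%R); [easy | easy | | easy].
  intros x _. apply is_derive_scal, is_derive_pow_div_fact.
Qed.

Definition exp_partial (z : C) (n : nat) : C := sum_n (fun j => RtoC (/ INR (fact j)) * z ^ j) n.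

Lemma exp_partial_0 (n : nat) : exp_partial 0 n = 1.
Proof.
  unfold exp_partial. rewrite (sum_n_single (G := C_AbelianMonoid) _ n 0); [|lia|].
  - simpl. rewrite Rinv_1. apply Cmult_1_l.
  - intros [|i] _ i_neq; [easy|]. rewrite Cpow_S, Cmult_0_l. apply Cmult_0_r.
Qed.

Lemma is_derive_exp_partial (z : C) (n : nat) (t : R) :
  is_Cderive (fun t => exp_partial (RtoC t * z) (S n)) t
    (z * exp_partial (RtoC t * z) n).
Proof.
  assert (termE : forall j t, RtoC (/ INR (fact j)) * (RtoC t * z) ^ j
    = RtoC (t ^ j / INR (fact j)) * z ^ j).
  { intros j x. unfold Rdiv. rewrite Cpow_mult_l, RtoC_mult, <- RtoC_pow. ring. }
  assert (succE : forall n t, exp_partial (RtoC t * z) (S n)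
    = exp_partial (RtoC t * z) n + RtoC (t ^ S n / INR (fact (S n))) * z ^ S n).
  { intros m x. unfold exp_partial. rewrite sum_Sn_C, termE. reflexivity. }
  induction n as [|n IH]; apply (is_derive_ext (V := C_R_NormedModule) _ _ _ _
    (fun x => eq_sym (succE _ x))).
  - unfold exp_partial. rewrite sum_O, termE.
    replace (z * (RtoC (t ^ 0 / INR (fact 0)) * z ^ 0))
      with (0 + RtoC (t ^ 0 / INR (fact 0)) * z ^ 1) by (simpl; ring).
    apply (is_derive_plus (V := C_R_NormedModule));
      [|apply is_derive_RtoC_scal, is_derive_pow_div_fact].
    apply (is_derive_ext (V := C_R_NormedModule) (fun _ => RtoC 1));
      [|exact (is_derive_const (V := C_R_NormedModule) (RtoC 1) t)].
    intros x. rewrite sum_O. simpl. rewrite Rinv_1. ring.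
  - rewrite succE.
    replace (z * (exp_partial (RtoC t * z) n + RtoC (t ^ S n / INR (fact (S n))) * z ^ S n))
      with (z * exp_partial (RtoC t * z) n + RtoC (t ^ S n / INR (fact (S n))) * z ^ S (S n))
      by (rewrite (Cpow_S z (S n)); ring).
    apply (is_derive_plus (V := C_R_NormedModule)); [exact IH|].
    apply is_derive_RtoC_scal, is_derive_pow_div_fact.
Qed.

Lemma cexp_taylor_remainder_path (z : C) (n : nat) (t : R) : 0 <= t <= 1 ->
  Cmod (cexp (RtoC t * z) - exp_partial (RtoC t * z) n)
    <= exp (Cmod z) * Cmod z ^ S n * (t ^ S n / INR (fact (S n))).
Proof.
  assert (start : forall n, cexp (RtoC 0 * z) - exp_partial (RtoC 0 * z) n = 0).
  { intros m. rewrite Cmult_0_l, cexp_0, exp_partial_0. ring. }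
  revert t. induction n as [|n IH]; intros t t_in.
  - apply (Cmod_le_of_derive_le_monomial (fun x => cexp (RtoC x * z) - exp_partial (RtoC x * z) 0)
      (fun x => z * cexp (RtoC x * z))); [apply start | easy | |].
    + intros x _. replace (z * cexp (RtoC x * z)) with (z * cexp (RtoC x * z) - 0) by ring.
      apply (is_derive_minus (V := C_R_NormedModule)); [apply is_derive_cexp_line|].
      apply (is_derive_ext (V := C_R_NormedModule) (fun _ => RtoC 1)).
      * intros y. unfold exp_partial. rewrite sum_O. simpl. rewrite Rinv_1. symmetry.
        apply Cmult_1_l.
      * exact (is_derive_const (V := C_R_NormedModule) (RtoC 1) x).
    + intros x x_in. rewrite Cmod_mult, Cmod_cexp, re_mult. simpl.
      replace (exp (Cmod z) * (Cmod z * 1) * (1 / 1))%R with (Cmod z * exp (Cmod z))%R by field.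
      apply Rmult_le_compat_l; [apply Cmod_ge_0|]. apply exp_le.
      pose proof (Re_le_Cmod z). pose proof (Cmod_ge_0 z). nra.
  - apply (Cmod_le_of_derive_le_monomial
      (fun x => cexp (RtoC x * z) - exp_partial (RtoC x * z) (S n))
      (fun x => z * cexp (RtoC x * z) - z * exp_partial (RtoC x * z) n));
        [apply start | easy | |].
    + intros x _. apply (is_derive_minus (V := C_R_NormedModule)); [apply is_derive_cexp_line|].
      apply is_derive_exp_partial.
    + intros x x_in. specialize (IH x ltac:(lra)).
      replace (z * cexp (RtoC x * z) - z * exp_partial (RtoC x * z) n)
        with (z * (cexp (RtoC x * z) - exp_partial (RtoC x * z) n)) by ring.
      rewrite Cmod_mult. eapply Rle_trans;
        [apply Rmult_le_compat_l; [apply Cmod_ge_0 | exact IH]|].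
      apply Req_le. rewrite (Rmult_comm (Cmod z)). simpl. ring.
Qed.

Lemma cexp_taylor_remainder (z : C) (n : nat) :
  Cmod (cexp z - exp_partial z n) <= exp (Cmod z) * (Cmod z ^ S n / INR (fact (S n))).
Proof.
  pose proof (cexp_taylor_remainder_path z n 1 ltac:(lra)) as remainder_le.
  rewrite Cmult_1_l, pow1 in remainder_le.
  eapply Rle_trans; [exact remainder_le|]. apply Req_le. unfold Rdiv. ring.
Qed.

Lemma cpow_pos_cexp (x : R) (s : C) : cpow_pos x s = cexp (RtoC (ln x) * s).
Proof.
  unfold cpow_pos, cexp. rewrite re_mult, im_mult. simpl.
  rewrite !Rmult_0_l, Rminus_0_r, Rplus_0_r, !(Rmult_comm (ln x)). reflexivity.
Qed.

Lemma cpow_pos_plus (x : R) (s u : C) : cpow_pos x (s + u) = cpow_pos x s * cpow_pos x u.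
Proof. rewrite !cpow_pos_cexp, <- cexp_plus. f_equal. ring. Qed.

Lemma cpow_pos_mult (x y : R) (s : C) : 0 < x -> 0 < y ->
  cpow_pos (x * y) s = cpow_pos x s * cpow_pos y s.
Proof.
  intros x_pos y_pos. rewrite !cpow_pos_cexp, ln_mult, RtoC_plus, <- cexp_plus by easy.
  f_equal. ring.
Qed.

Lemma cpow_pos_1_l (s : C) : cpow_pos 1 s = 1.
Proof. rewrite cpow_pos_cexp, ln_1, Cmult_0_l. apply cexp_0. Qed.

Lemma cpow_pos_1_r (x : R) : 0 < x -> cpow_pos x 1 = RtoC x.
Proof.
  intros x_pos. unfold cpow_pos; simpl.
  rewrite Rmult_1_l, Rmult_0_l, exp_ln, cos_0, sin_0 by easy. unfold RtoC. f_equal; ring.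
Qed.

Lemma Cmod_cpow_pos (x : R) (s : C) : Cmod (cpow_pos x s) = Rpower x (Re s).
Proof.
  rewrite cpow_pos_cexp, Cmod_cexp, re_mult. unfold Rpower. f_equal. simpl. ring.
Qed.

Lemma is_derive_cpow_pos (a : C) (x : R) : 0 < x ->
  is_Cderive (fun x => cpow_pos x a) x (a * cpow_pos x (a - 1)).
Proof.
  intros x_pos.
  apply (is_derive_ext (V := C_R_NormedModule) (fun x => cexp (RtoC (ln x) * a)));
    [intros; symmetry; apply cpow_pos_cexp|].
  replace (a * cpow_pos x (a - 1)) with (RtoC (/ x) * a * cexp (RtoC (ln x) * a)).
  - apply is_derive_cexp_comp. auto_derive; [easy | ring].
  - rewrite <- cpow_pos_cexp. replace a with (a - 1 + 1) at 2 by ring.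
    rewrite cpow_pos_plus, cpow_pos_1_r, RtoC_inv by lra. field. apply RtoC_neq0. lra.
Qed.

Lemma Rpower_1_l (c : R) : Rpower 1 c = 1%R.
Proof. unfold Rpower. rewrite ln_1, Rmult_0_r. apply exp_0. Qed.

Lemma Rpower_antimono (x y c : R) : 0 < x <= y -> c <= 0 -> Rpower y c <= Rpower x c.
Proof.
  intros x_le_y c_le0. replace c with (- - c)%R by ring. rewrite !(Rpower_Ropp _ (- c)).
  apply Rinv_le_contravar; [apply exp_pos | apply Rle_Rpower_l; lra].
Qed.

Lemma is_lim_seq_Rpower_opp (c : R) : 0 < c ->
  is_lim_seq (fun n => Rpower (INR (S n)) (- c)) 0%R.
Proof.
  intros c_pos.
  assert (ln_lim : is_lim_seq (fun n => ln (INR (S n))) p_infty).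
  { apply (is_lim_comp_seq ln _ p_infty); [apply is_lim_ln_p | now exists 0%nat|].
    apply (is_lim_seq_incr_1 INR), is_lim_seq_INR. }
  apply (is_lim_comp_seq exp _ m_infty); [apply is_lim_exp_m | now exists 0%nat|].
  apply (is_lim_seq_scal_l _ (- c)) in ln_lim. simpl in ln_lim.
  destruct (Rle_dec 0 (- c)); [lra | exact ln_lim].
Qed.

(** * The regularised zeta function *)

Lemma Cmod_cpow_pos_diff_le (a : C) (x y : R) : 0 < x <= y -> Re a <= 1 ->
  Cmod (cpow_pos y a - cpow_pos x a) <= Cmod a * Rpower x (Re a - 1) * (y - x).
Proof.
  intros x_le_y Re_le1. rewrite Rmult_minus_distr_l.
  apply (Cmod_increment_le (fun t => cpow_pos t a) (fun t => a * cpow_pos t (a - 1))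
    (fun t => Cmod a * Rpower x (Re a - 1) * t)%R (fun _ => Cmod a * Rpower x (Re a - 1))%R);
      [lra| | |].
  - intros t t_in. apply is_derive_cpow_pos. lra.
  - intros t _. auto_derive; [easy | ring].
  - intros t t_in. rewrite Cmod_mult, Cmod_cpow_pos. apply Rmult_le_compat_l; [apply Cmod_ge_0|].
    change (Re (a - 1)) with (Re a - 1)%R. apply Rpower_antimono; lra.
Qed.

(* The second-order remainder of [x |-> x^(1-s)] is the Euler-Maclaurin error of one step. *)
Lemma Cmod_cpow_pos_taylor_le (s : C) (x : R) : 0 < x -> 0 <= Re s ->
  Cmod (cpow_pos (x + 1) (1 - s) - cpow_pos x (1 - s) + (s - 1) * cpow_pos x (- s))
    <= Cmod s * Cmod (s - 1) * Rpower x (- Re s - 1).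
Proof.
  intros x_pos Re_ge0.
  set (M := (Cmod s * Cmod (s - 1) * Rpower x (- Re s - 1))%R).
  set (f := fun t => cpow_pos t (1 - s) - RtoC t * ((1 - s) * cpow_pos x (- s))).
  replace (cpow_pos (x + 1) (1 - s) - cpow_pos x (1 - s) + (s - 1) * cpow_pos x (- s))
    with (f (x + 1)%R - f x) by (unfold f; rewrite RtoC_plus; ring).
  replace M with (M * (x + 1) - M * x)%R by ring.
  apply (Cmod_increment_le f
    (fun t => (1 - s) * cpow_pos t (- s) - RtoC 1 * ((1 - s) * cpow_pos x (- s)))
    (fun t => M * t)%R (fun _ => M)); [lra| | |].
  - intros t t_in. apply (is_derive_minus (V := C_R_NormedModule)).
    + replace (- s) with (1 - s - 1) by ring. apply is_derive_cpow_pos. lra.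
    + apply is_derive_RtoC_scal. exact (is_derive_id t).
  - intros t _. auto_derive; [easy | ring].
  - intros t t_in.
    replace ((1 - s) * cpow_pos t (- s) - 1 * ((1 - s) * cpow_pos x (- s)))
      with (- (s - 1) * (cpow_pos t (- s) - cpow_pos x (- s))) by ring.
    rewrite Cmod_mult, Cmod_opp. change (- Re s)%R with (Re (- s)) in Re_ge0.
    pose proof (Cmod_cpow_pos_diff_le (- s) x t ltac:(lra) ltac:(simpl; unfold Re in *; lra))
      as diff_le.
    rewrite Cmod_opp in diff_le. change (Re (- s)) with (- Re s)%R in diff_le.
    assert (factor_ge0 : 0 <= Cmod s * Rpower x (- Re s - 1)).
    { apply Rmult_le_pos; [apply Cmod_ge_0 | apply Rlt_le, exp_pos]. }
    unfold M. rewrite (Rmult_comm (Cmod s)), Rmult_assoc.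
    apply Rmult_le_compat_l; [apply Cmod_ge_0 | nra].
Qed.

Lemma Rpower_telescope (c x : R) : 0 < c -> 0 < x ->
  Rpower (x + 1) (- c - 1) <= / c * (Rpower x (- c) - Rpower (x + 1) (- c)).
Proof.
  intros c_pos x_pos.
  set (slope := (c * Rpower (x + 1) (- c - 1))%R).
  assert (decreasing : Rpower (x + 1) (- c) + slope * (x + 1) <= Rpower x (- c) + slope * x).
  { apply (derive_nonpos_decreasing (fun t => Rpower t (- c) + slope * t)%R
      (fun t => - c * Rpower t (- c - 1) + slope)%R); [lra| |].
    - intros t t_in. apply (is_derive_plus (V := R_NormedModule)).
      + apply is_derive_Reals, derivable_pt_lim_power. lra.
      + auto_derive; [easy | ring].
    - intros t t_in. unfold slope.
      pose proof (Rpower_antimono t (x + 1) (- c - 1) ltac:(lra) ltac:(lra)). nra. }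
  rewrite Rmult_comm. apply Rle_div_r; [easy|]. unfold slope in decreasing. lra.
Qed.

(* The Euler-Maclaurin partial sums of [(s - 1) zeta s]. *)
Definition zeta_partial (s : C) (N : nat) : C :=
  (s - 1) * sum_n (fun i => cpow_pos (INR (S i)) (- s)) N + cpow_pos (INR (S (S N))) (1 - s).

Definition zeta_reg (s : C) : C :=
  iota (T := C_CompleteNormedModule) (is_Clim (zeta_partial s)).

Lemma Cmod_zeta_partial_step_le (s : C) (N : nat) : 0 <= Re s ->
  Cmod (zeta_partial s (S N) - zeta_partial s N)
    <= Cmod s * Cmod (s - 1) * Rpower (INR (S (S N))) (- Re s - 1).
Proof.
  intros Re_ge0. eapply Rle_trans; [|apply Cmod_cpow_pos_taylor_le; [apply lt_0_INR; lia | easy]].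
  apply Req_le. f_equal. unfold zeta_partial. rewrite sum_Sn_C, (S_INR (S (S N))). ring.
Qed.

Lemma Cmod_zeta_partial_diff_le (s : C) (N M : nat) : 0 < Re s -> (N <= M)%nat ->
  Cmod (zeta_partial s M - zeta_partial s N)
    <= Cmod s * Cmod (s - 1) / Re s * Rpower (INR (S N)) (- Re s).
Proof.
  intros Re_pos N_le_M.
  set (B := (Cmod s * Cmod (s - 1) / Re s)%R).
  assert (B_ge0 : 0 <= B) by (apply Rdiv_le_0_compat;
    [apply Rmult_le_pos; apply Cmod_ge_0 | easy]).
  enough (telescoped : Cmod (zeta_partial s M - zeta_partial s N)
     <= B * (Rpower (INR (S N)) (- Re s) - Rpower (INR (S M)) (- Re s))).
  { assert (0 < Rpower (INR (S M)) (- Re s)) by apply exp_pos. nra. }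
  induction N_le_M as [|M N_le_M IH].
  - replace (zeta_partial s N - zeta_partial s N) with (RtoC 0) by ring. rewrite Cmod_0. lra.
  - eapply Rle_trans; [apply (Cmod_minus_triangle _ (zeta_partial s M))|].
    pose proof (Cmod_zeta_partial_step_le s M ltac:(lra)) as step_le.
    pose proof (Rpower_telescope (Re s) (INR (S M)) Re_pos (lt_0_INR _ (Nat.lt_0_succ M)))
      as telescope.
    rewrite <- S_INR in telescope.
    assert (Cmod s * Cmod (s - 1) * Rpower (INR (S (S M))) (- Re s - 1)
      <= B * (Rpower (INR (S M)) (- Re s) - Rpower (INR (S (S M))) (- Re s))).
    { unfold B, Rdiv. rewrite (Rmult_assoc (Cmod s * Cmod (s - 1))).
      apply Rmult_le_compat_l; [apply Rmult_le_pos; apply Cmod_ge_0 | exact telescope]. }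
    lra.
Qed.

Lemma zeta_partial_lim (s : C) : 0 < Re s -> is_Clim (zeta_partial s) (zeta_reg s).
Proof.
  intros Re_pos.
  destruct (is_Clim_Cauchy (zeta_partial s)
    (fun N => Cmod s * Cmod (s - 1) / Re s * Rpower (INR (S N)) (- Re s))%R) as [l l_lim].
  - intros N M. now apply Cmod_zeta_partial_diff_le.
  - now apply is_lim_seq_scal_0, is_lim_seq_Rpower_opp.
  - unfold zeta_reg, is_Clim.
    now rewrite (iota_filterlim_locally (V := C_CompleteNormedModule) _ l).
Qed.

Lemma Cmod_zeta_reg_minus_partial_le (s : C) (N : nat) : 0 < Re s ->
  Cmod (zeta_reg s - zeta_partial s N)
    <= Cmod s * Cmod (s - 1) / Re s * Rpower (INR (S N)) (- Re s).
Proof.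
  intros Re_pos. apply (is_Clim_dist_le (zeta_partial s)); [now apply zeta_partial_lim|].
  exists N. intros M. now apply Cmod_zeta_partial_diff_le.
Qed.

Lemma Cmod_zeta_reg_le (s : C) : 0 < Re s ->
  Cmod (zeta_reg s) <= Cmod (s - 1) + 2 + Cmod s * Cmod (s - 1) / Re s.
Proof.
  intros Re_pos. pose proof (Cmod_zeta_reg_minus_partial_le s 0 Re_pos) as remainder_le.
  change (INR 1) with 1%R in remainder_le. rewrite Rpower_1_l, Rmult_1_r in remainder_le.
  eapply Rle_trans; [apply (Cmod_le_plus_minus _ (zeta_partial s 0))|].
  apply Rplus_le_compat; [|exact remainder_le].
  unfold zeta_partial. rewrite sum_O. change (INR 1) with 1%R. rewrite cpow_pos_1_l.
  eapply Rle_trans; [apply Cmod_triangle|]. apply Rplus_le_compat.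
  - rewrite Cmult_1_r. apply Rle_refl.
  - rewrite Cmod_cpow_pos. change (Re (1 - s)) with (1 - Re s)%R. change (INR 2) with 2%R.
    rewrite <- (Rpower_1 2) at 2 by lra. apply Rle_Rpower; lra.
Qed.

Lemma eta_odd_partial (s : C) (N : nat) :
  sum_n (eta_term s) (2 * N + 1) = sum_n (fun i => cpow_pos (INR (S i)) (- s)) (2 * N + 1)
    - 2 * cpow_pos 2 (- s) * sum_n (fun i => cpow_pos (INR (S i)) (- s)) N :> C.
Proof.
  assert (double : forall m,
    cpow_pos (INR (S (S (2 * m)))) (- s) = cpow_pos 2 (- s) * cpow_pos (INR (S m)) (- s)).
  { intros m. replace (INR (S (S (2 * m)))) with (2 * INR (S m))%R
      by (rewrite !S_INR, mult_INR; simpl; ring).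
    apply cpow_pos_mult; [lra | apply lt_0_INR; lia]. }
  rewrite Nat.add_1_r. induction N as [|N IH].
  - change (2 * 0)%nat with 0%nat. rewrite sum_Sn_C, (sum_Sn_C (fun i => _)), !sum_O.
    unfold eta_term. change 2%nat with (S (S (2 * 0))). rewrite double. simpl.
    rewrite !Rmult_1_r. ring.
  - replace (2 * S N)%nat with (S (S (2 * N))) by lia.
    rewrite !(sum_Sn_C _ (S _)), (sum_Sn_C _ N), IH.
    unfold eta_term. replace (S (S (S (S (2 * N))))) with (S (S (2 * S N))) by lia.
    rewrite double. replace (S (S (2 * N))) with (2 * S N)%nat by lia.
    rewrite pow_1_even, pow_1_odd. ring.
Qed.

Lemma eta_odd_zeta_partial (s : C) (N : nat) :
  (s - 1) * sum_n (eta_term s) (2 * N + 1)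
  = zeta_partial s (2 * N + 1) - cpow_pos 2 (1 - s) * zeta_partial s N
    + (cpow_pos (INR (S (S (2 * N + 1))) + 1) (1 - s)
      - cpow_pos (INR (S (S (2 * N + 1)))) (1 - s)).
Proof.
  rewrite eta_odd_partial. unfold zeta_partial.
  replace (INR (S (S (2 * N + 1))) + 1)%R with (2 * INR (S (S N)))%R
    by (rewrite !S_INR, plus_INR, mult_INR; simpl; ring).
  rewrite cpow_pos_mult by (try lra; apply lt_0_INR; lia).
  replace (cpow_pos 2 (1 - s)) with (2 * cpow_pos 2 (- s)); [ring|].
  unfold Cminus. rewrite cpow_pos_plus, cpow_pos_1_r by lra. reflexivity.
Qed.

Lemma Cmod_eta_odd_partial_le (s : C) (N : nat) : 0 < Re s ->
  Cmod ((s - 1) * sum_n (eta_term s) (2 * N + 1) - (1 - cpow_pos 2 (1 - s)) * zeta_reg s)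
    <= ((1 + Cmod (cpow_pos 2 (1 - s))) * (Cmod s * Cmod (s - 1) / Re s) + Cmod (s - 1))
       * Rpower (INR (S N)) (- Re s).
Proof.
  intros Re_pos. rewrite eta_odd_zeta_partial.
  set (q := cpow_pos 2 (1 - s)). set (B := (Cmod s * Cmod (s - 1) / Re s)%R).
  assert (B_ge0 : 0 <= B) by (apply Rdiv_le_0_compat;
    [apply Rmult_le_pos; apply Cmod_ge_0 | easy]).
  set (x := INR (S (S (2 * N + 1)))).
  assert (x_ge : INR (S N) <= x) by (apply le_INR; lia).
  assert (N_pos : 0 < INR (S N)) by (apply lt_0_INR; lia).
  assert (antimono : forall y, INR (S N) <= y ->
    Rpower y (- Re s) <= Rpower (INR (S N)) (- Re s)).
  { intros y y_ge. apply Rpower_antimono; lra. }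
  replace (zeta_partial s (2 * N + 1) - q * zeta_partial s N
      + (cpow_pos (x + 1) (1 - s) - cpow_pos x (1 - s)) - (1 - q) * zeta_reg s)
    with (q * (zeta_reg s - zeta_partial s N) - (zeta_reg s - zeta_partial s (2 * N + 1))
      + (cpow_pos (x + 1) (1 - s) - cpow_pos x (1 - s))) by ring.
  eapply Rle_trans; [apply Cmod_triangle|]. rewrite Rmult_plus_distr_r. apply Rplus_le_compat.
  - eapply Rle_trans; [apply Cmod_minus_le_plus|].
    rewrite Cmod_mult, Rplus_comm, !Rmult_plus_distr_r, Rmult_1_l.
    apply Rplus_le_compat.
    + eapply Rle_trans; [now apply Cmod_zeta_reg_minus_partial_le|].
      apply Rmult_le_compat_l; [easy|]. apply antimono, le_INR. lia.
    + rewrite Rmult_assoc. apply Rmult_le_compat_l; [apply Cmod_ge_0|].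
      now apply Cmod_zeta_reg_minus_partial_le.
  - pose proof (Cmod_cpow_pos_diff_le (1 - s) x (x + 1)) as diff_le.
    change (Re (1 - s)) with (1 - Re s)%R in diff_le. rewrite (Cmod_minus_sym 1 s) in diff_le.
    replace (1 - Re s - 1)%R with (- Re s)%R in diff_le by ring.
    replace (x + 1 - x)%R with 1%R in diff_le by ring. rewrite Rmult_1_r in diff_le.
    eapply Rle_trans; [apply diff_le; lra|].
    apply Rmult_le_compat_l; [apply Cmod_ge_0 | now apply antimono].
Qed.

Lemma eta_odd_partial_lim (s : C) : 0 < Re s -> s <> 1 ->
  is_Clim (fun N => sum_n (eta_term s) (2 * N + 1))
    ((1 - cpow_pos 2 (1 - s)) * zeta_reg s / (s - 1)).
Proof.
  intros Re_pos s_neq1. pose proof (Cminus_eq_contra s 1 s_neq1) as s1_neq0.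
  set (B := (Cmod s * Cmod (s - 1) / Re s)%R).
  set (A := ((1 + Cmod (cpow_pos 2 (1 - s))) * B + Cmod (s - 1))%R).
  apply (is_Clim_squeeze _ _ (fun N => / Cmod (s - 1) * (A * Rpower (INR (S N)) (- Re s)))%R);
    [|now do 2 apply is_lim_seq_scal_0; apply is_lim_seq_Rpower_opp].
  intros N.
  replace (sum_n (eta_term s) (2 * N + 1) - (1 - cpow_pos 2 (1 - s)) * zeta_reg s / (s - 1))
    with (/ (s - 1) * ((s - 1) * sum_n (eta_term s) (2 * N + 1)
      - (1 - cpow_pos 2 (1 - s)) * zeta_reg s))
    by (field; easy).
  rewrite Cmod_mult, Cmod_inv by easy.
  apply Rmult_le_compat_l; [|now apply Cmod_eta_odd_partial_le].
  now apply Rlt_le, Rinv_0_lt_compat, Cmod_gt_0.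
Qed.

Lemma eta_zeta_reg (s : C) : 0 < Re s -> s <> 1 ->
  eta s = (1 - cpow_pos 2 (1 - s)) * zeta_reg s / (s - 1).
Proof.
  intros Re_pos s_neq1. set (l := (1 - cpow_pos 2 (1 - s)) * zeta_reg s / (s - 1)).
  assert (eta_series : is_Cseries (eta_term s) l).
  { apply is_Cseries_of_odd_partial_sums; [|now apply eta_odd_partial_lim].
    apply (is_Clim_squeeze _ _ (fun n => Rpower (INR (S n)) (- Re s))).
    - intros n. replace (eta_term s n - 0) with (eta_term s n) by ring. unfold eta_term.
      rewrite Cmod_mult, Cmod_cpow_pos, Cmod_R, pow_1_abs, Rmult_1_l.
      apply Rle_refl.
    - now apply is_lim_seq_Rpower_opp. }
  destruct (is_Cseries_Re_Im _ _ eta_series) as [Re_series Im_series].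
  unfold eta. rewrite (is_series_unique _ _ Re_series), (is_series_unique _ _ Im_series).
  symmetry. apply surjective_pairing.
Qed.

Lemma zeta_factor_neq0_off_line (s : C) : Re s <> 1%R -> 1 - cpow_pos 2 (1 - s) <> 0.
Proof.
  intros Re_neq1 factor_eq0. apply Ceq_minus in factor_eq0. rewrite cpow_pos_cexp in factor_eq0.
  pose proof (cexp_eq_1_Re _ (eq_sym factor_eq0)) as Re_eq0. rewrite re_mult in Re_eq0.
  simpl in Re_eq0.
  pose proof ln_lt_2. unfold Re in *. nra.
Qed.

Lemma zeta_factor_neq0_disc (s : C) : 0 < Cmod (s - 1) < 1 -> 1 - cpow_pos 2 (1 - s) <> 0.
Proof.
  intros s_in factor_eq0. apply Ceq_minus in factor_eq0. rewrite cpow_pos_cexp in factor_eq0.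
  assert (ln2_lt1 : ln 2 < 1).
  { rewrite <- (ln_exp 1). apply ln_increasing; [lra|]. pose proof (exp_ineq1 1). lra. }
  pose proof ln_lt_2. pose proof PI2_1 as PI_gt. unfold PI2 in PI_gt.
  assert (exponent_eq0 : RtoC (ln 2) * (1 - s) = 0).
  { apply cexp_eq_1; [easy|]. eapply Rle_lt_trans; [apply Rabs_Im_le_Cmod|].
    rewrite Cmod_mult, Cmod_RtoC_pos, Cmod_minus_sym by lra. nra. }
  apply (f_equal Cmod) in exponent_eq0.
  rewrite Cmod_mult, Cmod_0, Cmod_RtoC_pos, Cmod_minus_sym in exponent_eq0 by lra. nra.
Qed.

Lemma zeta_reg_eq (s : C) : 0 < Re s -> s <> 1 -> 1 - cpow_pos 2 (1 - s) <> 0 ->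
  zeta_reg s = (s - 1) * zeta s.
Proof.
  intros Re_pos s_neq1 factor_neq0. unfold zeta. rewrite eta_zeta_reg by easy. field.
  split; [now apply Cminus_eq_contra | easy].
Qed.

Lemma zeta_reg_disc (s : C) : 0 < Cmod (s - 1) < 1 -> zeta_reg s = (s - 1) * zeta s.
Proof.
  intros s_in. apply zeta_reg_eq; [| |now apply zeta_factor_neq0_disc].
  - pose proof (Re_ge_opp_Cmod (s - 1)) as Re_ge.
    change (Re (s - 1)) with (Re s - 1)%R in Re_ge. lra.
  - intros ->. replace (1 - 1) with (RtoC 0) in s_in by ring. rewrite Cmod_0 in s_in. lra.
Qed.

Definition critical_line (t : R) : C := (1 / 2, t)%R.

Lemma zeta_reg_critical_line (t : R) :
  zeta_reg (critical_line t) = (critical_line t - 1) * zeta (critical_line t).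
Proof.
  apply zeta_reg_eq; [simpl; lra | |apply zeta_factor_neq0_off_line; simpl; lra].
  intros s_eq. apply (f_equal Re) in s_eq. simpl in s_eq. lra.
Qed.

(** * Uniform polynomial approximation *)

Definition psum (a : nat -> C) (z : C) (n : nat) : C := sum_n (fun j => a j * z ^ j) n.

Lemma psum_0 (a : nat -> C) (z : C) : psum a z 0 = a 0%nat.
Proof. unfold psum. rewrite sum_O. apply Cmult_1_r. Qed.

Lemma psum_S (a : nat -> C) (z : C) (n : nat) : psum a z (S n) = psum a z n + a (S n) * z ^ S n.
Proof. apply sum_Sn_C. Qed.

Lemma psum_ext (a b : nat -> C) (z : C) (n : nat) :
  (forall j, (j <= n)%nat -> a j = b j) -> psum a z n = psum b z n.
Proof. intros a_eq. apply sum_n_Cext. intros j j_le. now rewrite a_eq. Qed.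

Lemma psum_plus (a b : nat -> C) (z : C) (n : nat) :
  psum (fun j => a j + b j) z n = psum a z n + psum b z n.
Proof. unfold psum. rewrite <- sum_n_Cplus. apply sum_n_Cext. intros; ring. Qed.

Lemma psum_scal (c : C) (a : nat -> C) (z : C) (n : nat) :
  psum (fun j => c * a j) z n = c * psum a z n.
Proof. unfold psum. rewrite <- sum_n_Cmult_l. apply sum_n_Cext. intros; ring. Qed.

Lemma psum_minus (a b : nat -> C) (z : C) (n : nat) :
  psum (fun j => a j - b j) z n = psum a z n - psum b z n.
Proof.
  rewrite (psum_ext _ (fun j => a j + RtoC (-1) * b j)) by (intros; ring).
  rewrite psum_plus, psum_scal. ring.
Qed.

Lemma psum_at_0 (a : nat -> C) (n : nat) : psum a 0 n = a 0%nat.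
Proof.
  induction n as [|n IH]; [apply psum_0|]. rewrite psum_S, IH, Cpow_S. ring.
Qed.

Lemma psum_diff (a : nat -> C) (z : C) (n m : nat) : (n <= m)%nat ->
  psum a z m - psum a z n = sum_n_m (fun j => a j * z ^ j) (S n) m.
Proof. intros n_le. symmetry. now apply (sum_n_m_sum_n (G := C_AbelianGroup)). Qed.

Definition shift_coeffs (a : nat -> C) (j : nat) : C := match j with O => 0 | S i => a i end.

Lemma psum_shift (a : nat -> C) (z : C) (n : nat) :
  psum (shift_coeffs a) z (S n) = z * psum a z n.
Proof.
  induction n as [|n IH]; rewrite psum_S; [|rewrite IH, psum_S, (Cpow_S z (S n)); simpl; ring].
  rewrite !psum_0. simpl. ring.
Qed.

Definition polynomial (p : C -> C) : Prop :=
  exists a, eventually (fun n => forall z, p z = psum a z n).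

Lemma polynomial_ext (p q : C -> C) : (forall z, p z = q z) -> polynomial p -> polynomial q.
Proof.
  intros p_eq [a [N p_psum]]. exists a, N. intros n n_ge z. rewrite <- p_eq. auto.
Qed.

Lemma polynomial_plus (p q : C -> C) :
  polynomial p -> polynomial q -> polynomial (fun z => p z + q z).
Proof.
  intros [a [N p_psum]] [b [M q_psum]]. exists (fun j => a j + b j), (N + M)%nat. intros n n_ge z.
  now rewrite psum_plus, (p_psum n), (q_psum n) by lia.
Qed.

Lemma polynomial_scal (c : C) (p : C -> C) : polynomial p -> polynomial (fun z => c * p z).
Proof.
  intros [a [N p_psum]]. exists (fun j => c * a j), N. intros n n_ge z.
  now rewrite psum_scal, (p_psum n).
Qed.

Lemma polynomial_mult_id (p : C -> C) : polynomial p -> polynomial (fun z => z * p z).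
Proof.
  intros [a [N p_psum]]. exists (shift_coeffs a), (S N). intros [|n] n_ge z; [lia|].
  now rewrite psum_shift, (p_psum n) by lia.
Qed.

Lemma polynomial_const (c : C) : polynomial (fun _ => c).
Proof.
  exists (fun j => match j with O => c | S _ => 0 end), 0%nat. intros n _ z.
  induction n as [|n IH]; [now rewrite psum_0 | rewrite psum_S, <- IH; ring].
Qed.

Lemma polynomial_mult_pow (p : C -> C) (n : nat) :
  polynomial p -> polynomial (fun z => z ^ n * p z).
Proof.
  intros p_poly. induction n as [|n IH].
  - apply (polynomial_ext p); [intros z; simpl; ring | easy].
  - apply (polynomial_ext (fun z => z * (z ^ n * p z))); [intros z; rewrite Cpow_S; ring|].
    now apply polynomial_mult_id.
Qed.

Lemma polynomial_mult (p q : C -> C) :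
  polynomial p -> polynomial q -> polynomial (fun z => p z * q z).
Proof.
  intros [a [N p_psum]] q_poly.
  apply (polynomial_ext (fun z => psum a z N * q z)); [intros z; now rewrite (p_psum N)|].
  clear p_psum. induction N as [|N IH].
  - apply (polynomial_ext (fun z => a 0%nat * q z)); [intros z; now rewrite psum_0|].
    now apply polynomial_scal.
  - apply (polynomial_ext (fun z => psum a z N * q z + a (S N) * (z ^ S N * q z))).
    + intros z. rewrite psum_S. ring.
    + apply polynomial_plus; [easy|]. now apply polynomial_scal, polynomial_mult_pow.
Qed.

Definition bounded_set (K : C -> Prop) : Prop := exists B : R, forall z, K z -> Cmod z <= B.

Lemma psum_bounded (K : C -> Prop) (a : nat -> C) (n : nat) : bounded_set K ->
  exists B : R, 0 <= B /\ forall z, K z -> Cmod (psum a z n) <= B.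
Proof.
  intros [B K_le]. exists (sum_n (fun j => Cmod (a j) * Rabs B ^ j)%R n). split.
  - eapply Rle_trans; [|apply (sum_n_term_le _ n 0); [|lia]].
    + apply Rmult_le_pos; [apply Cmod_ge_0 | apply pow_le, Rabs_pos].
    + intros j. apply Rmult_le_pos; [apply Cmod_ge_0 | apply pow_le, Rabs_pos].
  - intros z z_in. apply Cmod_sum_n_m_le. intros j _. rewrite Cmod_mult, Cmod_pow.
    apply Rmult_le_compat_l; [apply Cmod_ge_0|]. apply pow_incr. split; [apply Cmod_ge_0|].
    eapply Rle_trans; [now apply K_le | apply Rle_abs].
Qed.

Lemma psum_lipschitz (K : C -> Prop) (a : nat -> C) (n : nat) : bounded_set K ->
  exists L : R, forall z w, K z -> K w -> Cmod (psum a z n - psum a w n) <= L * Cmod (z - w).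
Proof.
  intros [B K_le].
  assert (pow_lipschitz : forall j, exists L : R, forall z w, K z -> K w ->
    Cmod (z ^ j - w ^ j) <= L * Cmod (z - w)).
  { induction j as [|j [L IH]].
    - exists 0%R. intros z w _ _. simpl. replace (1 - 1) with (RtoC 0) by ring.
      rewrite Cmod_0. lra.
    - exists (Rabs B * L + Rabs B ^ j)%R. intros z w z_in w_in. specialize (IH z w z_in w_in).
      replace (z ^ S j - w ^ S j) with (z * (z ^ j - w ^ j) + w ^ j * (z - w))
        by (rewrite !Cpow_S; ring).
      eapply Rle_trans; [apply Cmod_triangle|].
      rewrite !Cmod_mult, Cmod_pow, Rmult_plus_distr_r, Rmult_assoc.
      pose proof (Rle_abs B). pose proof (K_le z z_in). pose proof (K_le w w_in).
      apply Rplus_le_compat.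
      + apply Rmult_le_compat; [apply Cmod_ge_0 | apply Cmod_ge_0 | lra | easy].
      + apply Rmult_le_compat_r; [apply Cmod_ge_0|]. apply pow_incr.
        split; [apply Cmod_ge_0 | lra]. }
  induction n as [|n [L IH]].
  - exists 0%R. intros z w _ _. rewrite !psum_0.
    replace (a 0%nat - a 0%nat) with (RtoC 0) by ring. rewrite Cmod_0. lra.
  - destruct (pow_lipschitz (S n)) as [L' pow_le']. exists (L + Cmod (a (S n)) * L')%R.
    intros z w z_in w_in.
    rewrite !psum_S. replace (psum a z n + a (S n) * z ^ S n - (psum a w n + a (S n) * w ^ S n))
      with ((psum a z n - psum a w n) + a (S n) * (z ^ S n - w ^ S n)) by ring.
    eapply Rle_trans; [apply Cmod_triangle|]. rewrite Cmod_mult, Rmult_plus_distr_r, Rmult_assoc.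
    apply Rplus_le_compat; [now apply IH|].
    apply Rmult_le_compat_l; [apply Cmod_ge_0 | now apply pow_le'].
Qed.

Definition poly_approx (K : C -> Prop) (f : C -> C) : Prop :=
  forall eps : R, 0 < eps ->
    exists p, polynomial p /\ forall z, K z -> Cmod (f z - p z) <= eps.

Section PolynomialApproximation.

Variable K : C -> Prop.
Hypothesis K_bounded : bounded_set K.

Lemma poly_approx_bounded (f : C -> C) : poly_approx K f ->
  exists B : R, 0 <= B /\ forall z, K z -> Cmod (f z) <= B.
Proof.
  intros f_approx. destruct (f_approx 1%R ltac:(lra)) as [p [[a [N p_psum]] p_close]].
  destruct (psum_bounded K a N K_bounded) as [B [B_ge0 p_le]].
  exists (B + 1)%R. split; [lra|]. intros z z_in.
  eapply Rle_trans; [apply (Cmod_le_plus_minus _ (p z))|].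
  specialize (p_close z z_in). specialize (p_le z z_in).
  rewrite <- (p_psum N (Nat.le_refl N)) in p_le. lra.
Qed.

Lemma poly_approx_uniformly_continuous (f : C -> C) (eps : R) : poly_approx K f -> 0 < eps ->
  exists d : R, 0 < d /\ forall z w, K z -> K w -> Cmod (z - w) <= d -> Cmod (f z - f w) <= eps.
Proof.
  intros f_approx eps_pos. destruct (f_approx (eps / 3)%R ltac:(lra))
    as [p [[a [N p_psum]] p_close]].
  destruct (psum_lipschitz K a N K_bounded) as [L lipschitz].
  destruct (small_factor (Rabs L) (eps / 3)%R ltac:(lra)) as [d [d_pos d_small]].
  exists d. split; [easy|]. intros z w z_in w_in z_near.
  specialize (lipschitz z w z_in w_in). rewrite <- !(p_psum N (Nat.le_refl N)) in lipschitz.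
  replace (f z - f w) with ((f z - p z) - (f w - p w) + (p z - p w)) by ring.
  eapply Rle_trans; [apply Cmod_triangle|].
  pose proof (Cmod_minus_le_plus (f z - p z) (f w - p w)).
  pose proof (p_close z z_in). pose proof (p_close w w_in).
  pose proof (Rle_abs L). pose proof (Rabs_pos L). pose proof (Cmod_ge_0 (z - w)). nra.
Qed.

Lemma poly_approx_polynomial (p : C -> C) : polynomial p -> poly_approx K p.
Proof.
  intros p_poly eps eps_pos. exists p. split; [easy|]. intros z _.
  replace (p z - p z) with (RtoC 0) by ring. rewrite Cmod_0. lra.
Qed.

Lemma poly_approx_const (c : C) : poly_approx K (fun _ => c).
Proof. apply poly_approx_polynomial, polynomial_const. Qed.

Lemma poly_approx_id : poly_approx K (fun z => z).
Proof.
  apply poly_approx_polynomial, (polynomial_ext (fun z => z * 1)); [intros; ring|].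
  apply polynomial_mult_id, polynomial_const.
Qed.

Lemma poly_approx_ext (f g : C -> C) :
  (forall z, K z -> f z = g z) -> poly_approx K f -> poly_approx K g.
Proof.
  intros f_eq f_approx eps eps_pos. destruct (f_approx eps eps_pos) as [p [p_poly p_close]].
  exists p. split; [easy|]. intros z z_in. rewrite <- f_eq by easy. auto.
Qed.

Lemma poly_approx_limit (f : C -> C) :
  (forall eps : R, 0 < eps -> exists g,
     poly_approx K g /\ forall z, K z -> Cmod (f z - g z) <= eps) ->
  poly_approx K f.
Proof.
  intros f_lim eps eps_pos. destruct (f_lim (eps / 2)%R ltac:(lra)) as [g [g_approx g_close]].
  destruct (g_approx (eps / 2)%R ltac:(lra)) as [p [p_poly p_close]].
  exists p. split; [easy|]. intros z z_in.
  eapply Rle_trans; [apply (Cmod_minus_triangle _ (g z))|].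
  specialize (g_close z z_in). specialize (p_close z z_in). lra.
Qed.

Lemma poly_approx_limit_seq (f : C -> C) (g : nat -> C -> C) (b : nat -> R) :
  (forall n, poly_approx K (g n)) -> (forall n z, K z -> Cmod (f z - g n z) <= b n) ->
  is_lim_seq b 0%R -> poly_approx K f.
Proof.
  intros g_approx f_close b_lim. apply poly_approx_limit. intros eps eps_pos.
  destruct (is_lim_seq_0_eventually_le b eps b_lim eps_pos) as [N b_small].
  exists (g N). split; [easy|]. intros z z_in.
  eapply Rle_trans; [now apply f_close | now apply b_small].
Qed.

Lemma poly_approx_plus (f g : C -> C) :
  poly_approx K f -> poly_approx K g -> poly_approx K (fun z => f z + g z).
Proof.
  intros f_approx g_approx eps eps_pos.
  destruct (f_approx (eps / 2)%R ltac:(lra)) as [p [p_poly p_close]].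
  destruct (g_approx (eps / 2)%R ltac:(lra)) as [q [q_poly q_close]].
  exists (fun z => p z + q z). split; [now apply polynomial_plus|]. intros z z_in.
  replace (f z + g z - (p z + q z)) with ((f z - p z) + (g z - q z)) by ring.
  eapply Rle_trans; [apply Cmod_triangle|].
  specialize (p_close z z_in). specialize (q_close z z_in). lra.
Qed.

Lemma poly_approx_polynomial_mult (p g : C -> C) :
  polynomial p -> poly_approx K g -> poly_approx K (fun z => p z * g z).
Proof.
  intros p_poly g_approx eps eps_pos.
  destruct (poly_approx_bounded p (poly_approx_polynomial p p_poly)) as [B [B_ge0 p_le]].
  destruct (small_factor B eps eps_pos) as [d [d_pos d_small]].
  destruct (g_approx d d_pos) as [q [q_poly q_close]].
  exists (fun z => p z * q z). split; [now apply polynomial_mult|]. intros z z_in.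
  replace (p z * g z - p z * q z) with (p z * (g z - q z)) by ring. rewrite Cmod_mult.
  eapply Rle_trans; [|exact d_small]. apply Rmult_le_compat; auto using Cmod_ge_0.
Qed.

Lemma poly_approx_mult (f g : C -> C) :
  poly_approx K f -> poly_approx K g -> poly_approx K (fun z => f z * g z).
Proof.
  intros f_approx g_approx. apply poly_approx_limit. intros eps eps_pos.
  destruct (poly_approx_bounded g g_approx) as [B [B_ge0 g_le]].
  destruct (small_factor B eps eps_pos) as [d [d_pos d_small]].
  destruct (f_approx d d_pos) as [p [p_poly p_close]].
  exists (fun z => p z * g z). split; [now apply poly_approx_polynomial_mult|]. intros z z_in.
  replace (f z * g z - p z * g z) with (g z * (f z - p z)) by ring. rewrite Cmod_mult.
  eapply Rle_trans; [|exact d_small]. apply Rmult_le_compat; auto using Cmod_ge_0.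
Qed.

Lemma poly_approx_opp (f : C -> C) : poly_approx K f -> poly_approx K (fun z => - f z).
Proof.
  intros f_approx. apply (poly_approx_ext (fun z => RtoC (-1) * f z)); [intros; ring|].
  apply poly_approx_mult; [apply poly_approx_const | easy].
Qed.

Lemma poly_approx_minus (f g : C -> C) :
  poly_approx K f -> poly_approx K g -> poly_approx K (fun z => f z - g z).
Proof. intros f_approx g_approx. now apply poly_approx_plus; [|apply poly_approx_opp]. Qed.

Lemma poly_approx_pow (f : C -> C) (n : nat) :
  poly_approx K f -> poly_approx K (fun z => f z ^ n).
Proof.
  intros f_approx. induction n as [|n IH]; [apply (poly_approx_const 1)|].
  now apply (poly_approx_mult f (fun z => f z ^ n)).
Qed.

Lemma poly_approx_sum_n (f : nat -> C -> C) (n : nat) :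
  (forall i, poly_approx K (f i)) -> poly_approx K (fun z => sum_n (fun i => f i z) n).
Proof.
  intros f_approx. induction n as [|n IH].
  - apply (poly_approx_ext (f 0%nat)); [intros; now rewrite sum_O | easy].
  - apply (poly_approx_ext (fun z => sum_n (fun i => f i z) n + f (S n) z)).
    + intros z _. now rewrite sum_Sn_C.
    + now apply poly_approx_plus.
Qed.

Lemma poly_approx_psum (a : nat -> C) (f : C -> C) (n : nat) :
  poly_approx K f -> poly_approx K (fun z => psum a (f z) n).
Proof.
  intros f_approx. apply (poly_approx_sum_n (fun j z => a j * f z ^ j)). intros j.
  apply poly_approx_mult; [apply poly_approx_const | now apply poly_approx_pow].
Qed.

Lemma poly_approx_comp (K' : C -> Prop) (f g : C -> C) :
  poly_approx K' f -> poly_approx K g -> (forall z, K z -> K' (g z)) ->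
  poly_approx K (fun z => f (g z)).
Proof.
  intros f_approx g_approx g_in. apply poly_approx_limit. intros eps eps_pos.
  destruct (f_approx eps eps_pos) as [p [[a [N p_psum]] p_close]].
  exists (fun z => psum a (g z) N). split; [now apply poly_approx_psum|].
  intros z z_in. rewrite <- p_psum by easy. auto.
Qed.

Lemma poly_approx_cexp (f : C -> C) : poly_approx K f -> poly_approx K (fun z => cexp (f z)).
Proof.
  intros f_approx. destruct (poly_approx_bounded f f_approx) as [B [B_ge0 f_le]].
  apply (poly_approx_limit_seq _ (fun n z => exp_partial (f z) n)
    (fun n => exp B * (B ^ S n / INR (fact (S n))))%R).
  - intros n. now apply (poly_approx_psum (fun j => RtoC (/ INR (fact j)))).
  - intros n z z_in. specialize (f_le z z_in).
    eapply Rle_trans; [apply cexp_taylor_remainder|]. apply Rmult_le_compat.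
    + apply Rlt_le, exp_pos.
    + apply Rdiv_le_0_compat; [apply pow_le, Cmod_ge_0 | apply INR_fact_lt_0].
    + now apply exp_le.
    + apply Rmult_le_compat_r; [apply Rlt_le, Rinv_0_lt_compat, INR_fact_lt_0|].
      apply pow_incr. split; [apply Cmod_ge_0 | easy].
  - apply is_lim_seq_scal_0, (is_lim_seq_incr_1 (fun n => B ^ n / INR (fact n))%R).
    apply is_lim_seq_Reals, cv_speed_pow_fact.
Qed.

Lemma poly_approx_cpow_pos (x : R) (f : C -> C) :
  poly_approx K f -> poly_approx K (fun z => cpow_pos x (f z)).
Proof.
  intros f_approx. apply (poly_approx_ext (fun z => cexp (RtoC (ln x) * f z))).
  - intros z _. symmetry. apply cpow_pos_cexp.
  - apply poly_approx_cexp, poly_approx_mult; [apply poly_approx_const | easy].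
Qed.

Lemma poly_approx_zeta_partial (f : C -> C) (N : nat) :
  poly_approx K f -> poly_approx K (fun z => zeta_partial (f z) N).
Proof.
  intros f_approx. unfold zeta_partial. apply poly_approx_plus; [apply poly_approx_mult|].
  - apply poly_approx_minus; [easy | apply poly_approx_const].
  - apply (poly_approx_sum_n (fun i z => cpow_pos (INR (S i)) (- f z))). intros i.
    now apply poly_approx_cpow_pos, poly_approx_opp.
  - apply poly_approx_cpow_pos, poly_approx_minus; [apply poly_approx_const | easy].
Qed.

End PolynomialApproximation.

Lemma poly_approx_subset (K K' : C -> Prop) (f : C -> C) :
  (forall z, K z -> K' z) -> poly_approx K' f -> poly_approx K f.
Proof.
  intros K_sub f_approx eps eps_pos. destruct (f_approx eps eps_pos) as [p [p_poly p_close]].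
  exists p. auto.
Qed.

Definition half_disc (B c : R) (z : C) : Prop := Cmod z <= B /\ c <= Re z.

Lemma half_disc_bounded (B c : R) : bounded_set (half_disc B c).
Proof. exists B. now intros z [z_le _]. Qed.

(* By Runge's theorem this is holomorphy on the right half-plane. *)
Definition rhp_approx (f : C -> C) : Prop :=
  forall B c : R, 0 < c -> poly_approx (half_disc B c) f.

Lemma rhp_approx_comp (K : C -> Prop) (c : R) (f g : C -> C) : bounded_set K -> 0 < c ->
  rhp_approx f -> poly_approx K g -> (forall z, K z -> c <= Re (g z)) ->
  poly_approx K (fun z => f (g z)).
Proof.
  intros K_bounded c_pos f_approx g_approx Re_ge.
  destruct (poly_approx_bounded K K_bounded g g_approx) as [B [_ g_le]].
  apply (poly_approx_comp K K_bounded (half_disc B c)); [now apply f_approx | easy |].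
  split; auto.
Qed.

(* With [r] small the numbers [1 - r u] lie in a disc of radius less than 1,
  so [1 / u] is a geometric series. *)
Lemma Cmod_1_minus_scal_le (B c : R) (u : C) : 0 < c <= B -> half_disc B c u ->
  Cmod (1 - RtoC (c / B ^ 2) * u) <= 1 - c ^ 2 / (2 * B ^ 2).
Proof.
  intros c_in [u_le Re_ge].
  set (r := (c / B ^ 2)%R).
  assert (r_pos : 0 < r) by (apply Rdiv_lt_0_compat; nra).
  assert (r_B : (r * B ^ 2 = c)%R) by (unfold r; field; lra).
  replace (c ^ 2 / (2 * B ^ 2))%R with (r * c / 2)%R by (unfold r; field; lra).
  assert (rc_le1 : r * c <= 1).
  { apply Rmult_le_reg_r with (B ^ 2)%R; [nra|].
    replace (r * c * B ^ 2)%R with (c * (r * B ^ 2))%R by ring. rewrite r_B. nra. }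
  apply Rsqr_incr_0_var; [|lra]. rewrite !Rsqr_pow2, Cmod2_alt.
  replace (Re (1 - RtoC r * u)) with (1 - r * Re u)%R by (unfold Re; simpl; ring).
  replace (Im (1 - RtoC r * u)) with (- (r * Im u))%R by (unfold Im; simpl; ring).
  assert (u_sq_le : Re u ^ 2 + Im u ^ 2 <= B ^ 2).
  { rewrite <- Cmod2_alt. apply pow_incr. split; [apply Cmod_ge_0 | easy]. }
  apply Rle_trans with (1 - 2 * r * c + r * (r * B ^ 2))%R; [|rewrite r_B; nra].
  replace ((1 - r * Re u) ^ 2 + (- (r * Im u)) ^ 2)%R
    with (1 - 2 * r * Re u + r * (r * (Re u ^ 2 + Im u ^ 2)))%R by ring.
  assert (r * Re u >= r * c) by nra. assert (r * (Re u ^ 2 + Im u ^ 2) <= r * B ^ 2) by nra. nra.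
Qed.

Lemma rhp_approx_inv : rhp_approx Cinv.
Proof.
  intros B0 c c_pos. set (B := Rmax B0 c).
  pose proof (Rmax_l B0 c : B0 <= B). pose proof (Rmax_r B0 c : c <= B).
  assert (B2_pos : 0 < B ^ 2) by nra.
  apply (poly_approx_subset _ (half_disc B c)); [intros u [u_le Re_ge]; split; lra|].
  pose proof (half_disc_bounded B c) as K_bounded.
  set (r := (c / B ^ 2)%R). set (q := (1 - c ^ 2 / (2 * B ^ 2))%R).
  assert (r_pos : 0 < r) by (apply Rdiv_lt_0_compat; lra).
  assert (q_in : 0 <= q < 1).
  { assert (0 < c ^ 2 / (2 * B ^ 2)) by (apply Rdiv_lt_0_compat; nra).
    assert (c ^ 2 <= B ^ 2) by (apply pow_incr; lra).
    assert (c ^ 2 / (2 * B ^ 2) <= 1) by (apply Rle_div_l; lra). unfold q. lra. }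
  apply (poly_approx_limit_seq _ _ (fun n u => RtoC r * sum_n (fun i => (1 - RtoC r * u) ^ i) n)
    (fun n => / c * q ^ S n)%R).
  - intros n. apply (poly_approx_mult _ K_bounded); [apply poly_approx_const|].
    apply (poly_approx_sum_n _ (fun i u => (1 - RtoC r * u) ^ i)). intros i.
    apply (poly_approx_pow _ K_bounded), (poly_approx_minus _ K_bounded);
      [apply poly_approx_const|].
    apply (poly_approx_mult _ K_bounded); [apply poly_approx_const | apply poly_approx_id].
  - intros n u u_in. destruct (u_in) as [_ Re_ge].
    assert (u_ge : c <= Cmod u) by (eapply Rle_trans; [exact Re_ge | apply Re_le_Cmod]).
    pose proof (Cneq0_of_Cmod u c c_pos u_ge) as u_neq0.
    replace (/ u - RtoC r * sum_n (fun i => (1 - RtoC r * u) ^ i) n)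
      with (/ u * (1 - RtoC r * u) ^ S n).
    + rewrite Cmod_mult, Cmod_inv, Cmod_pow by easy. apply Rmult_le_compat.
      * apply Rlt_le, Rinv_0_lt_compat. lra.
      * apply pow_le, Cmod_ge_0.
      * now apply Rinv_le_contravar.
      * apply pow_incr. split; [apply Cmod_ge_0|]. now apply Cmod_1_minus_scal_le.
    + pose proof (sum_n_Cgeom (1 - RtoC r * u) n) as geom.
      replace ((1 - RtoC r * u) ^ S n)
        with (1 - RtoC r * u * sum_n (fun i => (1 - RtoC r * u) ^ i) n).
      * field. easy.
      * replace (RtoC r * u) with (1 - (1 - RtoC r * u)) at 1 by ring. rewrite geom. ring.
  - apply is_lim_seq_scal_0, (is_lim_seq_incr_1 (fun n => q ^ n)%R), is_lim_seq_geom.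
    rewrite Rabs_pos_eq; lra.
Qed.

Lemma rhp_approx_zeta_reg : rhp_approx zeta_reg.
Proof.
  intros B c c_pos. pose proof (half_disc_bounded B c) as K_bounded.
  set (M := (Rabs B * (Rabs B + 1) / c)%R).
  apply (poly_approx_limit_seq _ _ (fun N s => zeta_partial s N)
    (fun N => M * Rpower (INR (S N)) (- c))%R).
  - intros N. apply (poly_approx_zeta_partial _ K_bounded), poly_approx_id.
  - intros N s [s_le Re_ge]. eapply Rle_trans; [apply Cmod_zeta_reg_minus_partial_le; lra|].
    pose proof (Rle_abs B). pose proof (Cmod_ge_0 s). pose proof (Cmod_ge_0 (s - 1)).
    pose proof (Cmod_minus_le_plus s 1) as s1_le. rewrite Cmod_1 in s1_le.
    apply Rmult_le_compat; [|apply Rlt_le, exp_pos | |].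
    + apply Rdiv_le_0_compat; [nra | lra].
    + apply Rmult_le_compat; [nra | apply Rlt_le, Rinv_0_lt_compat; lra | |
        now apply Rinv_le_contravar].
      apply Rmult_le_compat; lra.
    + apply Rle_Rpower; [|lra]. rewrite S_INR. pose proof (pos_INR N). lra.
  - now apply is_lim_seq_scal_0, is_lim_seq_Rpower_opp.
Qed.

(** * Roots of unity and Taylor coefficients *)

(* Of order [S N], to match the [S N] terms of [sum_n _ N]. *)
Definition unity_root (N : nat) : C := cexp (0, 2 * PI / INR (S N))%R.

Lemma Cmod_unity_root_pow (N m : nat) : Cmod (unity_root N ^ m) = 1%R.
Proof. unfold unity_root. rewrite Cmod_pow, Cmod_cexp. simpl. rewrite exp_0. apply pow1. Qed.

Lemma unity_root_pow_order (N : nat) : unity_root N ^ S N = 1.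
Proof.
  assert (INR (S N) <> 0%R) by (apply not_0_INR; lia).
  unfold unity_root. rewrite cexp_pow.
  replace (RtoC (INR (S N)) * (0, 2 * PI / INR (S N))%R) with (0, 2 * PI)%R
    by (apply injective_projections; cbn -[INR]; field; easy).
  unfold cexp; simpl. rewrite exp_0, cos_2PI, sin_2PI. unfold RtoC. f_equal; ring.
Qed.

Lemma unity_root_pow_pow_order (N m : nat) : (unity_root N ^ m) ^ S N = 1.
Proof.
  rewrite <- Cpow_mult_r, Nat.mul_comm, Cpow_mult_r, unity_root_pow_order. apply Cpow_1_l.
Qed.

Lemma sum_n_pow_root_of_unity (x : C) (N : nat) : x ^ S N = 1 -> x <> 1 ->
  sum_n (fun m => x ^ m) N = 0 :> C.
Proof.
  intros x_root x_neq1. pose proof (sum_n_Cgeom x N) as geom.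
  rewrite x_root in geom. replace (1 - 1) with (RtoC 0) in geom by ring.
  destruct (Ceq_dec (sum_n (fun m => x ^ m) N) 0) as [sum_eq0|sum_neq0]; [easy|].
  exfalso. revert geom. apply Cmult_neq_0; [|easy]. now apply Cminus_eq_contra, not_eq_sym.
Qed.

Lemma unity_root_conj_neq1 (N a b : nat) : (a <= N)%nat -> (b <= N)%nat -> a <> b ->
  unity_root N ^ a * Cconj (unity_root N ^ b) <> 1.
Proof.
  intros a_le b_le a_neq_b root_eq.
  set (angle := (2 * PI / INR (S N))%R).
  assert (N_pos : 0 < INR (S N)) by (apply lt_0_INR; lia).
  assert (angle_pos : 0 < angle) by (apply Rdiv_lt_0_compat; [pose proof PI_RGT_0; lra | easy]).
  assert (angle_mul : (angle * INR (S N) = 2 * PI)%R) by (unfold angle; field; lra).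
  assert (cexp_eq : cexp (0, (INR a - INR b) * angle)%R = 1).
  { rewrite <- root_eq. unfold unity_root. rewrite !cexp_pow, Cconj_cexp, <- cexp_plus. f_equal.
    apply injective_projections; cbn -[INR]; fold angle; ring. }
  assert (Rabs (INR a - INR b) < INR (S N)).
  { apply le_INR in a_le, b_le. rewrite S_INR. pose proof (pos_INR a). pose proof (pos_INR b).
    apply Rabs_def1; lra. }
  assert (pair_eq0 : (0, (INR a - INR b) * angle)%R = RtoC 0).
  { apply cexp_eq_1; [easy|]. simpl. rewrite Rabs_mult, (Rabs_pos_eq angle) by lra. nra. }
  apply (f_equal Im) in pair_eq0. simpl in pair_eq0.
  apply a_neq_b, INR_eq. nra.
Qed.

Lemma unity_root_orthogonal (N a b : nat) : (a <= N)%nat -> (b <= N)%nat ->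
  sum_n (fun m => (unity_root N ^ m) ^ a * Cconj ((unity_root N ^ m) ^ b)) N
  = (if Nat.eq_dec a b then RtoC (INR (S N)) else 0) :> C.
Proof.
  intros a_le b_le.
  set (x := unity_root N ^ a * Cconj (unity_root N ^ b)).
  rewrite (sum_n_Cext _ (fun m => x ^ m)).
  2:{ intros m _. unfold x. rewrite Cpow_mult_l, <- Cpow_conj, <- !Cpow_mult_r.
      now rewrite (Nat.mul_comm m a), (Nat.mul_comm m b). }
  destruct (Nat.eq_dec a b) as [a_eq|a_neq].
  - assert (x_eq1 : x = 1).
    { unfold x. rewrite a_eq, <- Cmod2_conj, Cmod_unity_root_pow. f_equal. ring. }
    rewrite (sum_n_Cext _ (fun _ => RtoC 1)) by (intros; rewrite x_eq1; apply Cpow_1_l).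
    rewrite sum_n_Cconst. ring.
  - apply sum_n_pow_root_of_unity; [|now apply unity_root_conj_neq1].
    unfold x. rewrite Cpow_mult_l, <- Cpow_conj, !unity_root_pow_pow_order.
    apply injective_projections; simpl; ring.
Qed.

Lemma unity_root_coeff (q : nat -> C) (N j : nat) (r : R) : (j <= N)%nat ->
  sum_n (fun m => psum q (RtoC r * unity_root N ^ m) N * Cconj ((unity_root N ^ m) ^ j)) N
  = RtoC (INR (S N)) * (q j * RtoC r ^ j) :> C.
Proof.
  intros j_le.
  rewrite (sum_n_Cext _ (fun m => sum_n (fun i => q i * RtoC r ^ i
     * ((unity_root N ^ m) ^ i * Cconj ((unity_root N ^ m) ^ j))) N)).
  2:{ intros m _. unfold psum. rewrite <- sum_n_Cmult_r. apply sum_n_Cext. intros i _.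
      rewrite Cpow_mult_l. ring. }
  rewrite (sum_n_switch (G := C_AbelianMonoid)).
  rewrite (sum_n_Cext _ (fun i => q i * RtoC r ^ i * if Nat.eq_dec i j then RtoC (INR (S N))
    else 0)).
  2:{ intros i i_le. now rewrite sum_n_Cmult_l, unity_root_orthogonal. }
  rewrite (sum_n_single (G := C_AbelianMonoid) _ N j j_le).
  - destruct (Nat.eq_dec j j); [ring | easy].
  - intros i _ i_neq. destruct (Nat.eq_dec i j); [easy | apply Cmult_0_r].
Qed.

Lemma cauchy_estimate (q : nat -> C) (N j : nat) (r M : R) : 0 <= r -> (j <= N)%nat ->
  (forall z, Cmod z = r -> Cmod (psum q z N) <= M) -> Cmod (q j) * r ^ j <= M.
Proof.
  intros r_ge0 j_le psum_le.
  assert (N_pos : 0 < INR (S N)) by (apply lt_0_INR; lia).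
  apply Rmult_le_reg_l with (INR (S N)); [easy|].
  rewrite <- (Cmod_RtoC_pos r), <- Cmod_pow, <- Cmod_mult, <- (Cmod_RtoC_pos (INR (S N))),
    <- Cmod_mult,
    (Cmod_RtoC_pos (INR (S N))) by lra.
  rewrite <- (unity_root_coeff q N j r j_le), <- sum_n_const.
  apply Cmod_sum_n_m_le. intros m _.
  rewrite Cmod_mult, Cmod_conj, Cmod_pow, Cmod_unity_root_pow, pow1, Rmult_1_r.
  apply psum_le. rewrite Cmod_mult, Cmod_unity_root_pow, Cmod_RtoC_pos by easy. ring.
Qed.

Lemma parseval (q : nat -> C) (N : nat) :
  sum_n (fun m => Cmod (psum q (unity_root N ^ m) N) ^ 2)%R N
  = (INR (S N) * sum_n (fun j => Cmod (q j) ^ 2)%R N)%R.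
Proof.
  apply RtoC_inj. rewrite RtoC_mult, !RtoC_sum_n.
  rewrite (sum_n_Cext _ (fun m => sum_n (fun j => Cconj (q j) *
     (psum q (RtoC 1 * unity_root N ^ m) N * Cconj ((unity_root N ^ m) ^ j))) N)).
  - rewrite (sum_n_switch (G := C_AbelianMonoid)), <- sum_n_Cmult_l. apply sum_n_Cext.
    intros j j_le.
    rewrite sum_n_Cmult_l, unity_root_coeff, Cmod2_conj, Cpow_1_l by easy. ring.
  - intros m _. rewrite Cmult_1_l, Cmod2_conj. unfold psum at 2.
    rewrite Cconj_sum_n, <- sum_n_Cmult_l. apply sum_n_Cext. intros j _.
    rewrite Cmult_conj. ring.
Qed.

Definition Cdisc (r : R) (h : C) : Prop := Cmod h <= r.

Lemma Cdisc_bounded (r : R) : bounded_set (Cdisc r).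
Proof. exists r. exact (fun h h_in => h_in). Qed.

Definition approx_by (r eps : R) (f : C -> C) (q : nat -> C) : Prop :=
  eventually (fun n => forall h, Cmod h <= r -> Cmod (f h - psum q h n) <= eps).

Definition taylor_in_disc (f : C -> C) (c : nat -> C) : Prop :=
  forall r eps, 0 <= r < 1 -> 0 < eps -> approx_by r eps f c.

Lemma poly_approx_approx_by (f : C -> C) (r eps : R) : 0 < eps ->
  poly_approx (Cdisc r) f -> exists q, approx_by r eps f q.
Proof.
  intros eps_pos f_approx. destruct (f_approx eps eps_pos) as [p [[a [N p_psum]] p_close]].
  exists a, N. intros n n_ge h h_in. rewrite <- p_psum by easy. now apply p_close.
Qed.

Lemma approx_by_coeff_close (f : C -> C) (r eps eps' : R) (q q' : nat -> C) (j : nat) : 0 <= r ->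
  approx_by r eps f q -> approx_by r eps' f q' -> Cmod (q j - q' j) * r ^ j <= eps + eps'.
Proof.
  intros r_ge0 [N q_close] [N' q'_close].
  apply (cauchy_estimate (fun j => q j - q' j) (N + N' + j)); [easy | lia|]. intros z z_on.
  rewrite psum_minus. eapply Rle_trans; [apply (Cmod_minus_triangle _ (f z))|].
  rewrite (Cmod_minus_sym (psum q _ _)).
  apply Rplus_le_compat; [apply q_close | apply q'_close]; try lia; lra.
Qed.

Lemma poly_approx_center_le (f : C -> C) (r M : R) : 0 <= r ->
  poly_approx (Cdisc r) f -> (forall h, Cmod h = r -> Cmod (f h) <= M) -> Cmod (f 0) <= M.
Proof.
  intros r_ge0 f_approx f_le. apply le_epsilon. intros eps eps_pos.
  destruct (poly_approx_approx_by f r (eps / 2) ltac:(lra) f_approx) as [q [N q_close]].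
  specialize (q_close N (Nat.le_refl N)).
  assert (coeff_le : Cmod (q 0%nat) * r ^ 0 <= M + eps / 2).
  { apply (cauchy_estimate q N); [easy | lia|]. intros z z_on.
    eapply Rle_trans; [apply (Cmod_le_plus_minus _ (f z))|]. rewrite Cmod_minus_sym.
    apply Rplus_le_compat; [auto | apply q_close; lra]. }
  specialize (q_close 0 ltac:(rewrite Cmod_0; lra)). rewrite psum_at_0 in q_close.
  eapply Rle_trans; [apply (Cmod_le_plus_minus _ (q 0%nat))|]. simpl in coeff_le. lra.
Qed.

Lemma psum_tail_le (a : nat -> C) (z : C) (e : R) (n m : nat) : Cmod z < 1 -> (n <= m)%nat ->
  (forall j, (n < j)%nat -> Cmod (a j) <= e) ->
  Cmod (psum a z m - psum a z n) <= e * (Cmod z ^ S n / (1 - Cmod z)).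
Proof.
  intros z_lt1 n_le a_le. rewrite psum_diff by easy.
  eapply Rle_trans; [apply (Cmod_sum_n_m_le _ (fun j => e * Cmod z ^ j)%R)|].
  - intros j j_in. rewrite Cmod_mult, Cmod_pow.
    apply Rmult_le_compat_r; [apply pow_le, Cmod_ge_0 | apply a_le; lia].
  - rewrite sum_n_m_Rmult_l. apply Rmult_le_compat_l.
    + eapply Rle_trans; [apply Cmod_ge_0 | apply (a_le (S n)); lia].
    + apply sum_n_m_geom_le_lt1. split; [apply Cmod_ge_0 | easy].
Qed.

Lemma psum_scaled (a : nat -> C) (s z : C) (n : nat) :
  psum (fun j => a j * s ^ j) z n = psum a (s * z) n.
Proof. apply sum_n_Cext. intros j _. rewrite Cpow_mult_l. ring. Qed.

Lemma Cmod_psum_le (a : nat -> C) (h : C) (r rho M : R) (n : nat) : Cmod h <= r < rho ->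
  (forall j, Cmod (a j) * rho ^ j <= M) -> Cmod (psum a h n) <= M * (rho / (rho - r)).
Proof.
  intros h_in a_le. pose proof (Cmod_ge_0 h).
  set (z := RtoC (/ rho) * h).
  assert (z_mod : Cmod z = (Cmod h / rho)%R).
  { unfold z. rewrite Cmod_mult, Cmod_RtoC_pos by (apply Rlt_le, Rinv_0_lt_compat; lra).
    apply Rmult_comm. }
  assert (z_le : Cmod z <= r / rho)
    by (rewrite z_mod; apply Rmult_le_compat_r; [apply Rlt_le, Rinv_0_lt_compat|]; lra).
  assert (r_rho : r / rho < 1) by (apply Rlt_div_l; lra).
  assert (M_ge0 : 0 <= M).
  { eapply Rle_trans; [|apply (a_le 0%nat)].
    apply Rmult_le_pos; [apply Cmod_ge_0 | apply pow_le; lra]. }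
  replace h with (RtoC rho * z)
    by (unfold z; rewrite RtoC_inv by lra; field; apply RtoC_neq0; lra).
  rewrite <- psum_scaled.
  eapply Rle_trans; [apply (Cmod_sum_n_m_le _ (fun j => M * Cmod z ^ j)%R)|].
  - intros j _. rewrite !Cmod_mult, !Cmod_pow, Cmod_RtoC_pos by lra.
    apply Rmult_le_compat_r; [apply pow_le, Cmod_ge_0 | apply a_le].
  - rewrite sum_n_m_Rmult_l. apply Rmult_le_compat_l; [easy|].
    eapply Rle_trans; [apply sum_n_m_geom_le_lt1; split; [apply Cmod_ge_0 | lra]|].
    replace (rho / (rho - r))%R with (/ (1 - r / rho))%R by (field; lra).
    rewrite pow_O, Rdiv_1_l. apply Rinv_le_contravar; lra.
Qed.

Definition exhausting_approx (f : C -> C) (q : nat -> nat -> C) : Prop :=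
  forall k, approx_by (1 - / INR (S (S k))) (/ INR (S k)) f (q k).

Lemma exhausting_approx_exists (f : C -> C) :
  (forall r, 0 < r < 1 -> poly_approx (Cdisc r) f) -> exists q, exhausting_approx f q.
Proof.
  intros f_approx.
  apply (functional_choice (fun k q => approx_by (1 - / INR (S (S k))) (/ INR (S k)) f q)).
  intros k.
  apply poly_approx_approx_by; [apply Rinv_0_lt_compat, lt_0_INR; lia|]. apply f_approx.
  assert (two_le : 2 <= INR (S (S k))) by (apply (le_INR 2); lia).
  pose proof (Rinv_le_contravar 2 _ ltac:(lra) two_le).
  pose proof (Rinv_0_lt_compat (INR (S (S k))) ltac:(lra)). lra.
Qed.

Lemma exhausting_approx_coeff_close (f : C -> C) (q : nat -> nat -> C) (r : R) (j k l : nat) :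
  exhausting_approx f q -> 0 <= r <= 1 - / INR (S (S k)) -> (k <= l)%nat ->
  Cmod (q l j - q k j) * r ^ j <= 2 * / INR (S k).
Proof.
  intros q_approx r_in k_le.
  assert (inv_le : forall m, (0 < m)%nat -> / INR (m + (l - k)) <= / INR m).
  { intros m m_pos. apply Rinv_le_contravar; [now apply lt_0_INR | apply le_INR; lia]. }
  assert (smaller_disc : forall m eps, r <= 1 - / INR (S (S m)) ->
    approx_by (1 - / INR (S (S m))) eps f (q m) -> approx_by r eps f (q m)).
  { intros m eps r_le [N q_close]. exists N. intros n n_ge h h_in. apply q_close; [easy | lra]. }
  pose proof (inv_le (S k) ltac:(lia)) as inv_l.
  replace (S k + (l - k))%nat with (S l) in inv_l by lia.
  pose proof (inv_le (S (S k)) ltac:(lia)) as inv_l'. replace (S (S k) + (l - k))%nat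
    with (S (S l)) in inv_l' by lia.
  apply Rle_trans with (/ INR (S l) + / INR (S k))%R; [|lra].
  apply (approx_by_coeff_close f r); [easy | |]; apply smaller_disc; try apply q_approx; lra.
Qed.

Lemma exhausting_approx_coeff_limit (f : C -> C) (q : nat -> nat -> C) : exhausting_approx f q ->
  exists c : nat -> C, forall r j k, 0 <= r <= 1 - / INR (S (S k)) ->
    Cmod (c j - q k j) * r ^ j <= 2 * / INR (S k).
Proof.
  intros q_approx.
  assert (coeff_lim : forall j, exists l, is_Clim (fun k => q k j) l).
  { intros j. assert (half_pow : 0 < (1 / 2) ^ j) by (apply pow_lt; lra).
    apply (is_Clim_Cauchy _ (fun k => 2 / (1 / 2) ^ j * / INR (S k))%R);
      [|apply is_lim_seq_scal_0, is_lim_seq_inv_INR_S].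
    intros k l k_le. replace (2 / (1 / 2) ^ j * / INR (S k))%R
      with (2 * / INR (S k) / (1 / 2) ^ j)%R
      by (unfold Rdiv; ring).
    apply Rle_div_r; [easy|]. apply (exhausting_approx_coeff_close f); [easy | | easy].
    assert (two_le : 2 <= INR (S (S k))) by (apply (le_INR 2); lia).
    pose proof (Rinv_le_contravar 2 _ ltac:(lra) two_le). lra. }
  destruct (functional_choice _ coeff_lim) as [c c_lim]. exists c. intros r j k r_in.
  assert (r_pow : 0 <= r ^ j) by (apply pow_le; lra).
  rewrite <- (Cmod_RtoC_pos (r ^ j)), <- Cmod_mult by easy.
  replace ((c j - q k j) * RtoC (r ^ j)) with (RtoC (r ^ j) * c j - RtoC (r ^ j) * q k j) by ring.
  apply (is_Clim_dist_le (fun l => RtoC (r ^ j) * q l j)).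
  - exact (filterlim_comp _ _ _ _ _ _ _ _ (c_lim j)
      (filterlim_scal_r (V := C_NormedModule) (RtoC (r ^ j)) (c j))).
  - exists k. intros l k_le.
    replace (RtoC (r ^ j) * q l j - RtoC (r ^ j) * q k j) with ((q l j - q k j) * RtoC (r ^ j))
      by ring.
    rewrite Cmod_mult, Cmod_RtoC_pos by easy. now apply (exhausting_approx_coeff_close f).
Qed.

Theorem taylor_in_disc_exists (f : C -> C) :
  (forall r, 0 < r < 1 -> poly_approx (Cdisc r) f) -> exists c, taylor_in_disc f c.
Proof.
  intros f_approx. destruct (exhausting_approx_exists f f_approx) as [q q_approx].
  destruct (exhausting_approx_coeff_limit f q q_approx) as [c c_close].
  exists c. intros r eps r_in eps_pos.
  set (rho := ((1 + r) / 2)%R). assert (rho_in : r < rho < 1) by (unfold rho; lra).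
  set (M := (1 + 2 * (rho / (rho - r)))%R).
  destruct (filter_ex (F := eventually) _ (filter_and _ _
    (is_lim_seq_0_eventually_le _ eps (is_lim_seq_scal_0 M _ is_lim_seq_inv_INR_S) eps_pos)
    (is_lim_seq_0_eventually_le _ (1 - rho)
      (proj1 (is_lim_seq_incr_1 _ _) is_lim_seq_inv_INR_S) ltac:(lra))))
    as [k [error_le radius_le]].
  destruct (q_approx k) as [N q_close]. exists N. intros n n_ge h h_in.
  eapply Rle_trans; [|exact error_le]. unfold M. rewrite Rmult_plus_distr_r, Rmult_1_l.
  eapply Rle_trans; [apply (Cmod_minus_triangle _ (psum (q k) h n))|]. apply Rplus_le_compat.
  - apply q_close; [easy | lra].
  - rewrite Cmod_minus_sym, <- psum_minus.
    replace (2 * (rho / (rho - r)) * / INR (S k))%R with (2 * / INR (S k) * (rho / (rho - r)))%R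
      by ring.
    apply Cmod_psum_le; [lra|]. intros j. apply c_close. lra.
Qed.

Lemma taylor_in_disc_is_series (f : C -> C) (c : nat -> C) (h : C) :
  taylor_in_disc f c -> Cmod h < 1 -> is_Cseries (fun j => c j * h ^ j) (f h).
Proof.
  intros f_taylor h_in. apply is_Clim_spec. intros eps eps_pos.
  apply (filter_imp (F := eventually) _ _
    (fun n H => Rle_trans _ _ _ (Req_le _ _ (Cmod_minus_sym _ _)) (H h (Rle_refl _)))
    (f_taylor (Cmod h) eps (conj (Cmod_ge_0 h) h_in) eps_pos)).
Qed.

(** * The Fatou-Riesz theorem *)

Lemma psum_tail_le_gt1 (a : nat -> C) (z : C) (e : R) (n m : nat) : 1 < Cmod z -> (n <= m)%nat ->
  (forall j, (n < j)%nat -> Cmod (a j) <= e) ->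
  Cmod (psum a z m - psum a z n) <= e * (Cmod z ^ S m / (Cmod z - 1)).
Proof.
  intros z_gt1 n_le a_le. rewrite psum_diff by easy.
  eapply Rle_trans; [apply (Cmod_sum_n_m_le _ (fun j => e * Cmod z ^ j)%R)|].
  - intros j j_in. rewrite Cmod_mult, Cmod_pow.
    apply Rmult_le_compat_r; [apply pow_le, Cmod_ge_0 | apply a_le; lia].
  - rewrite sum_n_m_Rmult_l. apply Rmult_le_compat_l.
    + eapply Rle_trans; [apply Cmod_ge_0 | apply (a_le (S n)); lia].
    + apply sum_n_m_geom_le_gt1; [easy | lia].
Qed.

Lemma is_series_psum_dist_le (a : nat -> C) (z l : C) (e : R) (n : nat) : Cmod z < 1 ->
  is_Cseries (fun j => a j * z ^ j) l ->
  (forall j, (n < j)%nat -> Cmod (a j) <= e) ->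
  Cmod (l - psum a z n) <= e * (Cmod z ^ S n / (1 - Cmod z)).
Proof.
  intros z_lt1 a_series a_le. apply (is_Clim_dist_le (psum a z) l); [exact a_series|].
  exists n. intros m n_le. now apply psum_tail_le.
Qed.

Lemma bernoulli_quotient (x : R) (n : nat) : 1 < x -> (x - 1) / x ^ S n <= / INR (S n).
Proof.
  intros x_gt1. assert (n_pos : 0 < INR (S n)) by (apply lt_0_INR; lia).
  pose proof (poly (S n) (x - 1) ltac:(lra)) as bernoulli.
  replace (1 + (x - 1))%R with x in bernoulli by ring.
  apply Rle_div_l; [apply pow_lt; lra|]. rewrite Rmult_comm. apply Rle_div_r; [easy|]. lra.
Qed.

(* On the circle [|h| = d], [h^2 + d^2 (1 + h) = (|1 + h|^2 - 1) h]: the multiplier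
   vanishes exactly where the circle crosses the unit circle. *)
Lemma Cmod_riesz_multiplier (h : C) (d : R) : Cmod h = d ->
  Cmod (h ^ 2 + RtoC (d ^ 2) * (1 + h)) = (d * Rabs (Cmod (1 + h) ^ 2 - 1))%R.
Proof.
  intros <-.
  replace (h ^ 2 + RtoC (Cmod h ^ 2) * (1 + h)) with (RtoC (Cmod (1 + h) ^ 2 - 1) * h).
  - rewrite Cmod_mult, Cmod_R. ring.
  - rewrite !Cmod2_alt. destruct h as [x y]. apply injective_projections; simpl; ring.
Qed.

Section FatouRieszAtOne.

Variables (f : C -> C) (a : nat -> C) (d : R).
Hypothesis d_in : 0 < d <= 1 / 2.
Hypothesis f_series :
  forall z, Cmod z < 1 -> is_Cseries (fun j => a j * z ^ j) (f z).
Hypothesis f_approx : poly_approx (Cdisc d) (fun h => f (1 + h)).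

Definition riesz_error (n : nat) (h : C) : C :=
  (h ^ 2 + RtoC (d ^ 2) * (1 + h)) * ((f (1 + h) - psum a (1 + h) n) * (/ (1 + h)) ^ S n).

Lemma poly_approx_1_plus : poly_approx (Cdisc d) (fun h => 1 + h).
Proof. apply poly_approx_plus; [apply poly_approx_const | apply poly_approx_id]. Qed.

Lemma poly_approx_f_minus_psum (n : nat) :
  poly_approx (Cdisc d) (fun h => f (1 + h) - psum a (1 + h) n).
Proof.
  apply (poly_approx_minus _ (Cdisc_bounded d)); [easy|].
  apply (poly_approx_psum _ (Cdisc_bounded d)), poly_approx_1_plus.
Qed.

Lemma poly_approx_riesz_error (n : nat) : poly_approx (Cdisc d) (riesz_error n).
Proof.
  pose proof (Cdisc_bounded d) as disc_bd. unfold riesz_error.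
  apply (poly_approx_mult _ disc_bd); [|apply (poly_approx_mult _ disc_bd)].
  - apply poly_approx_plus; [apply (poly_approx_pow _ disc_bd), poly_approx_id|].
    apply (poly_approx_mult _ disc_bd); [apply poly_approx_const | apply poly_approx_1_plus].
  - apply poly_approx_f_minus_psum.
  - apply (poly_approx_pow _ disc_bd), (rhp_approx_comp _ (1 / 2) Cinv); [easy | lra | | |].
    + apply rhp_approx_inv.
    + apply poly_approx_1_plus.
    + intros h h_in. unfold Cdisc in h_in. rewrite Re_1_plus. pose proof (Re_ge_opp_Cmod h). lra.
Qed.

Lemma Cmod_riesz_error_eq (n : nat) (h : C) : Cmod h = d ->
  Cmod (riesz_error n h) = (d * Rabs (Cmod (1 + h) ^ 2 - 1)
    * (Cmod (f (1 + h) - psum a (1 + h) n) / Cmod (1 + h) ^ S n))%R.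
Proof.
  intros h_on. unfold riesz_error. rewrite !Cmod_mult, Cmod_riesz_multiplier by easy.
  assert (v_neq0 : 1 + h <> 0).
  { apply Cneq0_of_Re. rewrite Re_1_plus. pose proof (Re_ge_opp_Cmod h). lra. }
  now rewrite Cmod_pow, Cmod_inv, pow_inv.
Qed.

Lemma Cmod_riesz_error_inside_le (n : nat) (e : R) (h : C) : Cmod h = d -> Cmod (1 + h) < 1 ->
  (forall j, (n < j)%nat -> Cmod (a j) <= e) -> Cmod (riesz_error n h) <= 2 * d * e.
Proof.
  intros h_on v_lt1 a_le. rewrite Cmod_riesz_error_eq by easy.
  pose proof (is_series_psum_dist_le a _ _ e n v_lt1 (f_series _ v_lt1) a_le) as tail_le.
  pose proof (Cmod_le_plus_minus 1 (1 + h)) as v_ge. rewrite Cmod_1 in v_ge.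
  replace (1 - (1 + h)) with (- h) in v_ge by ring. rewrite Cmod_opp in v_ge.
  set (x := Cmod (1 + h)) in *.
  assert (x_pow : 0 < x ^ S n) by (apply pow_lt; lra).
  assert (e_ge0 : 0 <= e) by (eapply Rle_trans; [apply Cmod_ge_0 | apply (a_le (S n)); lia]).
  assert (sq_lt1 : x ^ 2 - 1 < 0) by nra. rewrite Rabs_left by easy.
  apply Rle_trans with (d * - (x ^ 2 - 1) * (e * (x ^ S n / (1 - x)) / x ^ S n))%R.
  - apply Rmult_le_compat_l; [apply Rmult_le_pos; lra|].
    apply Rmult_le_compat_r; [now apply Rlt_le, Rinv_0_lt_compat | easy].
  - replace (d * - (x ^ 2 - 1) * (e * (x ^ S n / (1 - x)) / x ^ S n))%R with (d * e * (1 + x))%R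
      by (field; lra).
    assert (0 <= d * e) by nra. nra.
Qed.

Lemma Cmod_riesz_error_outside_le (m n : nat) (e M : R) (h : C) :
  Cmod h = d -> 1 < Cmod (1 + h) -> (m <= n)%nat ->
  (forall j, (m < j)%nat -> Cmod (a j) <= e) ->
  Cmod (f (1 + h) - psum a (1 + h) m) <= M -> M * / INR (S n) <= e ->
  Cmod (riesz_error n h) <= 5 * d * e.
Proof.
  intros h_on v_gt1 m_le a_le f_close M_le. rewrite Cmod_riesz_error_eq by easy.
  pose proof (psum_tail_le_gt1 a _ e m n v_gt1 m_le a_le) as tail_le.
  pose proof (Cmod_minus_triangle (f (1 + h)) (psum a (1 + h) m) (psum a (1 + h) n)) as f_le.
  rewrite (Cmod_minus_sym (psum a _ m)) in f_le.
  pose proof (Cmod_triangle 1 h) as v_le. rewrite Cmod_1 in v_le.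
  set (x := Cmod (1 + h)) in *.
  assert (M_ge0 : 0 <= M) by (eapply Rle_trans; [apply Cmod_ge_0 | exact f_close]).
  assert (x_pow : 0 < x ^ S n) by (apply pow_lt; lra).
  assert (e_ge0 : 0 <= e) by (eapply Rle_trans; [apply Cmod_ge_0 | apply (a_le (S m)); lia]).
  assert (sq_gt1 : 0 < x ^ 2 - 1) by nra. rewrite Rabs_pos_eq by lra.
  apply Rle_trans with (d * (x ^ 2 - 1) * ((M + e * (x ^ S n / (x - 1))) / x ^ S n))%R.
  - apply Rmult_le_compat_l; [apply Rmult_le_pos; lra|].
    apply Rmult_le_compat_r; [now apply Rlt_le, Rinv_0_lt_compat | lra].
  - replace (d * (x ^ 2 - 1) * ((M + e * (x ^ S n / (x - 1))) / x ^ S n))%R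
      with (d * (x + 1) * (M * ((x - 1) / x ^ S n) + e))%R by (field; lra).
    pose proof (Rmult_le_compat_l M _ _ M_ge0 (bernoulli_quotient x n v_gt1)).
    apply Rle_trans with (d * (x + 1) * (e + e))%R; [apply Rmult_le_compat_l; nra|].
    assert (0 <= d * e) by nra. nra.
Qed.

Lemma fatou_riesz_at_1 : is_Clim a 0 -> is_Cseries (fun j => a j * 1 ^ j) (f 1).
Proof.
  intros a_lim. apply is_Clim_spec. intros eps eps_pos.
  change (eventually (fun n => Cmod (psum a 1 n - f 1) <= eps)).
  set (e := (eps * d / 5)%R). assert (e_pos : 0 < e) by (unfold e; nra).
  destruct (proj1 (is_Clim_spec a 0) a_lim e e_pos) as [m a_small].
  assert (a_le : forall j, (m <= j)%nat -> Cmod (a j) <= e).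
  { intros j m_le. replace (a j) with (a j - 0) by ring. now apply a_small. }
  destruct (poly_approx_bounded _ (Cdisc_bounded d) _ (poly_approx_f_minus_psum m))
    as [M [M_ge0 f_close]].
  destruct (is_lim_seq_0_eventually_le _ e (is_lim_seq_scal_0 M _ is_lim_seq_inv_INR_S) e_pos)
    as [N M_small].
  exists (m + N)%nat. intros n n_ge.
  assert (center_le : Cmod (riesz_error n 0) <= 5 * d * e).
  { apply (poly_approx_center_le _ d); [lra | apply poly_approx_riesz_error|]. intros h h_on.
    destruct (Rtotal_order (Cmod (1 + h)) 1) as [v_lt1|[v_eq1|v_gt1]].
    - apply Rle_trans with (2 * d * e)%R; [|nra].
      apply Cmod_riesz_error_inside_le; [easy | easy |]. intros j j_gt. apply a_le. lia.
    - rewrite Cmod_riesz_error_eq, v_eq1 by easy.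
      replace (1 ^ 2 - 1)%R with 0%R by ring. rewrite Rabs_R0. nra.
    - apply (Cmod_riesz_error_outside_le m n e M); [easy | easy | lia | | |].
      + intros j j_gt. apply a_le. lia.
      + apply f_close. unfold Cdisc. lra.
      + apply M_small. lia. }
  assert (centerE : riesz_error n 0 = RtoC (d ^ 2) * (f 1 - psum a 1 n)).
  { unfold riesz_error. rewrite Cplus_0_r.
    replace (/ 1) with (RtoC 1) by (field; apply C1_nz). rewrite Cpow_1_l. ring. }
  rewrite centerE, Cmod_mult, Cmod_RtoC_pos, Cmod_minus_sym in center_le by nra.
  apply Rmult_le_reg_l with (d ^ 2)%R; [nra|].
  eapply Rle_trans; [exact center_le|]. apply Req_le. unfold e. field.
Qed.

End FatouRieszAtOne.

Theorem fatou_riesz (f : C -> C) (a : nat -> C) (d : R) (w : C) : 0 < d -> Cmod w = 1%R ->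
  (forall z, Cmod z < 1 -> is_Cseries (fun j => a j * z ^ j) (f z)) ->
  poly_approx (Cdisc d) (fun h => f (w * (1 + h))) -> is_Clim a 0 ->
  is_Cseries (fun j => a j * w ^ j) (f w).
Proof.
  intros d_pos w_on f_series f_approx a_lim.
  replace (f w) with (f (w * 1)) by now rewrite Cmult_1_r.
  apply (is_series_ext (fun j => a j * w ^ j * 1 ^ j)).
  { intros j. rewrite Cpow_1_l. apply Cmult_1_r. }
  apply (fatou_riesz_at_1 (fun z => f (w * z)) (fun j => a j * w ^ j) (Rmin d (1 / 2))).
  - split; [apply Rmin_pos; lra | apply Rmin_r].
  - intros z z_in. apply (is_series_ext (fun j => a j * (w * z) ^ j)).
    + intros j. rewrite Cpow_mult_l. apply Cmult_assoc.
    + apply f_series. rewrite Cmod_mult, w_on. lra.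
  - apply (poly_approx_subset _ (Cdisc d)); [|easy].
    intros h h_in. eapply Rle_trans; [exact h_in | apply Rmin_l].
  - apply is_Clim_spec. intros eps eps_pos.
    apply (filter_imp (fun n => Cmod (a n - 0) <= eps)); [|now apply (proj1 (is_Clim_spec a 0))].
    intros n. replace (a n * w ^ n - 0) with ((a n - 0) * w ^ n) by ring.
    now rewrite Cmod_mult, Cmod_pow, w_on, pow1, Rmult_1_r.
Qed.

(** * Expansions at the origin *)

(* The origin is excluded because [Gk] has a junk value at [s = 1]. *)
Definition near_0 (P : C -> Prop) : Prop := locally' (RtoC 0) P.

Lemma near_0_spec (P : C -> Prop) :
  near_0 P <-> exists d : R, 0 < d /\ forall w, 0 < Cmod w < d -> P w.
Proof.
  split.
  - intros P_near. destruct (locally_norm_le_locally (V := C_NormedModule) (RtoC 0) _ P_near)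
      as [d P_ball].
    exists d. split; [apply cond_pos|]. intros w w_in. apply P_ball; [|now apply Cmod_gt_0].
    change (Cmod (w - 0) < d). replace (w - 0) with w by ring. easy.
  - intros [d [d_pos P_disc]]. apply (locally_le_locally_norm (V := C_NormedModule) (RtoC 0)).
    exists (mkposreal d d_pos). intros w w_near w_neq0. apply P_disc.
    split; [now apply Cmod_gt_0|].
    replace w with (w - 0) by ring. exact w_near.
Qed.

Lemma near_0_and (P Q : C -> Prop) : near_0 P -> near_0 Q -> near_0 (fun w => P w /\ Q w).
Proof. apply filter_and. Qed.

Lemma near_0_imp (P Q : C -> Prop) : (forall w, P w -> Q w) -> near_0 P -> near_0 Q.
Proof. apply filter_imp. Qed.

Lemma near_0_forall (P : C -> Prop) : (forall w, P w) -> near_0 P.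
Proof. apply filter_forall. Qed.

Lemma near_0_Cmod_lt (d : R) : 0 < d -> near_0 (fun w => 0 < Cmod w < d).
Proof. intros d_pos. apply near_0_spec. now exists d. Qed.

Lemma near_0_1_plus : near_0 (fun w => 1 / 2 <= Cmod (1 + w)).
Proof.
  apply (near_0_imp (fun w => 0 < Cmod w < 1 / 2)); [|apply near_0_Cmod_lt; lra]. intros w w_in.
  pose proof (Re_ge_opp_Cmod w). pose proof (Re_le_Cmod (1 + w)) as v_ge.
  rewrite Re_1_plus in v_ge. lra.
Qed.

Definition bigO_0 (n : nat) (g : C -> C) : Prop :=
  exists M : R, near_0 (fun w => Cmod (g w) <= M * Cmod w ^ n).

Lemma bigO_0_ext (n : nat) (f g : C -> C) :
  near_0 (fun w => f w = g w) -> bigO_0 n f -> bigO_0 n g.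
Proof.
  intros f_eq [M f_le]. exists M. apply near_0_imp with (2 := near_0_and _ _ f_eq f_le).
  intros w [f_w f_le_w]. now rewrite <- f_w.
Qed.

Lemma bigO_0_plus (n : nat) (f g : C -> C) :
  bigO_0 n f -> bigO_0 n g -> bigO_0 n (fun w => f w + g w).
Proof.
  intros [M f_le] [M' g_le]. exists (M + M')%R.
  apply near_0_imp with (2 := near_0_and _ _ f_le g_le). intros w [f_w g_w].
  eapply Rle_trans; [apply Cmod_triangle | lra].
Qed.

Lemma bigO_0_mult (n m : nat) (f g : C -> C) :
  bigO_0 n f -> bigO_0 m g -> bigO_0 (n + m) (fun w => f w * g w).
Proof.
  intros [M f_le] [M' g_le]. exists (M * M')%R.
  apply near_0_imp with (2 := near_0_and _ _ f_le g_le). intros w [f_w g_w].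
  rewrite Cmod_mult, pow_add.
  replace (M * M' * (Cmod w ^ n * Cmod w ^ m))%R with (M * Cmod w ^ n * (M' * Cmod w ^ m))%R
    by ring.
  apply Rmult_le_compat; auto using Cmod_ge_0.
Qed.

Lemma bigO_0_const (c : C) : bigO_0 0 (fun _ => c).
Proof.
  exists (Cmod c). apply near_0_forall. intros w. simpl. lra.
Qed.

Lemma bigO_0_pow (n : nat) : bigO_0 n (fun w => w ^ n).
Proof.
  exists 1%R. apply near_0_forall. intros w. rewrite Cmod_pow. lra.
Qed.

Lemma bigO_0_of_S (n : nat) (g : C -> C) : bigO_0 (S n) g -> bigO_0 n g.
Proof.
  intros [M g_le]. exists (Rabs M).
  apply near_0_imp with (2 := near_0_and _ _ g_le (near_0_Cmod_lt 1 Rlt_0_1)).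
  intros w [g_w w_in].
  assert (w_pow : 0 <= Cmod w ^ n) by (apply pow_le, Cmod_ge_0).
  eapply Rle_trans; [exact g_w|]. apply Rle_trans with (Rabs M * (Cmod w * Cmod w ^ n))%R.
  - apply Rmult_le_compat_r; [apply Rmult_le_pos; [apply Cmod_ge_0 | easy] | apply Rle_abs].
  - apply Rmult_le_compat_l; [apply Rabs_pos | nra].
Qed.

Lemma bigO_0_inv_1_plus : bigO_0 0 (fun w => / (1 + w)).
Proof.
  exists 2%R. apply near_0_imp with (2 := near_0_1_plus). intros w v_ge.
  rewrite Cmod_inv by (apply (Cneq0_of_Cmod _ (1 / 2)); lra). simpl.
  rewrite Rmult_1_r, <- (Rinv_inv 2).
  apply Rinv_le_contravar; lra.
Qed.

Lemma bigO_0_comp (n : nat) (g phi : C -> C) (L : R) :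
  near_0 (fun w => 0 < Cmod (phi w) <= L * Cmod w) -> bigO_0 n g -> bigO_0 n (fun w => g (phi w)).
Proof.
  intros phi_near [M g_le]. apply near_0_spec in g_le. destruct g_le as [d [d_pos g_le]].
  destruct (small_factor (2 * Rabs L) d d_pos) as [d' [d'_pos d'_small]].
  exists (Rabs M * Rabs L ^ n)%R.
  apply near_0_imp with (2 := near_0_and _ _ phi_near (near_0_Cmod_lt d' d'_pos)).
  intros w [phi_w w_in].
  pose proof (Rle_abs L). pose proof (Rabs_pos L).
  assert (phi_le : Cmod (phi w) <= Rabs L * Cmod w) by nra.
  eapply Rle_trans; [apply g_le; nra|].
  rewrite Rmult_assoc, <- Rpow_mult_distr.
  apply Rle_trans with (Rabs M * Cmod (phi w) ^ n)%R.
  - apply Rmult_le_compat_r; [apply pow_le, Cmod_ge_0 | apply Rle_abs].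
  - apply Rmult_le_compat_l; [apply Rabs_pos|]. apply pow_incr. split; [apply Cmod_ge_0 | easy].
Qed.

Definition expands_to (N : nat) (f : C -> C) (a : nat -> C) : Prop :=
  bigO_0 (S N) (fun w => f w - psum a w N).

Lemma expands_to_ext (N : nat) (f g : C -> C) (a b : nat -> C) :
  near_0 (fun w => f w = g w) -> (forall i, (i <= N)%nat -> a i = b i) ->
  expands_to N f a -> expands_to N g b.
Proof.
  intros f_eq a_eq f_expands.
  apply (bigO_0_ext _ (fun w => f w - psum a w N)); [|exact f_expands].
  apply near_0_imp with (2 := f_eq). intros w f_w. now rewrite f_w, (psum_ext a b) by easy.
Qed.

Lemma expands_to_plus (N : nat) (f g : C -> C) (a b : nat -> C) :
  expands_to N f a -> expands_to N g b -> expands_to N (fun w => f w + g w) (fun i => a i + b i).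
Proof.
  intros f_expands g_expands.
  apply (bigO_0_ext _ (fun w => (f w - psum a w N) + (g w - psum b w N))).
  - apply near_0_forall. intros w. rewrite psum_plus. ring.
  - now apply bigO_0_plus.
Qed.

Lemma expands_to_scal (N : nat) (c : C) (f : C -> C) (a : nat -> C) :
  expands_to N f a -> expands_to N (fun w => c * f w) (fun i => c * a i).
Proof.
  intros f_expands. apply (bigO_0_ext _ (fun w => c * (f w - psum a w N))).
  - apply near_0_forall. intros w. rewrite psum_scal. ring.
  - exact (bigO_0_mult 0 _ _ _ (bigO_0_const c) f_expands).
Qed.

Lemma expands_to_sum_n (N n : nat) (f : nat -> C -> C) (a : nat -> nat -> C) :
  (forall j, expands_to N (f j) (a j)) ->
  expands_to N (fun w => sum_n (fun j => f j w) n) (fun i => sum_n (fun j => a j i) n).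
Proof.
  intros f_expands. induction n as [|n IH].
  - apply (expands_to_ext _ (f 0%nat) _ (a 0%nat)); [apply near_0_forall | |easy];
      intros; symmetry; apply (sum_O (G := C_AbelianMonoid)).
  - apply (expands_to_ext _ (fun w => sum_n (fun j => f j w) n + f (S n) w) _
      (fun i => sum_n (fun j => a j i) n + a (S n) i));
      [apply near_0_forall | |now apply expands_to_plus];
      intros; symmetry; apply sum_Sn_C.
Qed.

Lemma psum_shift_trunc (a : nat -> C) (w : C) (N : nat) :
  psum (shift_coeffs a) w N = w * psum a w N - a N * w ^ S N.
Proof. rewrite <- psum_shift, psum_S. simpl. ring. Qed.

Lemma expands_to_mult_id (N : nat) (f : C -> C) (a : nat -> C) :
  expands_to N f a -> expands_to N (fun w => w * f w) (shift_coeffs a).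
Proof.
  intros f_expands. apply (bigO_0_ext _ (fun w => w ^ 1 * (f w - psum a w N) + a N * w ^ S N)).
  - apply near_0_forall. intros w. rewrite psum_shift_trunc. ring.
  - apply bigO_0_plus.
    + apply bigO_0_of_S, (bigO_0_mult 1 (S N)); [apply bigO_0_pow | exact f_expands].
    + apply (bigO_0_mult 0 (S N)); [apply bigO_0_const | apply bigO_0_pow].
Qed.

Lemma expands_to_mult_pow (N j : nat) (f : C -> C) (a : nat -> C) :
  expands_to N f a -> expands_to N (fun w => w ^ j * f w) (Nat.iter j shift_coeffs a).
Proof.
  intros f_expands. induction j as [|j IH].
  - apply (expands_to_ext _ f _ a); [|easy | easy]. apply near_0_forall. intros w. simpl. ring.
  - apply (expands_to_ext _ (fun w => w * (w ^ j * f w)) _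
      (shift_coeffs (Nat.iter j shift_coeffs a))).
    + apply near_0_forall. intros w. rewrite Cpow_S. ring.
    + easy.
    + now apply expands_to_mult_id.
Qed.

Lemma iter_shift (j m : nat) (a : nat -> C) :
  Nat.iter j shift_coeffs a m = if (m <? j)%nat then 0 else a (m - j)%nat.
Proof.
  revert m. induction j as [|j IH]; intros m; simpl; [now rewrite Nat.sub_0_r|].
  destruct m as [|m]; [easy|]. simpl. now rewrite IH.
Qed.

Lemma expands_to_mult_1_plus (N : nat) (f : C -> C) (a b : nat -> C) :
  (forall i, b i = a i + shift_coeffs a i) ->
  expands_to N f a -> expands_to N (fun w => (1 + w) * f w) b.
Proof.
  intros b_eq f_expands.
  apply (expands_to_ext _ (fun w => f w + w * f w) _ (fun i => a i + shift_coeffs a i));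
    [| easy |].
  - apply near_0_forall. intros w. ring.
  - now apply expands_to_plus; [|apply expands_to_mult_id].
Qed.

Lemma expands_to_div_1_plus (N : nat) (f : C -> C) (a b : nat -> C) :
  (forall i, a i = b i + shift_coeffs b i) ->
  expands_to N f a -> expands_to N (fun w => / (1 + w) * f w) b.
Proof.
  intros a_eq f_expands.
  apply (bigO_0_ext _ (fun w => / (1 + w) * ((f w - psum a w N) + - b N * w ^ S N))).
  - apply near_0_imp with (2 := near_0_1_plus). intros w v_ge.
    rewrite (psum_ext a (fun i => b i + shift_coeffs b i)), psum_plus, psum_shift_trunc by easy.
    field. now apply (Cneq0_of_Cmod _ (1 / 2)); [lra|].
  - apply (bigO_0_mult 0 (S N)); [apply bigO_0_inv_1_plus|].
    apply bigO_0_plus; [exact f_expands|].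
    apply (bigO_0_mult 0 (S N)); [apply bigO_0_const | apply bigO_0_pow].
Qed.

Lemma bigO_0_monomial_eq0 (c : C) (n : nat) : bigO_0 (S n) (fun w => c * w ^ n) -> c = 0.
Proof.
  intros [M c_le]. apply near_0_spec in c_le. destruct c_le as [d [d_pos c_le]].
  apply Cmod_eq_0, Rle_antisym; [|apply Cmod_ge_0]. apply le_epsilon. intros eps eps_pos.
  destruct (small_factor M eps eps_pos) as [d' [d'_pos d'_small]].
  set (x := Rmin d' (d / 2)). assert (x_pos : 0 < x) by (apply Rmin_pos; lra).
  pose proof (Rmin_l d' (d / 2) : x <= d'). pose proof (Rmin_r d' (d / 2) : x <= d / 2).
  specialize (c_le (RtoC x)). rewrite Cmod_mult, Cmod_pow, Cmod_RtoC_pos in c_le by lra.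
  assert (x_pow : 0 < x ^ n) by now apply pow_lt.
  assert (c_le_Mx : Cmod c <= M * x).
  { apply Rmult_le_reg_r with (x ^ n)%R; [easy|].
    eapply Rle_trans; [apply c_le; lra | apply Req_le; simpl; ring]. }
  destruct (Rle_dec 0 M); nra.
Qed.

Lemma expands_to_unique (f : C -> C) (a b : nat -> C) :
  (forall N, expands_to N f a) -> (forall N, expands_to N f b) -> forall n, a n = b n.
Proof.
  intros f_a f_b n. induction n as [n IH] using (well_founded_induction lt_wf).
  apply Ceq_minus, (bigO_0_monomial_eq0 _ n).
  apply (bigO_0_ext _ (fun w => (f w - psum b w n) + RtoC (-1) * (f w - psum a w n))).
  - apply near_0_forall. intros w.
    replace (f w - psum b w n + RtoC (-1) * (f w - psum a w n)) with (psum a w n - psum b w n)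
      by ring.
    rewrite <- psum_minus.
    apply (sum_n_single (G := C_AbelianMonoid) (fun j => (a j - b j) * w ^ j) n n); [easy|].
    intros i i_le i_neq. rewrite (IH i) by lia. replace (b i - b i) with (RtoC 0) by ring.
    apply Cmult_0_l.
  - apply bigO_0_plus; [apply f_b|]. exact (bigO_0_mult 0 _ _ _ (bigO_0_const _) (f_a n)).
Qed.

Lemma is_Cseries_terms_bounded (a : nat -> C) (l : C) :
  is_Cseries a l -> exists B, forall n, Cmod (a n) <= B.
Proof.
  intros a_series. destruct (filterlim_bounded (V := C_NormedModule) _ (ex_intro _ l a_series))
    as [M sum_le].
  exists (2 * M)%R. intros [|n].
  - pose proof (sum_le 0%nat) as sum_0. rewrite sum_O in sum_0.
    change (Cmod (a 0%nat) <= M) in sum_0.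
    pose proof (Cmod_ge_0 (a 0%nat)). lra.
  - replace (a (S n)) with (sum_n a (S n) - sum_n a n) by (rewrite sum_Sn_C; ring).
    eapply Rle_trans; [apply Cmod_minus_le_plus|].
    pose proof (sum_le n : Cmod (sum_n a n) <= M).
    pose proof (sum_le (S n) : Cmod (sum_n a (S n)) <= M). lra.
Qed.

Lemma expands_to_of_series (f : C -> C) (a : nat -> C) (N : nat) :
  (forall h, 0 < Cmod h < 1 -> is_Cseries (fun j => a j * h ^ j) (f h)) ->
  expands_to N f a.
Proof.
  intros f_series.
  assert (half_mod : Cmod (RtoC (1 / 2)) = (1 / 2)%R) by (apply Cmod_RtoC_pos; lra).
  destruct (is_Cseries_terms_bounded _ _ (f_series (RtoC (1 / 2)) ltac:(lra))) as [B a_le].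
  assert (B_ge0 : 0 <= B) by (eapply Rle_trans; [apply Cmod_ge_0 | apply (a_le 0%nat)]).
  exists (B * (2 ^ S N * 2))%R. apply near_0_imp with (2 := near_0_Cmod_lt (1 / 4) ltac:(lra)).
  intros h h_in.
  set (z := RtoC 2 * h).
  assert (z_mod : Cmod z = (2 * Cmod h)%R) by (unfold z; rewrite Cmod_mult, Cmod_RtoC_pos; lra).
  assert (h_eq : h = RtoC (1 / 2) * z) by (unfold z; rewrite Cmult_assoc, <- RtoC_mult;
    replace (1 / 2 * 2)%R with 1%R by field; ring).
  rewrite h_eq at 2. rewrite <- psum_scaled.
  eapply Rle_trans; [apply (is_series_psum_dist_le _ z (f h) B N); [lra | |intros; apply a_le]|].
  - apply (is_series_ext (fun j => a j * h ^ j)); [|apply f_series; lra].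
    intros j. rewrite h_eq at 1. rewrite Cpow_mult_l. apply Cmult_assoc.
  - rewrite z_mod, Rmult_assoc, Rpow_mult_distr. apply Rmult_le_compat_l; [easy|].
    unfold Rdiv. replace (2 ^ S N * 2 * Cmod h ^ S N)%R with (2 ^ S N * Cmod h ^ S N * 2)%R
      by ring.
    apply Rmult_le_compat_l; [apply Rmult_le_pos; apply pow_le; lra|].
    rewrite <- (Rinv_inv 2). apply Rinv_le_contravar; lra.
Qed.

Fixpoint gbinom (x : R) (i : nat) : R :=
  match i with O => 1 | S i' => gbinom x i' * ((x - INR i') / INR (S i')) end.

Lemma gbinom_S (x : R) (i : nat) : gbinom x (S i) = (gbinom x i * ((x - INR i) / INR (S i)))%R.
Proof. reflexivity. Qed.

Lemma gbinom_absorption (x : R) (i : nat) :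
  gbinom (x + 1) (S i) = (gbinom x i * ((x + 1) / INR (S i)))%R.
Proof.
  induction i as [|i IH]; [simpl; field|].
  assert (INR (S i) <> 0%R) by (apply not_0_INR; lia).
  assert (INR (S (S i)) <> 0%R) by (apply not_0_INR; lia).
  rewrite gbinom_S, IH, gbinom_S.
  replace (x + 1 - INR (S i))%R with (x - INR i)%R by (rewrite S_INR; ring). field. easy.
Qed.

Lemma gbinom_pascal (x : R) (i : nat) :
  gbinom (x + 1) (S i) = (gbinom x (S i) + gbinom x i)%R.
Proof.
  rewrite gbinom_absorption, gbinom_S, S_INR. field. rewrite <- S_INR. apply not_0_INR. lia.
Qed.

Lemma gbinom_INR (n i : nat) : (i <= n)%nat -> gbinom (INR n) i = Binomial.C n i.
Proof.
  induction i as [|i IH]; intros i_le; [simpl; now rewrite C_n_0|].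
  rewrite pascal_step3, minus_INR, <- IH, gbinom_S by lia. ring.
Qed.

Lemma gbinom_INR_gt (n i : nat) : (n < i)%nat -> gbinom (INR n) i = 0%R.
Proof.
  intros i_gt. induction i_gt as [|i i_gt IH]; rewrite gbinom_S; [|rewrite IH; ring].
  unfold Rdiv. ring.
Qed.

Lemma gbinom_opp (p i : nat) : gbinom (- INR (S p)) i = ((-1) ^ i * Binomial.C (p + i) i)%R.
Proof.
  induction i as [|i IH]; [simpl; rewrite C_n_0; ring|].
  rewrite gbinom_S, IH, Nat.add_succ_r. unfold Binomial.C.
  replace (S (p + i) - S i)%nat with p by lia. replace (p + i - i)%nat with p by lia.
  rewrite !fact_simpl, !mult_INR, (S_INR (p + i)), plus_INR, (S_INR p), <- tech_pow_Rmult.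
  field. repeat split; try apply INR_fact_neq_0. apply not_0_INR. lia.
Qed.

Lemma expands_to_binomial_series (N k j : nat) :
  expands_to N (fun w => (1 + w) ^ k * (/ (1 + w)) ^ j)
    (fun i => RtoC (gbinom (INR k - INR j) i)).
Proof.
  assert (pascal_shift : forall x i, RtoC (gbinom (x + 1) i)
    = RtoC (gbinom x i) + shift_coeffs (fun i => RtoC (gbinom x i)) i).
  { intros x [|i]; [simpl; ring|]. rewrite gbinom_pascal, RtoC_plus. reflexivity. }
  induction k as [|k IHk]; [induction j as [|j IHj]|].
  - apply (bigO_0_ext _ (fun w => 0 * w ^ S N)); [apply near_0_forall; intros w|].
    + unfold psum. rewrite (sum_n_single (G := C_AbelianMonoid) _ N 0); [simpl; ring | lia|].
      intros [|i] _ i_neq; [easy|]. rewrite Rminus_0_r, (gbinom_INR_gt 0 (S i)) by lia.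
      apply Cmult_0_l.
    + apply (bigO_0_mult 0 (S N)); [apply bigO_0_const | apply bigO_0_pow].
  - apply (expands_to_ext _ (fun w => / (1 + w) * ((1 + w) ^ 0 * (/ (1 + w)) ^ j)) _
      (fun i => RtoC (gbinom (INR 0 - INR (S j)) i))); [|easy|].
    + apply near_0_forall. intros w. rewrite (Cpow_S _ j). ring.
    + apply (expands_to_div_1_plus _ _ _ _ (fun i => pascal_shift _ i)).
      replace (INR 0 - INR (S j) + 1)%R with (INR 0 - INR j)%R by (rewrite (S_INR j); ring).
      exact IHj.
  - apply (expands_to_ext _ (fun w => (1 + w) * ((1 + w) ^ k * (/ (1 + w)) ^ j)) _
      (fun i => RtoC (gbinom (INR (S k) - INR j) i))); [|easy|].
    + apply near_0_forall. intros w. rewrite (Cpow_S _ k). ring.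
    + apply (expands_to_mult_1_plus _ _ (fun i => RtoC (gbinom (INR k - INR j) i))); [|exact IHk].
      replace (INR (S k) - INR j)%R with (INR k - INR j + 1)%R by (rewrite S_INR; ring).
      apply pascal_shift.
Qed.

(** * The zeta function on the unit disc *)

(* [s = 1 / (1 + w)] maps the unit disc onto the half-plane [Re s > 1/2],
  and [zeta_disc w] is [w * zeta s]. *)
Definition zeta_disc (w : C) : C := - ((1 + w) * zeta_reg (/ (1 + w))).

Lemma poly_approx_zeta_disc (K : C -> Prop) (c : R) (f : C -> C) : bounded_set K -> 0 < c ->
  poly_approx K f -> (forall z, K z -> c <= Re (1 + f z)) ->
    poly_approx K (fun z => zeta_disc (f z)).
Proof.
  intros K_bounded c_pos f_approx Re_ge.
  assert (v_approx : poly_approx K (fun z => 1 + f z))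
    by (apply poly_approx_plus; [apply poly_approx_const | easy]).
  destruct (poly_approx_bounded K K_bounded _ v_approx) as [B [B_ge0 v_le]].
  apply (poly_approx_opp K K_bounded), (poly_approx_mult K K_bounded); [easy|].
  apply (rhp_approx_comp K (c / (B + 1) ^ 2)); [easy | apply Rdiv_lt_0_compat; nra | | |].
  - apply rhp_approx_zeta_reg.
  - now apply (rhp_approx_comp K c Cinv); [| |apply rhp_approx_inv| |].
  - intros z z_in. specialize (Re_ge z z_in). specialize (v_le z z_in).
    pose proof (Re_le_Cmod (1 + f z)). rewrite Re_inv.
    apply Rmult_le_compat; [lra | apply Rlt_le, Rinv_0_lt_compat; nra | easy |].
    apply Rinv_le_contravar; [nra | apply pow_incr; lra].
Qed.

Lemma poly_approx_zeta_disc_pow (K : C -> Prop) (c : R) (f : C -> C) (k : nat) :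
  bounded_set K -> 0 < c ->
  poly_approx K f -> (forall z, K z -> c <= Re (1 + f z)) ->
  poly_approx K (fun z => zeta_disc (f z) ^ k).
Proof. intros. now apply poly_approx_pow, (poly_approx_zeta_disc K c). Qed.

Lemma taylor_coef_exists (k : nat) : exists c, is_taylor_coef k c.
Proof.
  destruct (taylor_in_disc_exists (fun h => zeta_reg (1 + h) ^ k)) as [c c_taylor].
  - intros r r_in. pose proof (Cdisc_bounded r) as disc_bd.
    apply (poly_approx_pow _ disc_bd), (rhp_approx_comp _ (1 - r) zeta_reg); [easy | lra | | |].
    + apply rhp_approx_zeta_reg.
    + apply poly_approx_plus; [apply poly_approx_const | apply poly_approx_id].
    + intros h h_in. unfold Cdisc in h_in. rewrite Re_1_plus. pose proof (Re_ge_opp_Cmod h). lra.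
  - exists c. intros s s_in. unfold Gk. rewrite <- zeta_reg_disc by easy.
    pose proof (taylor_in_disc_is_series _ c (s - 1) c_taylor ltac:(lra)) as c_series.
    cbv beta in c_series.
    replace (1 + (s - 1)) with s in c_series by ring. exact c_series.
Qed.

Lemma lam_over_fact_series (k : nat) (h : C) : 0 < Cmod h < 1 ->
  is_Cseries (fun j => lam_over_fact k j * h ^ j) (zeta_reg (1 + h) ^ k).
Proof.
  intros h_in. assert (h_eq : 1 + h - 1 = h) by ring. rewrite <- h_eq in h_in.
  pose proof (epsilon_spec (inhabits (fun _ => RtoC 0)) (is_taylor_coef k) (taylor_coef_exists k)
    (1 + h) h_in)
    as series. fold (lam_over_fact k) in series. unfold Gk in series.
  rewrite <- zeta_reg_disc, h_eq in series by easy. exact series.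
Qed.

Lemma lam_div_fact (j k : nat) : lam j k / RtoC (INR (fact j)) = lam_over_fact k j.
Proof. unfold lam. field. apply RtoC_neq0, INR_fact_neq_0. Qed.

Definition zeta_disc_coeff (k m : nat) : C := ell (Z.of_nat m - Z.of_nat k) k.

(* [zeta_disc w ^ k] is the sum over [j] of [(-1)^(k+j) lam_over_fact k j w^j (1 + w)^(k-j)]. *)
Definition zeta_disc_term_coeff (k j : nat) : nat -> C :=
  Nat.iter j shift_coeffs (fun i => RtoC (gbinom (INR k - INR j) i)).

Lemma zeta_disc_term_coeff_gt (k j m : nat) : (m < j)%nat -> zeta_disc_term_coeff k j m = 0.
Proof.
  intros m_lt. unfold zeta_disc_term_coeff. rewrite iter_shift.
  now destruct (Nat.ltb_spec m j); [|lia].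
Qed.

Lemma zeta_disc_term_coeff_le (k j m : nat) : (j <= m)%nat ->
  zeta_disc_term_coeff k j m = RtoC (gbinom (INR k - INR j) (m - j)).
Proof.
  intros j_le. unfold zeta_disc_term_coeff. rewrite iter_shift.
  now destruct (Nat.ltb_spec m j); [lia|].
Qed.

Lemma ell_nonpos_eq (k m : nat) : (m <= k)%nat -> zeta_disc_coeff k m =
  sum_n (fun j => RtoC ((-1) ^ (k + j)) * lam_over_fact k j * zeta_disc_term_coeff k j m) m.
Proof.
  intros m_le. unfold zeta_disc_coeff, ell.
  destruct (Z.ltb_spec 0 (Z.of_nat m - Z.of_nat k)); [lia|].
  destruct (Z.leb_spec (- Z.of_nat k) (Z.of_nat m - Z.of_nat k)); [|lia].
  replace (Z.to_nat (- (Z.of_nat m - Z.of_nat k))) with (k - m)%nat by lia.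
  cbv zeta. replace (k - (k - m))%nat with m by lia.
  rewrite <- sum_n_Cmult_l. apply sum_n_Cext. intros j j_le.
  rewrite lam_div_fact, zeta_disc_term_coeff_le, <- minus_INR, gbinom_INR,
    (pascal_step1 (k - j) (m - j)) by lia.
  replace (k - j - (m - j))%nat with (k - m)%nat by lia. rewrite pow_add, RtoC_mult. ring.
Qed.

Lemma ell_pos_eq (k n : nat) : zeta_disc_coeff k (k + S n) =
  sum_n (fun j => RtoC ((-1) ^ (k + j)) * lam_over_fact k j * zeta_disc_term_coeff k j (k + S n))
    (k + S n).
Proof.
  unfold zeta_disc_coeff, ell.
  destruct (Z.ltb_spec 0 (Z.of_nat (k + S n) - Z.of_nat k)); [|lia].
  replace (Z.to_nat (Z.of_nat (k + S n) - Z.of_nat k)) with (S n) by lia.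
  cbv zeta. replace (S n - 1)%nat with n by lia.
  set (term := fun j => RtoC ((-1) ^ (k + j)) * lam_over_fact k j
    * zeta_disc_term_coeff k j (k + S n)).
  rewrite sum_n_split, (sum_n_zero term k), plus_zero_l.
  2:{ intros j j_le. unfold term. rewrite zeta_disc_term_coeff_le, <- minus_INR, gbinom_INR_gt
        by lia. apply Cmult_0_r. }
  rewrite <- sum_n_Cmult_l. apply sum_n_Cext. intros i i_le. unfold term.
  replace (S i + k)%nat with (S k + i)%nat by lia.
  rewrite lam_div_fact, zeta_disc_term_coeff_le by lia.
  replace (INR k - INR (S k + i))%R with (- INR (S i))%R by (rewrite plus_INR, !S_INR; ring).
  replace (k + S n - (S k + i))%nat with (n - i)%nat by lia.
  rewrite gbinom_opp. replace (i + (n - i))%nat with n by lia. rewrite <- pascal_step1 by lia.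
  replace ((-1) ^ S n)%R with ((-1) ^ (k + (S k + i)) * (-1) ^ (n - i))%R.
  - rewrite !RtoC_mult. ring.
  - rewrite <- pow_add. replace (k + (S k + i) + (n - i))%nat with (2 * k + S n)%nat by lia.
    rewrite pow_add, pow_1_even. ring.
Qed.

Lemma zeta_disc_coeff_eq (k m N : nat) : (m <= N)%nat -> zeta_disc_coeff k m =
  sum_n (fun j => RtoC ((-1) ^ (k + j)) * lam_over_fact k j * zeta_disc_term_coeff k j m) N.
Proof.
  intros m_le. rewrite (sum_n_truncate _ m N m_le).
  - destruct (Nat.le_gt_cases m k) as [m_le_k|m_gt_k]; [now apply ell_nonpos_eq|].
    replace m with (k + S (m - k - 1))%nat by lia. apply ell_pos_eq.
  - intros j j_gt. rewrite zeta_disc_term_coeff_gt by easy. apply Cmult_0_r.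
Qed.

Lemma near_0_inv_1_plus_minus_1 : near_0 (fun w => 0 < Cmod (/ (1 + w) - 1) <= 2 * Cmod w).
Proof.
  apply near_0_imp with (2 := near_0_and _ _ near_0_1_plus (near_0_Cmod_lt 1 Rlt_0_1)).
  intros w [v_ge w_in].
  assert (v_neq0 : 1 + w <> 0) by (apply (Cneq0_of_Cmod _ (1 / 2)); lra).
  replace (/ (1 + w) - 1) with (- w / (1 + w)) by (field; easy).
  rewrite Cmod_div, Cmod_opp by easy. split; [apply Rdiv_lt_0_compat; lra|].
  apply Rle_div_l; nra.
Qed.

Lemma psum_inv_1_plus_minus_1 (k N : nat) (c : nat -> C) (w : C) : 1 + w <> 0 ->
  (- (1 + w)) ^ k * psum c (/ (1 + w) - 1) N
  = sum_n (fun j => RtoC ((-1) ^ (k + j)) * c j * (w ^ j * ((1 + w) ^ k * (/ (1 + w)) ^ j))) N.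
Proof.
  intros v_neq0. unfold psum. rewrite <- sum_n_Cmult_l. apply sum_n_Cext. intros j _.
  replace (/ (1 + w) - 1) with (- (w * / (1 + w))) by (field; easy).
  rewrite !Cpow_opp_l, Cpow_mult_l, pow_add, RtoC_mult. ring.
Qed.

Lemma zeta_disc_pow_expands_to (k N : nat) :
  expands_to N (fun w => zeta_disc w ^ k) (zeta_disc_coeff k).
Proof.
  set (c := lam_over_fact k).
  set (main := fun w => sum_n (fun j => RtoC ((-1) ^ (k + j)) * c j
     * (w ^ j * ((1 + w) ^ k * (/ (1 + w)) ^ j))) N).
  set (rest := fun w => zeta_reg (1 + (/ (1 + w) - 1)) ^ k - psum c (/ (1 + w) - 1) N).
  assert (main_expands : expands_to N main (zeta_disc_coeff k)).
  { apply (expands_to_ext _ main _ (fun m => sum_n (fun j => RtoC ((-1) ^ (k + j)) * c j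
      * zeta_disc_term_coeff k j m) N)); [now apply near_0_forall | |].
    - intros m m_le. symmetry. now apply zeta_disc_coeff_eq.
    - apply (expands_to_sum_n N N (fun j w => RtoC ((-1) ^ (k + j)) * c j
        * (w ^ j * ((1 + w) ^ k * (/ (1 + w)) ^ j)))). intros j.
      apply expands_to_scal, expands_to_mult_pow, expands_to_binomial_series. }
  assert (rest_small : bigO_0 (S N) rest).
  { apply (bigO_0_comp _ (fun h => zeta_reg (1 + h) ^ k - psum c h N) _ 2
      near_0_inv_1_plus_minus_1).
    apply expands_to_of_series, lam_over_fact_series. }
  assert (factor_bounded : bigO_0 0 (fun w => (- (1 + w)) ^ k)).
  { exists (2 ^ k)%R. apply near_0_imp with (2 := near_0_Cmod_lt 1 Rlt_0_1). intros w w_in.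
    rewrite Cmod_pow, Cmod_opp, pow_O, Rmult_1_r. apply pow_incr. split; [apply Cmod_ge_0|].
    eapply Rle_trans; [apply Cmod_triangle|]. rewrite Cmod_1. lra. }
  apply (bigO_0_ext _ (fun w => (main w - psum (zeta_disc_coeff k) w N) + (- (1 + w)) ^ k
    * rest w)).
  - apply near_0_imp with (2 := near_0_1_plus). intros w v_ge.
    unfold main, rest, zeta_disc.
    rewrite <- psum_inv_1_plus_minus_1 by (apply (Cneq0_of_Cmod _ (1 / 2)); lra).
    replace (1 + (/ (1 + w) - 1)) with (/ (1 + w)) by ring.
    replace (- ((1 + w) * zeta_reg (/ (1 + w)))) with (- (1 + w) * zeta_reg (/ (1 + w))) by ring.
    rewrite Cpow_mult_l. ring.
  - apply bigO_0_plus; [exact main_expands|]. now apply (bigO_0_mult 0 (S N)).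
Qed.

Lemma zeta_disc_pow_taylor (k : nat) :
  taylor_in_disc (fun w => zeta_disc w ^ k) (zeta_disc_coeff k).
Proof.
  destruct (taylor_in_disc_exists (fun w => zeta_disc w ^ k)) as [b b_taylor].
  { intros r r_in. apply (poly_approx_zeta_disc_pow _ (1 - r) (fun w => w));
      [apply Cdisc_bounded | lra | |].
    - apply poly_approx_id.
    - intros w w_in. unfold Cdisc in w_in. rewrite Re_1_plus.
      pose proof (Re_ge_opp_Cmod w). lra. }
  assert (b_eq : forall m, b m = zeta_disc_coeff k m).
  { apply (expands_to_unique (fun w => zeta_disc w ^ k)); intros N;
      [|apply zeta_disc_pow_expands_to].
    apply expands_to_of_series. intros h h_in.
    now apply (taylor_in_disc_is_series (fun w => zeta_disc w ^ k)). }
  intros r eps r_in eps_pos. destruct (b_taylor r eps r_in eps_pos) as [N b_close].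
  exists N. intros n n_ge h h_in. rewrite <- (psum_ext b) by auto. now apply b_close.
Qed.

Lemma zeta_disc_pow_series_on_circle (k : nat) (w : C) : Cmod w = 1%R -> 0 < Re (1 + w) ->
  is_Clim (zeta_disc_coeff k) 0 ->
  is_Cseries (fun m => zeta_disc_coeff k m * w ^ m) (zeta_disc w ^ k).
Proof.
  intros w_on Re_pos coeff_lim. set (d := (Re (1 + w) / 2)%R).
  apply (fatou_riesz (fun w => zeta_disc w ^ k) _ d); [unfold d; lra | easy | | |easy].
  - intros z z_in. apply (taylor_in_disc_is_series (fun w => zeta_disc w ^ k));
      [apply zeta_disc_pow_taylor | easy].
  - pose proof (Cdisc_bounded d) as disc_bd.
    apply (poly_approx_zeta_disc_pow _ d (fun h => w * (1 + h))); [easy | unfold d; lra | |].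
    + apply (poly_approx_mult _ disc_bd); [apply poly_approx_const|].
      apply poly_approx_plus; [apply poly_approx_const | apply poly_approx_id].
    + intros h h_in. unfold Cdisc in h_in.
      replace (1 + w * (1 + h)) with ((1 + w) + w * h) by ring.
      change (Re (1 + w + w * h)) with (Re (1 + w) + Re (w * h))%R.
      pose proof (Re_ge_opp_Cmod (w * h)) as Re_ge. rewrite Cmod_mult, w_on in Re_ge.
      unfold d in *. lra.
Qed.

(* The inverse of [w |-> 1 / (1 + w)] on the critical line. *)
Definition line_to_circle (t : R) : C := Cconj (critical_line t) / critical_line t.

Lemma critical_line_neq0 (t : R) : critical_line t <> 0.
Proof. apply Cneq0_of_Re. simpl. lra. Qed.

Lemma line_to_circle_1_plus (t : R) : 1 + line_to_circle t = / critical_line t.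
Proof.
  unfold line_to_circle. replace (Cconj (critical_line t)) with (1 - critical_line t).
  - field. apply critical_line_neq0.
  - apply injective_projections; simpl; field.
Qed.

Lemma Cmod_line_to_circle (t : R) : Cmod (line_to_circle t) = 1%R.
Proof.
  unfold line_to_circle. rewrite Cmod_div, Cmod_conj by apply critical_line_neq0.
  field. apply Rgt_not_eq, Cmod_gt_0, critical_line_neq0.
Qed.

Lemma Re_1_plus_line_to_circle_pos (t : R) : 0 < Re (1 + line_to_circle t).
Proof.
  rewrite line_to_circle_1_plus, Re_inv.
  apply Rdiv_lt_0_compat; [simpl; lra | apply pow_lt, Cmod_gt_0, critical_line_neq0].
Qed.

Lemma zeta_disc_line_to_circle (t : R) :
  zeta_disc (line_to_circle t) = line_to_circle t * zeta (critical_line t).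
Proof.
  pose proof (critical_line_neq0 t) as s_neq0. unfold zeta_disc.
  replace (line_to_circle t) with (1 + line_to_circle t - 1) at 3 by ring.
  rewrite line_to_circle_1_plus.
  replace (/ / critical_line t) with (critical_line t) by (field; easy).
  rewrite zeta_reg_critical_line. field. easy.
Qed.

Lemma CpowZ_sub (w : C) (m k : nat) : w <> 0 ->
  CpowZ w (Z.of_nat m - Z.of_nat k) = / w ^ k * w ^ m.
Proof.
  intros w_neq0. unfold CpowZ. pose proof (Cpow_nz w k w_neq0).
  destruct (Z.leb_spec 0 (Z.of_nat m - Z.of_nat k)).
  - replace (Z.to_nat (Z.of_nat m - Z.of_nat k)) with (m - k)%nat by lia.
    replace (w ^ m) with (w ^ (m - k) * w ^ k) by (rewrite <- Cpow_add_r; f_equal; lia).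
    field. easy.
  - replace (Z.to_nat (- (Z.of_nat m - Z.of_nat k))) with (k - m)%nat by lia.
    pose proof (Cpow_nz w m w_neq0). pose proof (Cpow_nz w (k - m) w_neq0).
    replace (w ^ k) with (w ^ (k - m) * w ^ m) by (rewrite <- Cpow_add_r; f_equal; lia).
    field. easy.
Qed.

Lemma expansion_of_coeff_lim_0 (k : nat) (t : R) :
  is_Clim (zeta_disc_coeff k) 0 -> expansion_holds k t.
Proof.
  intros coeff_lim. unfold expansion_holds. cbv zeta. fold (critical_line t).
  change (1 / 2, - t)%R with (Cconj (critical_line t)). fold (line_to_circle t).
  assert (w_neq0 : line_to_circle t <> 0) by (apply Cmod_gt_0; rewrite Cmod_line_to_circle; lra).
  pose proof (Cpow_nz _ k w_neq0) as w_pow_neq0.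
  pose proof (zeta_disc_pow_series_on_circle k _ (Cmod_line_to_circle t)
    (Re_1_plus_line_to_circle_pos t) coeff_lim) as series.
  rewrite zeta_disc_line_to_circle, Cpow_mult_l in series.
  apply (is_series_scal (/ line_to_circle t ^ k)) in series.
  replace (zeta (critical_line t) ^ k)
    with (/ line_to_circle t ^ k * (line_to_circle t ^ k * zeta (critical_line t) ^ k))
      by (field; easy).
  refine (is_series_ext _ _ _ _ series). intros m. rewrite CpowZ_sub by easy.
  change (ell (Z.of_nat m - Z.of_nat k) k) with (zeta_disc_coeff k m).
  change (scal (/ line_to_circle t ^ k) (zeta_disc_coeff k m * line_to_circle t ^ m))
    with (/ line_to_circle t ^ k * (zeta_disc_coeff k m * line_to_circle t ^ m)).
  rewrite !Cmult_assoc, (Cmult_comm (/ _)). reflexivity.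
Qed.

(** * A Poisson majorant of [|u|^(-1/2)] *)

Lemma Cmod_plus_pos_ge (u : C) (e : R) : 0 <= Re u -> 0 < e ->
  e <= Cmod (u + RtoC e) /\ Cmod u <= Cmod (u + RtoC e).
Proof.
  intros Re_ge0 e_pos. split.
  - eapply Rle_trans; [|apply Re_le_Cmod]. change (Re (u + RtoC e)) with (Re u + e)%R. lra.
  - apply Rsqr_incr_0_var; [|apply Cmod_ge_0]. rewrite !Rsqr_pow2, !Cmod2_alt.
    change (Re (u + RtoC e)) with (Re u + e)%R. change (Im (u + RtoC e)) with (Im u + 0)%R. nra.
Qed.

Lemma Cplus_pos_neq0 (u : C) (e : R) : 0 <= Re u -> 0 < e -> u + RtoC e <> 0.
Proof.
  intros Re_ge0 e_pos. apply Cneq0_of_Re. change (Re (u + RtoC e)) with (Re u + e)%R. lra.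
Qed.

Lemma Re_inv_plus_pos_nonneg (u : C) (e : R) : 0 <= Re u -> 0 < e -> 0 <= Re (/ (u + RtoC e)).
Proof.
  intros Re_ge0 e_pos. rewrite Re_inv. change (Re (u + RtoC e)) with (Re u + e)%R.
  apply Rdiv_le_0_compat; [lra|]. now apply pow_lt, Cmod_gt_0, Cplus_pos_neq0.
Qed.

(* A sum of Poisson kernels, one for each scale [4^(-i)], weighted by [|u|^(1/2)] at that
   scale; [25] is [5^2], as [|u + 4^(-i)| <= 5 * 4^(-i)] when [|u| <= 4 * 4^(-i)]. *)
Definition poisson_majorant (I : nat) (u : C) : R :=
  (25 * sum_n (fun i => (1 / 2) ^ i * Re (/ (u + RtoC ((1 / 4) ^ i))))%R I)%R.

Lemma poisson_majorant_nonneg (I : nat) (u : C) : 0 <= Re u -> 0 <= poisson_majorant I u.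
Proof.
  intros Re_ge0. assert (term_ge0 : forall i, 0 <= (1 / 2) ^ i * Re (/ (u + RtoC ((1 / 4) ^ i)))).
  { intros i. apply Rmult_le_pos; [apply pow_le; lra|].
    apply Re_inv_plus_pos_nonneg; [easy | apply pow_lt; lra]. }
  apply Rmult_le_pos; [lra|]. eapply Rle_trans; [apply (term_ge0 0%nat)|].
  apply (sum_n_term_le (fun i => (1 / 2) ^ i * Re (/ (u + RtoC ((1 / 4) ^ i))))%R); [easy | lia].
Qed.

Lemma dyadic_scale_exists (I : nat) (x : R) : (1 / 4) ^ I <= x <= 4 ->
  exists i, (i <= I)%nat /\ (1 / 4) ^ i <= x <= 4 * (1 / 4) ^ i.
Proof.
  induction I as [|I IH]; intros x_in.
  - exists 0%nat. simpl in *. split; [lia | lra].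
  - destruct (Rle_lt_dec ((1 / 4) ^ I) x) as [x_ge|x_lt].
    + destruct (IH ltac:(lra)) as [i [i_le x_scale]]. exists i. split; [lia | easy].
    + exists (S I). split; [lia|]. simpl in *. lra.
Qed.

Lemma poisson_kernel_at_scale_ge (u : C) (e : R) : 0 <= Re u -> 0 < e -> Cmod u <= 4 * e ->
  / (25 * e) <= Re (/ (u + RtoC e)).
Proof.
  intros Re_ge0 e_pos u_le. destruct (Cmod_plus_pos_ge u e Re_ge0 e_pos) as [shift_ge _].
  pose proof (Cmod_triangle u (RtoC e)) as shift_le. rewrite Cmod_RtoC_pos in shift_le by lra.
  rewrite Re_inv. change (Re (u + RtoC e)) with (Re u + e)%R.
  replace (/ (25 * e))%R with (e / (5 * e) ^ 2)%R by (field; lra).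
  apply Rmult_le_compat; [lra | apply Rlt_le, Rinv_0_lt_compat; nra | lra |].
  apply Rinv_le_contravar; [nra | apply pow_incr; lra].
Qed.

Lemma sqrt_inv_le_poisson_majorant (I : nat) (u : C) : 0 <= Re u -> (1 / 4) ^ I <= Cmod u <= 4 ->
  sqrt (/ Cmod u) <= poisson_majorant I u.
Proof.
  intros Re_ge0 u_in. destruct (dyadic_scale_exists I (Cmod u) u_in) as [i [i_le u_scale]].
  assert (scale_pos : 0 < (1 / 4) ^ i) by (apply pow_lt; lra).
  assert (weight_pos : 0 < (1 / 2) ^ i) by (apply pow_lt; lra).
  assert (scale_sq : ((1 / 4) ^ i = (1 / 2) ^ i * (1 / 2) ^ i)%R).
  { rewrite <- Rpow_mult_distr. f_equal. field. }
  apply Rle_trans with (/ (1 / 2) ^ i)%R.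
  - rewrite <- (sqrt_pow2 (/ (1 / 2) ^ i)) by now apply Rlt_le, Rinv_0_lt_compat.
    apply sqrt_le_1_alt. rewrite pow_inv.
    replace (((1 / 2) ^ i) ^ 2)%R with ((1 / 4) ^ i)%R by (rewrite scale_sq; ring).
    apply Rinv_le_contravar; lra.
  - apply Rle_trans with (25 * ((1 / 2) ^ i * Re (/ (u + RtoC ((1 / 4) ^ i)))))%R.
    + replace (/ (1 / 2) ^ i)%R with (25 * ((1 / 2) ^ i * / (25 * (1 / 4) ^ i)))%R
        by (rewrite scale_sq; field; lra).
      apply Rmult_le_compat_l, Rmult_le_compat_l; [lra | lra |].
      now apply poisson_kernel_at_scale_ge.
    + apply Rmult_le_compat_l; [lra|].
      apply (sum_n_term_le (fun i => (1 / 2) ^ i * Re (/ (u + RtoC ((1 / 4) ^ i))))%R); [|easy].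
      intros j. apply Rmult_le_pos; [apply pow_le; lra|].
      apply Re_inv_plus_pos_nonneg; [easy | apply pow_lt; lra].
Qed.

Lemma unity_root_sum_inv (x : C) (N : nat) : x ^ S N <> 1 ->
  sum_n (fun m => / (1 - x * unity_root N ^ m)) N = RtoC (INR (S N)) / (1 - x ^ S N) :> C.
Proof.
  intros x_pow_neq1.
  assert (q_neq0 : 1 - x ^ S N <> 0) by now apply Cminus_eq_contra, not_eq_sym.
  rewrite (sum_n_Cext _ (fun m => / (1 - x ^ S N)
    * sum_n (fun l => x ^ l * ((unity_root N ^ m) ^ l * Cconj ((unity_root N ^ m) ^ 0))) N)).
  - rewrite sum_n_Cmult_l, (sum_n_switch (G := C_AbelianMonoid)),
      (sum_n_single (G := C_AbelianMonoid) _ N 0); [|lia|].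
    + rewrite sum_n_Cmult_l, unity_root_orthogonal by lia. simpl (Nat.eq_dec 0 0). cbv iota.
      simpl (x ^ 0).
      field. easy.
    + intros l l_le l_neq. rewrite sum_n_Cmult_l, unity_root_orthogonal by lia.
      destruct (Nat.eq_dec l 0); [easy | apply Cmult_0_r].
  - intros m _. set (v := unity_root N ^ m).
    rewrite (sum_n_Cext _ (fun l => (x * v) ^ l)).
    2:{ intros l _. rewrite Cpow_mult_l. simpl (v ^ 0). unfold Cconj; simpl. rewrite Ropp_0.
        fold (RtoC 1). ring. }
    pose proof (sum_n_Cgeom (x * v) N) as geom.
    rewrite Cpow_mult_l, (unity_root_pow_pow_order N m : v ^ S N = 1), Cmult_1_r in geom.
    assert (xv_neq1 : 1 - x * v <> 0).
    { intros xv_eq. rewrite xv_eq, Cmult_0_l in geom. now apply q_neq0. }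
    rewrite <- geom. field. split; [|easy]. intros sum_eq. rewrite sum_eq, Cmult_0_r in geom.
    now apply q_neq0.
Qed.

Lemma unity_root_mean_Re_inv_le (u : R) (N : nat) : 1 < u -> (/ u) ^ S N <= 1 / 2 ->
  sum_n (fun m => Re (/ (RtoC u + unity_root N ^ m))) N <= 2 * INR (S N).
Proof.
  intros u_gt1 u_pow. assert (N_pos : 0 < INR (S N)) by (apply lt_0_INR; lia).
  assert (u_neq0 : RtoC u <> 0) by (apply RtoC_neq0; lra).
  assert (u_inv : 0 < / u <= 1)
    by (split; [apply Rinv_0_lt_compat | rewrite <- Rinv_1; apply Rinv_le_contravar]; lra).
  set (q := RtoC (- / u) ^ S N).
  assert (q_le : Cmod q <= 1 / 2).
  { unfold q. rewrite Cmod_pow, Cmod_R, Rabs_Ropp, Rabs_pos_eq by lra. easy. }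
  pose proof (Cmod_le_plus_minus 1 q) as q_ge. rewrite Cmod_1 in q_ge.
  assert (q_neq1 : q <> 1) by (intros q_eq; rewrite q_eq, Cmod_1 in q_le; lra).
  rewrite (sum_n_ext _ (fun m => Re (/ RtoC u * / (1 - RtoC (- / u) * unity_root N ^ m)))).
  2:{ intros m. f_equal. rewrite RtoC_opp, RtoC_inv by lra.
      replace (1 - - / RtoC u * unity_root N ^ m) with ((RtoC u + unity_root N ^ m) / RtoC u)
        by (field; easy).
      field. split; [easy|]. intros v_eq.
      pose proof (Cmod_le_plus_minus (RtoC u) (- unity_root N ^ m)) as u_le.
      replace (RtoC u - - unity_root N ^ m) with (RtoC u + unity_root N ^ m) in u_le by ring.
      rewrite v_eq, Cmod_0, Cmod_opp, Cmod_unity_root_pow, Cmod_RtoC_pos in u_le by lra. lra. }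
  rewrite <- (Re_sum_n (fun m => / RtoC u * / (1 - RtoC (- / u) * unity_root N ^ m))).
  rewrite sum_n_Cmult_l, unity_root_sum_inv by easy. fold q.
  eapply Rle_trans; [apply Re_le_Cmod|].
  rewrite Cmod_mult, Cmod_inv, Cmod_div, !Cmod_RtoC_pos
    by (try easy; try lra; now apply Cminus_eq_contra, not_eq_sym).
  rewrite <- (Rmult_1_l (2 * INR (S N))).
  apply Rmult_le_compat; [lra | | lra | apply Rle_div_l; nra].
  apply Rdiv_le_0_compat; lra.
Qed.

Lemma poisson_majorant_mean_le (I : nat) :
  eventually (fun N => sum_n (fun m => poisson_majorant I (1 + unity_root N ^ m)) N
    <= 100 * INR (S N)).
Proof.
  set (e := ((1 / 4) ^ I)%R). assert (e_pos : 0 < e) by (apply pow_lt; lra).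
  assert (ratio_in : 0 < / (1 + e) < 1).
  { split; [apply Rinv_0_lt_compat; lra|]. rewrite <- Rinv_1. apply Rinv_lt_contravar; lra. }
  assert (ratio_lim : is_lim_seq (fun N => / (1 + e) ^ S N)%R 0%R).
  { apply (is_lim_seq_ext (fun N => (/ (1 + e)) ^ S N)%R); [intros; apply pow_inv|].
    apply (is_lim_seq_incr_1 (fun N => (/ (1 + e)) ^ N)%R), is_lim_seq_geom.
    rewrite Rabs_pos_eq; lra. }
  apply filter_imp with (2 := is_lim_seq_0_eventually_le _ (1 / 2) ratio_lim ltac:(lra)).
  intros N ratio_le.
  rewrite <- pow_inv in ratio_le.
  assert (N_pos : 0 < INR (S N)) by (apply lt_0_INR; lia).
  unfold poisson_majorant. unfold sum_n at 1. rewrite sum_n_m_Rmult_l.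
  fold (sum_n (fun m => sum_n (fun i => (1 / 2) ^ i
    * Re (/ (1 + unity_root N ^ m + RtoC ((1 / 4) ^ i))))%R I) N).
  rewrite (sum_n_switch (G := R_AbelianMonoid)).
  apply Rle_trans with (25 * (2 * INR (S N) * 2))%R; [|lra]. apply Rmult_le_compat_l; [lra|].
  apply Rle_trans with (sum_n (fun i => 2 * INR (S N) * (1 / 2) ^ i)%R I).
  - apply sum_n_m_le_loc. intros i i_in. unfold sum_n. rewrite sum_n_m_Rmult_l, Rmult_comm.
    apply Rmult_le_compat_r; [apply pow_le; lra|].
    rewrite (sum_n_m_ext _ (fun m => Re (/ (RtoC (1 + (1 / 4) ^ i) + unity_root N ^ m)))).
    2:{ intros m. rewrite RtoC_plus. f_equal. f_equal. ring. }
    assert (scale_ge : e <= (1 / 4) ^ i).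
    { unfold e. replace I with (i + (I - i))%nat by lia. rewrite pow_add.
      pose proof (pow_le_1 (1 / 4) (I - i) ltac:(lra)).
      assert (0 < (1 / 4) ^ i) by (apply pow_lt; lra). nra. }
    apply unity_root_mean_Re_inv_le; [lra|]. eapply Rle_trans; [|exact ratio_le].
    apply pow_incr. split; [apply Rlt_le, Rinv_0_lt_compat; lra | apply Rinv_le_contravar; lra].
  - unfold sum_n. rewrite sum_n_m_Rmult_l. apply Rmult_le_compat_l; [lra|].
    eapply Rle_trans; [apply sum_n_m_geom_le_lt1; lra|]. simpl. lra.
Qed.

(** * Square-summability of Taylor coefficients *)

Lemma Cmod_1_plus_sq_le (w : C) : Cmod w <= 1 -> Cmod (1 + w) ^ 2 <= 2 * Re (1 + w).
Proof.
  intros w_le. assert (w_sq : Cmod w ^ 2 <= 1) by (pose proof (Cmod_ge_0 w); nra).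
  rewrite Cmod2_alt in w_sq. rewrite Cmod2_alt.
  change (Re (1 + w)) with (1 + Re w)%R. change (Im (1 + w)) with (0 + Im w)%R. nra.
Qed.

Lemma Re_1_plus_nonneg (w : C) : Cmod w <= 1 -> 0 <= Re (1 + w).
Proof. intros w_le. rewrite Re_1_plus. pose proof (Re_ge_opp_Cmod w). lra. Qed.

Lemma Cmod_pow_minus_1_le (y : C) (n : nat) :
  Cmod y <= 1 -> Cmod (y ^ n - 1) <= INR n * Cmod (y - 1).
Proof.
  intros y_le. induction n as [|n IH].
  - simpl. replace (1 - 1) with (RtoC 0) by ring. rewrite Cmod_0. lra.
  - rewrite Cpow_S, S_INR. replace (y * y ^ n - 1) with (y * (y ^ n - 1) + (y - 1)) by ring.
    eapply Rle_trans; [apply Cmod_triangle|]. rewrite Cmod_mult.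
    pose proof (Cmod_ge_0 (y ^ n - 1)). nra.
Qed.

Definition disc_away (c : R) (w : C) : Prop := Cmod w <= 1 /\ c <= Re (1 + w).

Lemma disc_away_bounded (c : R) : bounded_set (disc_away c).
Proof. exists 1%R. now intros w [w_le _]. Qed.

Lemma disc_away_dilation (c r : R) (w : C) :
  0 <= r <= 1 -> c <= 1 -> disc_away c w -> disc_away c (RtoC r * w).
Proof.
  intros r_in c_le [w_le Re_ge]. rewrite Re_1_plus in Re_ge. split.
  - rewrite Cmod_mult, Cmod_RtoC_pos by lra. pose proof (Cmod_ge_0 w). nra.
  - rewrite Re_1_plus, re_mult. simpl. nra.
Qed.

(* Near [-1] both values are small, and away from [-1] the function is uniformly continuous. *)
Lemma dilation_close (g : C -> C) (L eps : R) : 0 < eps ->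
  (forall c, 0 < c -> poly_approx (disc_away c) g) ->
  (forall w, Cmod w <= 1 -> Cmod (g w) <= L * Cmod (1 + w)) ->
  exists d : R, 0 < d <= 1 /\ forall w, Cmod w <= 1 -> Cmod (g w - g (RtoC (1 - d) * w)) <= eps.
Proof.
  intros eps_pos g_approx g_le.
  destruct (small_factor L (eps / 2)%R ltac:(lra)) as [kap [kap_pos kap_small]].
  set (c := Rmin 1 (kap ^ 2 / 8)).
  assert (c_pos : 0 < c) by (apply Rmin_pos; nra).
  pose proof (Rmin_l 1 (kap ^ 2 / 8) : c <= 1).
  pose proof (Rmin_r 1 (kap ^ 2 / 8) : c <= kap ^ 2 / 8).
  destruct (poly_approx_uniformly_continuous _ (disc_away_bounded c) g eps
    (g_approx c c_pos) eps_pos)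
    as [d0 [d0_pos g_cont]].
  set (d := Rmin d0 (Rmin 1 (kap / 2))). exists d.
  pose proof (Rmin_l d0 (Rmin 1 (kap / 2)) : d <= d0).
  pose proof (Rle_trans _ _ _ (Rmin_r d0 (Rmin 1 (kap / 2))) (Rmin_l _ _) : d <= 1).
  pose proof (Rle_trans _ _ _ (Rmin_r d0 (Rmin 1 (kap / 2))) (Rmin_r _ _) : d <= kap / 2).
  assert (d_pos : 0 < d) by (repeat apply Rmin_pos; lra).
  split; [lra|]. intros w w_le. pose proof (Cmod_ge_0 w).
  assert (dilation_near : Cmod (w - RtoC (1 - d) * w) <= d).
  { replace (w - RtoC (1 - d) * w) with (RtoC d * w) by (rewrite RtoC_minus; ring).
    rewrite Cmod_mult, Cmod_RtoC_pos by lra. nra. }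
  destruct (Rle_lt_dec (Cmod (1 + w)) (kap / 2)) as [near|away].
  - assert (L_ge0 : 0 <= L).
    { pose proof (g_le 0 ltac:(rewrite Cmod_0; lra)) as g_0. rewrite Cplus_0_r, Cmod_1 in g_0.
      pose proof (Cmod_ge_0 (g 0)). lra. }
    assert (dilated_le : Cmod (RtoC (1 - d) * w) <= 1)
      by (rewrite Cmod_mult, Cmod_RtoC_pos by lra; nra).
    assert (dilated_near : Cmod (1 + RtoC (1 - d) * w) <= kap).
    { pose proof (Cmod_le_plus_minus (1 + RtoC (1 - d) * w) (1 + w)) as tri.
      replace (1 + RtoC (1 - d) * w - (1 + w)) with (- (w - RtoC (1 - d) * w)) in tri by ring.
      rewrite Cmod_opp in tri. lra. }
    eapply Rle_trans; [apply Cmod_minus_le_plus|].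
    pose proof (g_le w w_le). pose proof (g_le _ dilated_le). nra.
  - assert (w_away : disc_away c w).
    { split; [easy|]. pose proof (Cmod_1_plus_sq_le w w_le). nra. }
    apply g_cont; [easy | apply disc_away_dilation; [lra | lra | easy] | lra].
Qed.

Lemma poly_approx_closed_disc (g : C -> C) (L : R) :
  (forall c, 0 < c -> poly_approx (disc_away c) g) ->
  (forall w, Cmod w <= 1 -> Cmod (g w) <= L * Cmod (1 + w)) ->
  poly_approx (Cdisc 1) g.
Proof.
  intros g_approx g_le. apply poly_approx_limit. intros eps eps_pos.
  destruct (dilation_close g L eps eps_pos g_approx g_le) as [d [d_in g_close]].
  exists (fun w => g (RtoC (1 - d) * w)). split; [|exact g_close].
  apply (poly_approx_comp _ (Cdisc_bounded 1) (disc_away d)).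
  - apply g_approx. lra.
  - apply (poly_approx_mult _ (Cdisc_bounded 1));
      [apply poly_approx_const | apply poly_approx_id].
  - intros w w_le. unfold Cdisc in w_le. pose proof (Cmod_ge_0 w).
    assert (dilated_le : Cmod (RtoC (1 - d) * w) <= 1 - d)
      by (rewrite Cmod_mult, Cmod_RtoC_pos by lra; nra).
    pose proof (Re_ge_opp_Cmod (RtoC (1 - d) * w)). split; [lra|]. rewrite Re_1_plus. lra.
Qed.

Section SquareSummability.

Variables (f : C -> C) (a : nat -> C) (k : nat) (A B : R).
Hypothesis B_ge0 : 0 <= B.
Hypothesis f_approx : forall c, 0 < c -> poly_approx (disc_away c) f.
Hypothesis f_growth : forall w, Cmod w <= 1 -> Cmod (f w) * Cmod (1 + w) ^ k <= A.
Hypothesis f_circle :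
  forall w, Cmod w = 1%R -> 1 + w <> 0 -> Cmod (f w) ^ 2 <= B * sqrt (/ Cmod (1 + w)).
Hypothesis f_taylor : taylor_in_disc f a.

Definition damping (e : R) (w : C) : C := (1 + w) * / (1 + w + RtoC e).

(* Damping makes [f] continuous on the closed disc without increasing it. *)
Definition damped (e : R) (w : C) : C := f w * damping e w ^ S k.

Lemma Cmod_damping_eq (e : R) (w : C) : 0 < e -> Cmod w <= 1 ->
  Cmod (damping e w) = (Cmod (1 + w) / Cmod (1 + w + RtoC e))%R.
Proof.
  intros e_pos w_le. unfold damping. rewrite Cmod_mult, Cmod_inv; [easy|].
  apply Cplus_pos_neq0; [now apply Re_1_plus_nonneg | easy].
Qed.

Lemma Cmod_damping_le_1 (e : R) (w : C) : 0 < e -> Cmod w <= 1 -> Cmod (damping e w) <= 1.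
Proof.
  intros e_pos w_le. rewrite Cmod_damping_eq by easy.
  destruct (Cmod_plus_pos_ge (1 + w) e (Re_1_plus_nonneg w w_le) e_pos). apply Rle_div_l; lra.
Qed.

Lemma Cmod_damped_le (e : R) (w : C) : 0 < e -> Cmod w <= 1 -> Cmod (damped e w) <= Cmod (f w).
Proof.
  intros e_pos w_le. unfold damped. rewrite Cmod_mult, Cmod_pow.
  pose proof (pow_le_1 _ (S k) (conj (Cmod_ge_0 _) (Cmod_damping_le_1 e w e_pos w_le))).
  pose proof (Cmod_ge_0 (f w)). nra.
Qed.

Lemma Cmod_damped_le_near (e : R) (w : C) : 0 < e -> Cmod w <= 1 ->
  Cmod (damped e w) <= A / e ^ S k * Cmod (1 + w).
Proof.
  intros e_pos w_le. unfold damped. rewrite Cmod_mult, Cmod_pow, Cmod_damping_eq by easy.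
  destruct (Cmod_plus_pos_ge (1 + w) e (Re_1_plus_nonneg w w_le) e_pos) as [shift_ge _].
  assert (e_pow : 0 < e ^ S k) by now apply pow_lt.
  unfold Rdiv. rewrite Rpow_mult_distr, pow_inv, <- tech_pow_Rmult.
  set (shift_pow := (Cmod (1 + w + RtoC e) ^ S k)%R).
  replace (Cmod (f w) * (Cmod (1 + w) * Cmod (1 + w) ^ k * / shift_pow))%R
    with (Cmod (f w) * Cmod (1 + w) ^ k * / shift_pow * Cmod (1 + w))%R by ring.
  apply Rmult_le_compat_r; [apply Cmod_ge_0|]. apply Rmult_le_compat.
  - apply Rmult_le_pos; [apply Cmod_ge_0 | apply pow_le, Cmod_ge_0].
  - apply Rlt_le, Rinv_0_lt_compat, pow_lt. lra.
  - now apply f_growth.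
  - apply Rinv_le_contravar; [easy | apply pow_incr; lra].
Qed.

Lemma poly_approx_damped (e : R) : 0 < e -> poly_approx (Cdisc 1) (damped e).
Proof.
  intros e_pos. apply (poly_approx_closed_disc _ (A / e ^ S k));
    [|now intros; apply Cmod_damped_le_near].
  intros c c_pos. pose proof (disc_away_bounded c) as lens_bd.
  assert (v_approx : poly_approx (disc_away c) (fun w => 1 + w))
    by (apply poly_approx_plus; [apply poly_approx_const | apply poly_approx_id]).
  apply (poly_approx_mult _ lens_bd); [now apply f_approx|]. apply (poly_approx_pow _ lens_bd).
  apply (poly_approx_mult _ lens_bd); [easy|].
  apply (rhp_approx_comp _ c Cinv (fun w => 1 + w + RtoC e));
    [easy | easy | apply rhp_approx_inv | |].
  - apply poly_approx_plus; [easy | apply poly_approx_const].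
  - intros w [_ Re_ge]. change (Re (1 + w + RtoC e)) with (Re (1 + w) + e)%R. lra.
Qed.

Lemma Cmod_damped_minus_le (e : R) (w : C) : 0 < e -> Cmod w <= 1 / 2 ->
  Cmod (damped e w - f w) <= A * 2 ^ k * INR (S k) * 2 * e.
Proof.
  intros e_pos w_le. pose proof (Re_ge_opp_Cmod w) as Re_ge.
  pose proof (Re_le_Cmod (1 + w)) as v_ge.
  rewrite Re_1_plus in v_ge.
  destruct (Cmod_plus_pos_ge (1 + w) e (Re_1_plus_nonneg w ltac:(lra)) e_pos) as [_ shift_ge].
  pose proof (Cplus_pos_neq0 (1 + w) e (Re_1_plus_nonneg w ltac:(lra)) e_pos) as shift_neq0.
  assert (f_le : Cmod (f w) <= A * 2 ^ k).
  { assert (v_pow : (/ 2) ^ k <= Cmod (1 + w) ^ k) by (apply pow_incr; lra).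
    replace (2 ^ k)%R with (/ (/ 2) ^ k)%R by now rewrite pow_inv, Rinv_inv.
    apply Rle_div_r; [apply pow_lt; lra|].
    eapply Rle_trans; [|apply (f_growth w); lra].
    apply Rmult_le_compat_l; [apply Cmod_ge_0 | easy]. }
  assert (damping_close : Cmod (damping e w - 1) <= 2 * e).
  { replace (damping e w - 1) with (- RtoC e / (1 + w + RtoC e)) by (unfold damping; field; easy).
    rewrite Cmod_div, Cmod_opp, Cmod_RtoC_pos by (try easy; lra). apply Rle_div_l; [lra | nra]. }
  pose proof (Cmod_pow_minus_1_le _ (S k) (Cmod_damping_le_1 e w e_pos ltac:(lra))) as pow_close.
  replace (damped e w - f w) with (f w * (damping e w ^ S k - 1)) by (unfold damped; ring).
  rewrite Cmod_mult. replace (A * 2 ^ k * INR (S k) * 2 * e)%R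
    with (A * 2 ^ k * (INR (S k) * (2 * e)))%R by ring.
  apply Rmult_le_compat; [apply Cmod_ge_0 | apply Cmod_ge_0 | easy |].
  eapply Rle_trans; [exact pow_close|]. apply Rmult_le_compat_l; [apply pos_INR | easy].
Qed.

Lemma Cmod_damped_sq_le (e : R) : 0 < e -> exists I, forall v, Cmod v = 1%R ->
  Cmod (damped e v) ^ 2 <= 1 + B * poisson_majorant I (1 + v).
Proof.
  intros e_pos. set (L := (A / e ^ S k)%R).
  destruct (filter_ex (F := eventually) _ (is_lim_seq_0_eventually_le _ 1
    (is_lim_seq_scal_0 L _ (is_lim_seq_geom (1 / 4) ltac:(rewrite Rabs_pos_eq; lra))) Rlt_0_1))
      as [I scale_small].
  assert (scale_pos : 0 < (1 / 4) ^ I) by (apply pow_lt; lra).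
  exists I. intros v v_on. pose proof (Re_1_plus_nonneg v ltac:(lra)) as Re_ge0.
  pose proof (poisson_majorant_nonneg I _ Re_ge0) as majorant_ge0.
  pose proof (Cmod_ge_0 (damped e v)).
  destruct (Rle_lt_dec ((1 / 4) ^ I) (Cmod (1 + v))) as [away|near].
  - pose proof (Cmod_triangle 1 v) as v_le. rewrite Cmod_1 in v_le.
    pose proof (sqrt_inv_le_poisson_majorant I (1 + v) Re_ge0 ltac:(lra)) as majorant_ge.
    pose proof (Cmod_damped_le e v e_pos ltac:(lra)) as damped_le.
    apply Rle_trans with (Cmod (f v) ^ 2)%R; [apply pow_incr; lra|].
    eapply Rle_trans; [apply f_circle; [easy | apply (Cneq0_of_Cmod _ ((1 / 4) ^ I)); lra]|].
    pose proof (Rmult_le_compat_l B _ _ B_ge0 majorant_ge). lra.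
  - pose proof (Cmod_damped_le_near e v e_pos ltac:(lra)) as damped_le. fold L in damped_le.
    assert (damped_le1 : Cmod (damped e v) <= 1).
    { pose proof (Cmod_ge_0 (1 + v)). destruct (Rle_dec 0 L); nra. }
    assert (0 <= B * poisson_majorant I (1 + v)) by now apply Rmult_le_pos. nra.
Qed.

Lemma damped_approx_coeffs_sq_le (e d : R) (q : nat -> C) (J : nat) : 0 < e -> 0 <= d <= 1 ->
  approx_by 1 d (damped e) q -> sum_n (fun j => Cmod (q j) ^ 2)%R J <= 4 + 200 * B.
Proof.
  intros e_pos d_in q_approx. destruct (Cmod_damped_sq_le e e_pos) as [I damped_sq_le].
  assert (J_near : eventually (fun N => (J <= N)%nat)) by now exists J.
  destruct (filter_ex (F := eventually) _ (filter_and _ _ J_near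
    (filter_and _ _ q_approx (poisson_majorant_mean_le I)))) as [N [J_le [q_close mean_le]]].
  assert (N_pos : 0 < INR (S N)) by (apply lt_0_INR; lia).
  apply Rle_trans with (sum_n (fun j => Cmod (q j) ^ 2)%R N);
    [apply sum_n_mono; [intros; apply pow2_ge_0 | easy]|].
  apply Rmult_le_reg_l with (INR (S N)); [easy|]. rewrite <- parseval.
  apply Rle_trans with (sum_n (fun m => 4 + 2 * B * poisson_majorant I (1 + unity_root N ^ m))%R
    N).
  - apply sum_n_m_le_loc. intros m _. pose proof (Cmod_unity_root_pow N m) as v_on.
    specialize (damped_sq_le _ v_on). specialize (q_close (unity_root N ^ m) ltac:(lra)).
    eapply Rle_trans; [apply (Cmod_sq_le_minus _ (damped e (unity_root N ^ m)))|].
    rewrite Cmod_minus_sym in q_close.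
    pose proof (Cmod_ge_0 (psum q (unity_root N ^ m) N - damped e (unity_root N ^ m))). nra.
  - rewrite sum_n_Rplus, sum_n_const. unfold sum_n at 1. rewrite sum_n_m_Rmult_l.
    fold (sum_n (fun m => poisson_majorant I (1 + unity_root N ^ m)) N). nra.
Qed.

Lemma taylor_coeffs_approx (J : nat) (eta : R) : 0 < eta ->
  exists q, sum_n (fun j => Cmod (q j) ^ 2)%R J <= 4 + 200 * B /\
    forall j, (j <= J)%nat -> Cmod (a j - q j) <= eta.
Proof.
  intros eta_pos.
  destruct (small_factor (3 * 2 ^ J) eta eta_pos) as [d0 [d0_pos d0_small]].
  set (d := Rmin 1 d0). pose proof (Rmin_l 1 d0 : d <= 1). pose proof (Rmin_r 1 d0 : d <= d0).
  assert (d_pos : 0 < d) by (apply Rmin_pos; lra).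
  destruct (small_factor (A * 2 ^ k * INR (S k) * 2) d d_pos) as [e [e_pos e_small]].
  destruct (poly_approx_approx_by _ 1 d d_pos (poly_approx_damped e e_pos)) as [q q_approx].
  exists q. split; [apply (damped_approx_coeffs_sq_le e d); [easy | lra | easy]|]. intros j j_le.
  assert (q_approx_f : approx_by (1 / 2) (2 * d) f q).
  { apply filter_imp with (2 := q_approx). intros n q_close h h_in.
    eapply Rle_trans; [apply (Cmod_minus_triangle _ (damped e h))|]. rewrite Cmod_minus_sym.
    pose proof (Cmod_damped_minus_le e h e_pos h_in). specialize (q_close h ltac:(lra)). lra. }
  pose proof (approx_by_coeff_close f (1 / 2) d (2 * d) a q j ltac:(lra)
    (f_taylor (1 / 2)%R d ltac:(lra) d_pos) q_approx_f) as coeff_close.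
  apply Rmult_le_reg_r with ((1 / 2) ^ j)%R; [apply pow_lt; lra|].
  eapply Rle_trans; [exact coeff_close|].
  apply Rle_trans with (eta * (1 / 2) ^ J)%R.
  - replace ((1 / 2) ^ J)%R with (/ 2 ^ J)%R by (rewrite <- pow_inv; f_equal; field).
    apply Rle_div_r; [apply pow_lt; lra|]. assert (0 < 2 ^ J) by (apply pow_lt; lra). nra.
  - apply Rmult_le_compat_l; [lra|]. replace J with (j + (J - j))%nat by lia. rewrite pow_add.
    pose proof (pow_le_1 (1 / 2) (J - j) ltac:(lra)).
    assert (0 < (1 / 2) ^ j) by (apply pow_lt; lra). nra.
Qed.

Theorem taylor_coeffs_square_summable : ex_series (fun j => Cmod (a j) ^ 2)%R.
Proof.
  destruct (ex_finite_lim_seq_incr (sum_n (fun j => Cmod (a j) ^ 2)%R) (2 * (4 + 200 * B) + 2))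
    as [l l_lim].
  - intros n. apply sum_n_mono; [intros; apply pow2_ge_0 | lia].
  - intros J. assert (J_pos : 0 < INR (S J)) by (apply lt_0_INR; lia).
    assert (J_inv : 0 < / INR (S J) <= 1).
    { split; [now apply Rinv_0_lt_compat|]. rewrite <- Rinv_1. apply Rinv_le_contravar; [lra|].
      apply (le_INR 1). lia. }
    destruct (taylor_coeffs_approx J (/ INR (S J)) (proj1 J_inv)) as [q [q_sq_le a_close]].
    apply Rle_trans with (sum_n (fun j => 2 * Cmod (q j) ^ 2 + 2 * / INR (S J))%R J).
    + apply sum_n_m_le_loc. intros j [_ j_le]. specialize (a_close j j_le).
      eapply Rle_trans; [apply (Cmod_sq_le_minus _ (q j))|].
      pose proof (Cmod_ge_0 (a j - q j)). nra.
    + rewrite sum_n_Rplus, sum_n_const. unfold sum_n at 1. rewrite sum_n_m_Rmult_l.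
      fold (sum_n (fun j => Cmod (q j) ^ 2)%R J).
      replace (INR (S J) * (2 * / INR (S J)))%R with 2%R by (field; lra). lra.
  - exists l. exact l_lim.
Qed.

End SquareSummability.

(** * Consequences of the Lindelof Hypothesis *)

Lemma Cmod_zeta_disc_growth (w : C) : Cmod w <= 1 -> Cmod (zeta_disc w) * Cmod (1 + w) <= 12.
Proof.
  intros w_le. unfold zeta_disc. rewrite Cmod_opp, Cmod_mult.
  destruct (Ceq_dec (1 + w) 0) as [v_eq0|v_neq0]; [rewrite v_eq0, Cmod_0; lra|].
  set (s := / (1 + w)). pose proof (proj1 (Cmod_gt_0 _) v_neq0) as v_pos.
  pose proof (Cmod_triangle 1 w) as v_le. rewrite Cmod_1 in v_le.
  assert (s_mod : Cmod s = (/ Cmod (1 + w))%R) by now apply Cmod_inv.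
  assert (s_ge : / 2 <= Cmod s) by (rewrite s_mod; apply Rinv_le_contravar; lra).
  assert (Re_ge : / 2 <= Re s).
  { unfold s. rewrite Re_inv. apply Rle_div_r; [apply pow_lt; lra|].
    pose proof (Cmod_1_plus_sq_le w w_le). lra. }
  assert (s1_le : Cmod (s - 1) <= Cmod s).
  { replace (s - 1) with (- w * s) by (unfold s; field; easy).
    rewrite Cmod_mult, Cmod_opp. pose proof (Cmod_ge_0 s). nra. }
  pose proof (Cmod_ge_0 (s - 1)).
  assert (quotient_le : Cmod s * Cmod (s - 1) / Re s <= 2 * Cmod s ^ 2) by (apply Rle_div_l; nra).
  pose proof (Cmod_zeta_reg_le s ltac:(lra)) as zeta_le.
  assert (zeta_reg_le : Cmod (zeta_reg s) <= 12 * Cmod s ^ 2) by nra.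
  apply Rle_trans with (Cmod (1 + w) * (12 * Cmod s ^ 2) * Cmod (1 + w))%R.
  - apply Rmult_le_compat_r; [lra|]. apply Rmult_le_compat_l; lra.
  - rewrite s_mod. apply Req_le. field. lra.
Qed.

Lemma line_to_circle_surj (w : C) : Cmod w = 1%R -> 1 + w <> 0 -> exists t, w = line_to_circle t.
Proof.
  intros w_on v_neq0. exists (Im (/ (1 + w))).
  assert (Re_eq : Re (/ (1 + w)) = (1 / 2)%R).
  { pose proof (pow_lt _ 2 (proj1 (Cmod_gt_0 _) v_neq0)) as v_sq_pos.
    assert (v_sq : (Cmod (1 + w) ^ 2 = 2 * Re (1 + w))%R).
    { pose proof (Cmod2_alt w) as w_sq. rewrite w_on in w_sq. rewrite Cmod2_alt.
      change (Re (1 + w)) with (1 + Re w)%R. change (Im (1 + w)) with (0 + Im w)%R. nra. }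
    rewrite Re_inv, v_sq. field. lra. }
  assert (point_eq : critical_line (Im (/ (1 + w))) = / (1 + w)).
  { unfold critical_line. rewrite <- Re_eq. symmetry. apply surjective_pairing. }
  replace (line_to_circle (Im (/ (1 + w)))) with (1 + line_to_circle (Im (/ (1 + w))) - 1)
    by ring.
  rewrite line_to_circle_1_plus, point_eq. field. easy.
Qed.

Lemma Rpower_pow_l (x y : R) (n : nat) : (Rpower x y ^ n = Rpower x (y * INR n))%R.
Proof. rewrite <- Rpower_pow by apply exp_pos. apply Rpower_mult. Qed.

Lemma Cmod_critical_line_ge (t : R) :
  1 / 2 <= Cmod (critical_line t) /\ Rabs t <= Cmod (critical_line t).
Proof. exact (conj (Re_le_Cmod (critical_line t)) (Rabs_Im_le_Cmod (critical_line t))). Qed.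

Lemma Cmod_zeta_critical_line_le (t : R) :
  Cmod (zeta (critical_line t)) <= 12 * Cmod (critical_line t).
Proof.
  pose proof (Cmod_zeta_disc_growth (line_to_circle t) (Req_le _ _ (Cmod_line_to_circle t)))
    as growth.
  pose proof (Cmod_critical_line_ge t) as [s_ge _].
  rewrite zeta_disc_line_to_circle, line_to_circle_1_plus, Cmod_mult, Cmod_line_to_circle,
    Rmult_1_l,
    Cmod_inv in growth by apply critical_line_neq0.
  apply (Rle_div_l _ 12 (Cmod (critical_line t))) in growth; [exact growth | lra].
Qed.

(* The exponent [1/(4k)] in the Lindelof Hypothesis makes [|zeta^k|^2] an [O(|t|^(1/2))]. *)
Lemma lindelof_zeta_pow_le (k : nat) : (1 <= k)%nat -> Lindelof ->
  exists B : R, 0 <= B /\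
    forall t, (Cmod (zeta (critical_line t)) ^ k) ^ 2 <= B * sqrt (Cmod (critical_line t)).
Proof.
  intros k_ge1 lindelof. assert (k_pos : 0 < INR k) by (apply lt_0_INR; lia).
  destruct (lindelof (/ (4 * INR k))%R) as [M [T [T_pos zeta_le]]];
    [apply Rinv_0_lt_compat; lra|].
  set (B_large := ((Rabs M ^ k) ^ 2)%R). set (B_small := (((12 * (1 / 2 + T)) ^ k) ^ 2)%R).
  pose proof (pow2_ge_0 (Rabs M ^ k) : 0 <= B_large).
  pose proof (pow2_ge_0 ((12 * (1 / 2 + T)) ^ k) : 0 <= B_small).
  exists (B_large + 2 * B_small)%R. split; [lra|]. intros t.
  destruct (Cmod_critical_line_ge t) as [s_ge t_le].
  assert (sqrt_ge : 1 / 2 <= sqrt (Cmod (critical_line t))).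
  { rewrite <- (sqrt_pow2 (1 / 2)) by lra. apply sqrt_le_1_alt. lra. }
  destruct (Rle_lt_dec T (Rabs t)) as [t_large|t_small].
  - apply Rle_trans with (B_large * sqrt (Cmod (critical_line t)))%R;
      [|apply Rmult_le_compat_r; lra].
    apply Rle_trans with (((Rabs M * Rpower (Rabs t) (/ (4 * INR k))) ^ k) ^ 2)%R.
    + apply pow_incr. split; [apply pow_le, Cmod_ge_0|]. apply pow_incr.
      split; [apply Cmod_ge_0|].
      eapply Rle_trans; [now apply zeta_le|].
      apply Rmult_le_compat_r; [apply Rlt_le, exp_pos | apply Rle_abs].
    + rewrite !Rpow_mult_distr. apply Rmult_le_compat_l; [easy|]. rewrite !Rpower_pow_l.
      replace (/ (4 * INR k) * INR k * INR 2)%R with (/ 2)%R by (simpl; field; lra).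
      rewrite Rpower_sqrt by lra. now apply sqrt_le_1_alt.
  - apply Rle_trans with (2 * B_small * sqrt (Cmod (critical_line t)))%R;
      [|apply Rmult_le_compat_r; lra].
    apply Rle_trans with B_small; [|nra].
    apply pow_incr. split; [apply pow_le, Cmod_ge_0|]. apply pow_incr. split; [apply Cmod_ge_0|].
    eapply Rle_trans; [apply Cmod_zeta_critical_line_le|]. apply Rmult_le_compat_l; [lra|].
    eapply Rle_trans; [apply Cmod_le_Re_Im|]. simpl. rewrite (Rabs_pos_eq (1 / 2)); lra.
Qed.

Lemma lindelof_zeta_disc_coeff_square_summable (k : nat) : (1 <= k)%nat -> Lindelof ->
  ex_series (fun m => Cmod (zeta_disc_coeff k m) ^ 2)%R.
Proof.
  intros k_ge1 lindelof. destruct (lindelof_zeta_pow_le k k_ge1 lindelof) as [B [B_ge0 zeta_le]].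
  apply (taylor_coeffs_square_summable (fun w => zeta_disc w ^ k) _ k (12 ^ k) B);
    [easy | | | |apply zeta_disc_pow_taylor].
  - intros c c_pos. apply (poly_approx_zeta_disc_pow _ c (fun w => w));
      [apply disc_away_bounded | easy | |].
    + apply poly_approx_id.
    + now intros w [_ Re_ge].
  - intros w w_le. rewrite Cmod_pow, <- Rpow_mult_distr. apply pow_incr.
    split; [apply Rmult_le_pos; apply Cmod_ge_0 | now apply Cmod_zeta_disc_growth].
  - intros w w_on v_neq0. destruct (line_to_circle_surj w w_on v_neq0) as [t ->].
    rewrite zeta_disc_line_to_circle, line_to_circle_1_plus, Cmod_inv, Rinv_inv
      by apply critical_line_neq0.
    rewrite Cmod_pow, Cmod_mult, Cmod_line_to_circle, Rmult_1_l. apply zeta_le.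
Qed.

Lemma is_Clim_0_of_square_summable (a : nat -> C) :
  ex_series (fun n => Cmod (a n) ^ 2)%R -> is_Clim a 0.
Proof.
  intros a_sq. apply is_Clim_spec. intros eps eps_pos.
  apply filter_imp with (2 := is_lim_seq_0_eventually_le _ (eps ^ 2)
    (ex_series_lim_0 _ a_sq) ltac:(nra)).
  intros n a_le. replace (a n - 0) with (a n) by ring. pose proof (Cmod_ge_0 (a n)). nra.
Qed.

Lemma zeta_disc_coeff_square_summable (k : nat) :
  ex_series (fun n : nat => (Cmod (ell (Z.of_nat n) k)) ^ 2)%R ->
  ex_series (fun m => Cmod (zeta_disc_coeff k m) ^ 2)%R.
Proof.
  intros ell_sq. apply (ex_series_incr_n _ k).
  apply (ex_series_ext (fun n : nat => Cmod (ell (Z.of_nat n) k) ^ 2)%R); [|easy].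
  intros n. unfold zeta_disc_coeff. do 3 f_equal. lia.
Qed.

Local Close Scope C_scope.

Theorem theorem2 :
  (forall k : nat, (1 <= k)%nat ->
     ex_series (fun n : nat => (Cmod (ell (Z.of_nat n) k)) ^ 2) ->
     forall t : R, expansion_holds k t)
  /\
  (Lindelof -> forall k : nat, (1 <= k)%nat -> forall t : R, expansion_holds k t).
Proof.
  split.
  - intros k _ ell_sq t.
    now apply expansion_of_coeff_lim_0, is_Clim_0_of_square_summable,
      zeta_disc_coeff_square_summable.
  - intros lindelof k k_ge1 t.
    now apply expansion_of_coeff_lim_0, is_Clim_0_of_square_summable,
      lindelof_zeta_disc_coeff_square_summable.
Qed.
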